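(* Let $(\xi_k)_{k\ge 0}$ be a Markov chain satisfying the lower bound condition (with constant $a>0$) described in the context, let $X_j=g_j(\xi_j)$, $j\ge 0$, with $g_j$ real-valued measurable functions, let $S_n=\sum_{k=1}^n X_k$, and let $f_k(t)=\mathbb{E}(\exp(itX_k))$. Let $(B_n)$ be a sequence of positive numbers with $B_n\to\infty$ and let $L$ be a random variable with integrable characteristic function $f_L$ and continuous density $h_L$ such that $S_n/B_n\Rightarrow L$. Assume: Condition A: there are $\delta>0$, $n_0\in\mathbb{N}$ and a Borel function $G:[1,\infty)\to(0,\infty)$ such that for all $n>n_0$ and all real $u$ with $1\le |u|\le \delta B_n$, $$\frac{a^4}{2^4}\sum_{k=1}^n\Big(1-\Big|f_k\Big(\frac{u}{B_n}\Big)\Big|^2\Big)>G(|u|),$$ and $\exp(-G(|u|))$ is integrable (in $u$, over $|u|\ge 1$). (i) Suppose that not all the variables have values in a fixed lattice $\{kh:k\in\mathbb{Z}\}$, $h>0$, and that the following holds: Condition B: for every $u\ne 0$ there are $\varepsilon=\varepsilon(u)>0$, $c(u)$ and $n_0=n_0(u)$ such that for all $t$ with $|t-u|\le\varepsilon$ and all $n>n_0$, $$\frac{a^4}{2^4\,(\ln B_n)}\sum_{k=1}^n(1-|f_k(t)|^2)\ge c(u)>1.$$ Then for every continuous function $\varphi$ on $\mathbb{R}$ with compact support, $$\lim_{n\to\infty}\sup_{u\in\mathbb{R}}\Big|B_n\mathbb{E}\varphi(S_n+u)-h_L\Big(-\frac{u}{B_n}\Big)\int\varphi(t)\,\lambda(dt)\Big|=0,$$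 where $\lambda$ is Lebesgue measure. (ii) Suppose that all the variables have values in a fixed lattice $\mathcal{S}=\{kh:k\in\mathbb{Z}\}$ for some $h>0$, and that the requirement in Condition B holds for every $u$ with $0<|u|\le\pi/h$ (instead of for every $u\neq 0$). Then for every continuous function $\varphi$ on $\mathbb{R}$ with compact support, $$\lim_{n\to\infty}\sup_{u\in\mathcal{S}}\Big|B_n\mathbb{E}\varphi(S_n+u)-h_L\Big(-\frac{u}{B_n}\Big)\int\varphi(v)\,\mathcal{L}_h(dv)\Big|=0,$$ where $\mathcal{L}_h$ is the measure assigning mass $h$ to each point $kh$, $k\in\mathbb{Z}$.
   Context: $(\xi_k)_{k\ge0}$ is a (not necessarily stationary or homogeneous) Markov chain on a probability space $(\Omega,\mathcal{K},\mathbb{P})$ with values in a measurable space $(\mathcal{X},\mathcal{B}(\mathcal{X}))$, with regular transition probabilities $Q_k(x,A)=\mathbb{P}(\xi_k\in A\mid\xi_{k-1}=x)$ and marginal distributions $\mathbb{P}_k(A)=\mathbb{P}(\xi_k\in A)$. Lower bound condition: there is a constant $a>0$ such that for all $k\ge 1$ there is $\mathcal{X}_k'\in\mathcal{B}(\mathcal{X})$ with $\mathbb{P}_{k-1}(\mathcal{X}_k')=1$ such that for all $A\in\mathcal{B}(\mathcal{X})$ and all $x\in\mathcal{X}_k'$, $Q_k(x,A)\ge a\,\mathbb{P}_k(A)$. $\Rightarrow$ denotes convergence in distribution. ''The variables'' in (i) and (ii) are the $X_j$. Since $f_L$ is integrable, $L$ has a continuous density, denoted $h_L$ (not to be confused with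 the lattice spacing $h$). *)

(* Defs.v *)
From HB Require Import structures.
From mathcomp Require Import all_boot all_order all_algebra.
From mathcomp Require Import all_classical all_reals all_analysis.
From mathcomp.real_closed Require Import complex.

Set Implicit Arguments.
Unset Strict Implicit.
Unset Printing Implicit Defensive.

Import Order.TTheory GRing.Theory Num.Theory.
Import numFieldNormedType.Exports.

Local Open Scope classical_set_scope.
Local Open Scope ring_scope.

(* Complex-valued functions are integrated componentwise. *)
Definition cRintegral (d : measure_display) (T : measurableType d)
    (R : realType) (mu : {measure set T -> \bar R}) (D : set T)
    (F : T -> R[i]) : R[i] :=
  Complex (\int[mu]_(x in D) complex.Re (F x))
          (\int[mu]_(x in D) complex.Im (F x)).

Definition cintegrable (d : measure_display) (T : measurableType d)
    (R : realType) (mu : {measure set T -> \bar R}) (D : set T)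
    (F : T -> R[i]) : Prop :=
  mu.-integrable D (fun x => (complex.Re (F x))%:E) /\
  mu.-integrable D (fun x => (complex.Im (F x))%:E).

(* [cexpi x] is $e^{ix}$. *)
Definition cexpi (R : realType) (x : R) : R[i] := Complex (cos x) (sin x).

Definition charfun (d : measure_display) (T : measurableType d) (R : realType)
    (P : probability T R) (Y : T -> R) (t : R) : R[i] :=
  cRintegral P setT (fun w => cexpi (t * Y w)).

Definition partial_sum (T : Type) (R : realType) (Y : nat -> T -> R) (n : nat)
    (w : T) : R :=
  \sum_(1 <= k < n.+1) Y k w.

(* Weak convergence of the laws, tested on bounded continuous functions; the
   limit may live on another probability space. *)
Definition cvg_in_distribution (d d' : measure_display)
    (T : measurableType d) (T' : measurableType d') (R : realType)
    (P : probability T R) (Y : nat -> T -> R)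
    (P' : probability T' R) (L : T' -> R) : Prop :=
  forall f : R -> R, continuous f -> bounded_fun f ->
    (\int[P]_w f (Y n w)) @[n --> \oo] --> \int[P']_w f (L w).

Definition is_density (d : measure_display) (T : measurableType d)
    (R : realType) (P : probability T R) (L : {RV P >-> R}) (hL : R -> R) :
    Prop :=
  [/\ measurable_fun [set: R] hL, forall x, 0 <= hL x &
      forall A : set R, measurable A ->
        distribution P L A = (\int[lebesgue_measure]_(x in A) (hL x)%:E)%E].

Section markov_chain.
Context (d dX : measure_display) (T : measurableType d)
  (X : measurableType dX) (R : realType) (P : probability T R).
Variable xi : nat -> {RV P >-> X}.

(* The sigma-algebra generated by [xi 0, ..., xi k]. *)
Definition past (k : nat) : set (set T) :=
  <<s \bigcup_(j in [set j | (j <= k)%N])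
        preimage_set_system [set: T] (xi j) measurable >>.

(* [Q k] is the transition kernel from time [k - 1] to time [k], for [k >= 1];
   [Q 0] plays no role. The equation says that [Q k.+1 (xi k _) A] is a version
   of the conditional probability of [xi k.+1 \in A] given the past up to time
   [k]: this is both the Markov property and the fact that the [Q k] are
   regular transition probabilities of the chain. *)
Definition markov_chain (Q : nat -> R.-pker X ~> X) : Prop :=
  forall (k : nat) (E : set T) (A : set X), past k E -> measurable A ->
    P (E `&` xi k.+1 @^-1` A) = (\int[P]_(w in E) Q k.+1 (xi k w) A)%E.

Definition lower_bound_condition (Q : nat -> R.-pker X ~> X) (a : R) : Prop :=
  forall k : nat, (1 <= k)%N ->
    exists X' : set X, [/\ measurable X',
      distribution P (xi k.-1) X' = 1%E &
      forall (A : set X) (x : X), measurable A -> X' x ->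
        (a%:E * distribution P (xi k) A <= Q k x A)%E].

End markov_chain.

Section conditions.
Context (R : realType).
Variables (a : R) (f : nat -> R -> R[i]) (B : nat -> R).

(* [G] is a function on [1, +oo[; its values elsewhere are irrelevant. *)
Definition condition_A : Prop :=
  exists (delta : R) (n0 : nat) (G : R -> R),
    [/\ 0 < delta,
        measurable_fun (`[1, +oo[ : set R) G /\ (forall x, 1 <= x -> 0 < G x),
        forall (n : nat) (u : R), (n0 < n)%N -> 1 <= `|u| <= delta * B n ->
          G `|u| < a ^+ 4 / 2 ^+ 4 *
            \sum_(1 <= k < n.+1) (1 - Normc.normc (f k (u / B n)) ^+ 2) &
        lebesgue_measure.-integrable [set u : R | 1 <= `|u|]
          (fun u => (expR (- G `|u|))%:E)].

(* The requirement of Condition B, for the frequencies [u] in [U]. *)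
Definition condition_B_on (U : set R) : Prop :=
  forall u : R, U u ->
    exists (eps c : R) (n0 : nat),
      [/\ 0 < eps, 1 < c &
          forall (t : R) (n : nat), `|t - u| <= eps -> (n0 < n)%N ->
            c <= a ^+ 4 / (2 ^+ 4 * ln (B n)) *
              \sum_(1 <= k < n.+1) (1 - Normc.normc (f k t) ^+ 2)].

End conditions.

Definition compactly_supported (R : realType) (phi : R -> R) : Prop :=
  compact (closure [set x | phi x != 0]).

Definition lattice (R : realType) (h : R) : set R :=
  range (fun k : int => k%:~R * h).

Lemma measurable_lattice (R : realType) (h : R) : measurable (lattice h).
Proof.
apply: countable_measurable; first by move=> x; exact: measurable_set1.
exact: (sub_countable (card_image_le _ _)).
Qed.

(* The measure with mass [h] at each point of [lattice h]. *)
Definition lattice_measure (R : realType) (h : {posnum R}) :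
    {measure set R -> \bar R} :=
  mscale h%:num%:nng (mrestr counting (measurable_lattice h%:num)).

(* Main.v *)
Require Import Defs.
From HB Require Import structures.
From mathcomp Require Import all_boot all_order all_algebra.
From mathcomp Require Import all_classical all_reals all_analysis.
From mathcomp Require Import measurable_realfun lebesgue_integral_under.
From mathcomp Require Import ring lra zify.
From mathcomp.real_closed Require Import complex.

(** Everything rests on the decay of E exp (i t S_n).

    Decay.  By the lower bound condition every transition law dominates a
    times the next marginal law.  Let h_k be the conditional expectation of
    exp (i t (X_{k+1} + ... + X_n)) given the state at time k, so that
    h_{k-1} = T_k h_k for the operator T_k h = \int Q_k(., dy) e^{i t g_k(y)} h(y).
    If |h| <= M, the part of T_k h coming from the marginal law is a constant,
    so T_k h is a constant up to an error (1 - a) M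
    ([transfer_nearly_constant]), and applying T_{k-1} to such a function
    multiplies the bound by 1 - a^2 (1 - |f_{k-1}(t)|)
    ([transfer_contracts]).  One factor is thus gained every second step;
    following the product of two consecutive bounds collects each factor once,
    and gives |E exp (i t S_n)| <= exp (- a^2 / 4 * \sum_k (1 - |f_k(t)|^2))
    ([normc_charfun_partial_sum]).  As a <= 1, the constant a^4 / 2^4 of
    Conditions A and B is not larger than a^2 / 4.

    Local limit for special kernels.  Let w be integrable, bounded by 1, null
    outside [-kappa, kappa], with w(t) -> 1 as t -> 0, and let K be its cosine
    transform.  By Fubini and the substitution t = s / B_n, B_n E K(S_n + v) is
    the integral over s of w(s / B_n) times the real part of
    E exp (i s (S_n + v) / B_n), while 2 pi h_L(- v / B_n) is, by Fourier
    inversion, the integral of the real part of E exp (i s (L + v / B_n)).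
    Their difference is at most an L^1 distance which does not involve v.  It
    tends to 0: for |s| <= delta B_n by dominated convergence, with a dominating
    function provided by Condition A, and for delta B_n <= |s| <= kappa B_n
    because Condition B makes the transform of S_n uniformly o(1 / B_n) at the
    frequencies between delta and kappa ([kernel_local_limit]).

    Test functions on the line.  With w a triangle function K is a Fejer
    kernel.  A continuous phi with compact support is approximated by averages of
    Fejer kernels with an error eta / (1 + x^2)
    ([band_limited_approximation]), and 1 / (1 + x^2) is dominated by the sum
    of a Fejer kernel and of its translate by pi, to which the special local
    limit applies; so B_n times the expected error is O(eta)
    ([nonlattice_limit]).

    Test functions on a lattice.  With w the indicator of [-pi/h, pi/h], K
    vanishes at all the points of the lattice but 0, so that E K(S_n + u - x) is
    2 pi / h times the probability that S_n + u = x.  On the lattice phi is a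
    finite combination of indicators of points ([lattice_limit]).

    In both cases h_L is uniformly continuous, which absorbs the bounded shifts
    due to the support of phi. *)

Set Implicit Arguments.
Unset Strict Implicit.
Unset Printing Implicit Defensive.

Import Order.TTheory GRing.Theory Num.Theory.
Import numFieldNormedType.Exports.

Local Open Scope classical_set_scope.
Local Open Scope ring_scope.

#[local] Arguments Normc.normc : simpl never.

(** * Integration lemmas *)

Section Rintegral_tools.
Context d (T : measurableType d) (R : realType).
Variable mu : {measure set T -> \bar R}.
Implicit Types f g : T -> R.

Lemma integrable_le f g : measurable_fun setT f ->
  mu.-integrable setT (EFin \o g) -> (forall x, `|f x| <= g x) ->
  mu.-integrable setT (EFin \o f).
Proof.
move=> mf ig fg; apply: le_integrable ig => //; first exact/measurable_EFinP.
by move=> x _ /=; rewrite lee_fin (le_trans (fg x))// ler_norm.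
Qed.

Lemma integrable_mulr f g (M : R) : mu.-integrable setT (EFin \o f) ->
  measurable_fun setT g -> (forall x, `|g x| <= M) ->
  mu.-integrable setT (EFin \o (fun x => f x * g x)).
Proof.
move=> fi mg gM; have mf := measurable_int _ fi.
apply: (@integrable_le _ (fun x => M * `|f x|)).
- by apply: measurable_funM => //; exact/measurable_EFinP.
- apply: (@integrableZl _ _ _ _ _ measurableT M (fun x => (`|f x|)%:E)).
  exact: integrable_norm.
- by move=> x; rewrite normrM mulrC ler_wpM2r.
Qed.

Lemma Rintegral_bound f g : mu.-integrable setT (EFin \o g) ->
  measurable_fun setT f -> (forall x, `|f x| <= g x) ->
  `|\int[mu]_x f x| <= \int[mu]_x g x.
Proof.
move=> ig mf fg; have fi := integrable_le mf ig fg.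
apply: le_trans (le_normr_Rintegral measurableT fi) _.
by apply: le_Rintegral => //; exact: integrable_norm.
Qed.

(** Dominated convergence, the domination being required for large n only:
    Condition A says nothing about the first terms. *)
Lemma cvg_Rintegral (f_ : (T -> R)^nat) f g : (forall n, measurable_fun setT (f_ n)) ->
  measurable_fun setT f ->
  (forall x, f_ n x @[n --> \oo] --> f x) ->
  mu.-integrable setT (EFin \o g) ->
  (\forall n \near \oo, forall x, `|f_ n x| <= g x) ->
  \int[mu]_x f_ n x @[n --> \oo] --> \int[mu]_x f x.
Proof.
move=> mf_ mf ff ig [N _ fg].
have fi : mu.-integrable setT (EFin \o f).
  apply: integrable_le mf ig _ => x.
  have h : `|f_ n x| @[n --> \oo] --> `|f x| by exact: cvg_norm (ff x).
  rewrite -(cvg_lim _ h)//; apply: limr_le; first by apply: cvgP h.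
  by exists N => // n /= Nn; exact: fg.
rewrite -(cvg_shiftn N) /Rintegral; apply: fine_cvg.
rewrite fineK; last exact: integrable_fin_num.
apply: (@dominated_cvg _ _ _ mu setT _ (fun n x => (f_ (n + N)%N x)%:E)
   (EFin \o f) (EFin \o g)) => //.
- by move=> n; exact/measurable_EFinP.
- move=> x _; apply: cvg_EFin; first exact: nearW.
  by have := ff x; rewrite -(cvg_shiftn N).
- by move=> n x _ /=; rewrite lee_fin fg//= leq_addl.
Qed.

End Rintegral_tools.

Section probability_tools.
Context d (T : measurableType d) (R : realType).
Variable P : probability T R.
Implicit Types f g : T -> R.

Lemma integrable_bounded (M : R) f : measurable_fun setT f ->
  (forall x, `|f x| <= M) -> P.-integrable setT (EFin \o f).
Proof.
move=> mf fM; apply: (@integrable_le _ _ _ _ f (cst M)) => //.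
exact: finite_measure_integrable_cst.
Qed.

Lemma Rintegral_prob_cst (c : R) : \int[P]_x c = c.
Proof.
rewrite Rintegral_cst//; set m := (X in fine X).
by have -> : m = 1%E by [exact: probability_setT]; rewrite mulr1.
Qed.

Lemma Rintegral_prob_bound (M : R) f : measurable_fun setT f ->
  (forall x, `|f x| <= M) -> `|\int[P]_x f x| <= M.
Proof.
move=> mf fM; rewrite -[leRHS]Rintegral_prob_cst.
by apply: Rintegral_bound => //; exact: (integrable_bounded (M := `|M|)).
Qed.

End probability_tools.

Section Fubini_tools.
Context d d' (T : measurableType d) (T' : measurableType d') (R : realType).
Variables (mu : {sigma_finite_measure set T -> \bar R})
          (nu : {sigma_finite_measure set T' -> \bar R}).

Variables (f : T -> T' -> R) (g : T -> R) (h : T' -> R).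
Hypothesis mf : measurable_fun setT (fun z => f z.1 z.2).
Hypothesis ig : mu.-integrable setT (EFin \o g).
Hypothesis ih : nu.-integrable setT (EFin \o h).
Hypothesis fgh : forall x y, `|f x y| <= g x * h y.

Let int_fx x : nu.-integrable setT (fun y => (f x y)%:E).
Proof.
apply: (@integrable_le _ _ _ nu (f x) (fun y => g x * h y)) => //.
  exact: measurableT_comp mf (measurable_pair1 x).
exact: (@integrableZl _ _ _ _ _ measurableT (g x) (EFin \o h)).
Qed.

Let int_fy y : mu.-integrable setT (fun x => (f x y)%:E).
Proof.
apply: (@integrable_le _ _ _ mu (f ^~ y) (fun x => g x * h y)) => //.
  exact: measurableT_comp mf (measurable_pair2 y).
exact: (@integrableZr _ _ _ _ _ measurableT (h y) (EFin \o g)).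
Qed.

(** Domination by a product of integrable functions is what all the exchanges
    of integrals below satisfy: their integrands are products of a weight in one
    variable, a function of the other, and a cosine. *)
Lemma integrable_prod : (mu \x nu)%E.-integrable setT (fun z => (f z.1 z.2)%:E).
Proof.
apply/integrable12ltyP; first exact/measurable_EFinP.
apply: (@le_lt_trans _ _ (\int[mu]_x (`|g x| * \int[nu]_y `|h y|)%:E)%E).
  apply: ge0_le_integral => //.
  - by move=> x _; apply: integral_ge0.
  - apply: (@measurable_fun_fubini_tonelli_F _ _ _ _ _ nu
      (fun z => `|(f z.1 z.2)%:E|%E)) => //.
    by apply: measurableT_comp => //; exact/measurable_EFinP.
  - apply/measurable_EFinP/measurable_funM => //.
    apply: measurableT_comp => //.
    by apply/measurable_EFinP; exact: measurable_int ig.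
  - move=> x _.
    apply: (@le_trans _ _ (\int[nu]_y (`|g x| * `|h y|)%:E)%E).
      apply: ge0_le_integral => //.
      + by apply: measurableT_comp => //; exact: measurable_int (int_fx x).
      + apply/measurable_EFinP/measurable_funM => //.
        apply: measurableT_comp => //.
        by apply/measurable_EFinP; exact: measurable_int ih.
      + by move=> y _; rewrite lee_fin (le_trans (fgh x y))// -normrM ler_norm.
    rewrite EFinM /Rintegral fineK; last first.
      by apply: integrable_fin_num => //; exact: integrable_norm.
    by rewrite -integralZl//; exact: integrable_norm.
under eq_integral do rewrite EFinM.
rewrite integralZr//; last exact: integrable_norm.
rewrite lte_mul_pinfty//.
- by apply: integral_ge0 => x _; rewrite lee_fin.
- by apply: integrable_fin_num => //; exact: integrable_norm.
- by rewrite ltry.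
Qed.

Lemma measurable_Rintegral_Fubini : measurable_fun setT (fun x => \int[nu]_y f x y).
Proof.
rewrite /Rintegral; apply: measurableT_comp => //.
exact: measurable_fubini_F integrable_prod.
Qed.

Lemma Rintegral_Fubini :
  \int[mu]_x \int[nu]_y f x y = \int[nu]_y \int[mu]_x f x y.
Proof.
rewrite /Rintegral; congr fine.
transitivity (\int[mu]_x \int[nu]_y (f x y)%:E)%E.
  by apply: eq_integral => x _; rewrite fineK//; exact: integrable_fin_num.
rewrite (Fubini integrable_prod).
by apply: eq_integral => y _; rewrite fineK//; exact: integrable_fin_num.
Qed.

End Fubini_tools.

(** * Affine changes of variables and densities *)

Section affine_change_of_variables.
Context (R : realType).
Local Notation mu := (@lebesgue_measure R).
Variables (r b : R).
Hypothesis r0 : 0 < r.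

Let af (x : measurableTypeR R) : measurableTypeR R := r * x + b.
Let maf : measurable_fun setT af.
Proof.
have : measurable_fun setT (fun x : R => r * x + b); last by [].
by apply: measurable_funD => //; exact: measurable_funM.
Qed.

Let af_mixin := isMeasurableFun.Build _ _ _ _ _ maf.
Let afm : {mfun (measurableTypeR R) >-> (measurableTypeR R)} := HB.pack af af_mixin.

(** Both sides are measures in A, and they agree on half-open intervals. *)
Lemma lebesgue_measure_affine (A : set R) : measurable A ->
  mu A = (r%:E * mu ((fun x => r * x + b)%R @^-1` A))%E.
Proof.
move=> mA.
have := @lebesgue_measure_unique R (mscale (NngNum (ltW r0)) (pushforward mu afm)).
apply => // _ [[p q] _ <-].
rewrite /= /mscale/= /pushforward/=.
have -> : af @^-1` `]p, q] = `](p - b) / r, (q - b) / r]%classic.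
  apply/seteqP; split=> x /=; rewrite !in_itv/= /af ltr_pdivrMr// ler_pdivlMr//;
    by rewrite ltrBlDr lerBrDr mulrC.
rewrite !lebesgue_measure_itv/= !lte_fin ltr_pM2r ?invr_gt0// ltrBlDr subrK.
case: ifPn => pq; last by rewrite mule0.
by rewrite -!EFinD -EFinM; congr EFin; field; rewrite gt_eqF.
Qed.

Lemma ge0_integral_affine (f : R -> \bar R) : measurable_fun setT f ->
  (forall x, 0 <= f x)%E ->
  (\int[mu]_x f x = r%:E * \int[mu]_x f (r * x + b)%R)%E.
Proof.
move=> mf f0.
rewrite (@eq_measure_integral _ _ _ _
  (mscale (NngNum (ltW r0)) (pushforward mu afm))); last first.
  by move=> A mA _; exact: lebesgue_measure_affine.
by rewrite ge0_integral_mscale//= ge0_integral_pushforward.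
Qed.

Lemma integrable_affine (f : R -> R) : mu.-integrable setT (EFin \o f) ->
  mu.-integrable setT (fun x => (f (r * x + b))%:E).
Proof.
move=> fi; have mf : measurable_fun setT f.
  by apply/measurable_EFinP; exact: measurable_int fi.
apply/integrableP; split; first exact/measurable_EFinP/measurableT_comp.
move/integrableP : fi => [_].
rewrite (ge0_integral_affine (f := fun x => `|(f x)%:E|%E))//; last first.
  by apply: measurableT_comp => //; exact/measurable_EFinP.
by rewrite muleC -lte_pdivlMr// => /lt_le_trans; apply; rewrite mulr_infty gtr0_sg ?invr_gt0// mul1e.
Qed.

Lemma Rintegral_affine (f : R -> R) : mu.-integrable setT (EFin \o f) ->
  \int[mu]_x f x = r * \int[mu]_x f (r * x + b).
Proof.
move=> fi; have mf := measurable_int _ fi.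
have gi := integrable_affine fi.
rewrite -[X in X * _]/(fine r%:E) -fineM//; last exact: integrable_fin_num.
rewrite /Rintegral; congr fine.
rewrite integralE [in RHS]integralE muleBr//; last first.
  rewrite fin_num_adde_defl// fin_numN.
  by apply: integrable_fin_num => //; exact: integrable_funeneg.
congr (_ - _)%E.
- rewrite ge0_integral_affine//; last exact: measurable_funepos.
  by congr (_ * _)%E; apply: eq_integral => x _; rewrite !funeposE.
- rewrite ge0_integral_affine//; last exact: measurable_funeneg.
  by congr (_ * _)%E; apply: eq_integral => x _; rewrite !funenegE.
Qed.

End affine_change_of_variables.

(** The Radon-Nikodym derivative of [nu] equals [h] almost everywhere, since
    both have the same integral over every measurable set. *)
Lemma integral_with_density d (T : measurableType d) (R : realType)
    (nu : {finite_measure set T -> \bar R})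
    (mu : {sigma_finite_measure set T -> \bar R}) (h : T -> R) :
  measurable_fun setT h ->
  (forall A, measurable A -> nu A = \int[mu]_(x in A) (h x)%:E)%E ->
  forall f : T -> R, nu.-integrable setT (EFin \o f) ->
  \int[nu]_x f x = \int[mu]_x (f x * h x).
Proof.
move=> mh nuh f fi; have mf : measurable_fun setT f.
  by apply/measurable_EFinP; exact: measurable_int fi.
have numu : nu `<< mu.
  apply/null_content_dominatesP => A mA A0; rewrite nuh//.
  by apply: null_set_integral => //; exact/measurable_EFinP/measurable_funTS.
congr fine; rewrite -(Radon_Nikodym_change_of_variables numu)//=.
apply: ae_eq_integral => //.
- apply: emeasurable_funM; first exact/measurable_EFinP.
  by apply: measurable_int; exact: Radon_Nikodym_integrable.
- by apply/measurable_EFinP; exact: measurable_funM.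
- under [X in ae_eq _ _ _ X]eq_fun do rewrite EFinM.
  apply: ae_eqe_mul2l; apply: integral_ae_eq => //=.
  + exact: Radon_Nikodym_integrable.
  + exact/measurable_EFinP.
  + by move=> E _ mE; rewrite -Radon_Nikodym_integral//=; exact: nuh.
Qed.

Lemma Rintegral_density d (T : measurableType d) (R : realType)
    (P : probability T R) (L : {RV P >-> R}) (h : R -> R) :
  is_density L h ->
  forall (M : R) (f : R -> R), measurable_fun setT f -> (forall x, `|f x| <= M) ->
  \int[P]_w f (L w) = \int[lebesgue_measure]_x (f x * h x).
Proof.
move=> [mh h0 hL] M f mf fM.
have mL : measurable_fun setT (L : T -> measurableTypeR R).
  exact: (measurable_funP L).
pose Lmixin := isMeasurableFun.Build _ _ _ _ _ mL.
pose L' : {mfun T >-> measurableTypeR R} := HB.pack (L : T -> measurableTypeR R) Lmixin.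
have fi : (distribution P L').-integrable setT (EFin \o f).
  exact: (@integrable_bounded _ (measurableTypeR R) R (distribution P L') M).
have /(_ f fi) <- := @integral_with_density _ (measurableTypeR R) R
  (distribution P L') (@lebesgue_measure R) h mh hL.
congr fine; apply/esym.
apply: (@integral_distribution _ _ T (measurableTypeR R) R P L' (EFin \o f)).
- exact/measurable_EFinP.
- by apply: (@integrable_bounded _ _ _ P M) => //; exact: measurableT_comp.
Qed.

Lemma integrable_density d (T : measurableType d) (R : realType)
    (P : probability T R) (L : {RV P >-> R}) (h : R -> R) :
  is_density L h -> lebesgue_measure.-integrable setT (EFin \o h).
Proof.
move=> [mh h0 hL]; apply/integrableP; split; first exact/measurable_EFinP.
under eq_integral do rewrite /= ger0_norm//.
by rewrite -hL// probability_setT ltry.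
Qed.

(** * Uniform approximation by step functions *)

(** The sum is the integer part of z. *)
Lemma count_below (R : realType) (J : nat) (z : R) : 0 <= z <= J%:R ->
  z - 1 <= \sum_(j < J) (j.+1%:R <= z)%R%:R <= z.
Proof.
move=> /andP[z0 zJ].
have up I : \sum_(j < I) (j.+1%:R <= z)%R%:R <= z.
  elim: I => [|I IH]; first by rewrite big_ord0.
  rewrite big_ord_recr /=; case: (leP I.+1%:R z) => Iz /=; last by rewrite addr0.
  apply: le_trans Iz; rewrite -[I.+1%:R]natr1 lerD2r.
  rewrite -[X in _ <= X%:R](card_ord I) -sum1_card natr_sum.
  by apply: ler_sum => j _; case: (_ <= z).
rewrite up andbT; elim: J zJ => [|J IH] zJ; first by rewrite big_ord0; lra.
rewrite big_ord_recr /=; case: (leP z J%:R) => zJ'.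
  by rewrite (le_trans (IH zJ'))// lerDl ler0n.
suff -> : \sum_(j < J) (j.+1%:R <= z)%R%:R = J%:R :> R.
  move: zJ; rewrite -[J.+1%:R]natr1 => zJ; apply: (@le_trans _ _ J%:R); first lra.
  by rewrite lerDl ler0n.
rewrite -[in RHS](card_ord J) -sum1_card natr_sum.
apply: eq_bigr => j _; rewrite (le_trans _ (ltW zJ'))//.
by rewrite ler_nat.
Qed.

Section bounded_measurable_ind.
Context d (T : measurableType d) (R : realType).

(** A monotone-class induction by uniform approximation: f is within e of the
    step function - M + e * floor ((f + M) / e), which is a linear combination of
    indicators of superlevel sets of f. *)
Lemma bounded_measurable_ind (Pr : (T -> R) -> Prop) :
  (forall A, measurable A -> Pr \1_A) ->
  (forall (c : R) (f h : T -> R) (M N : R), measurable_fun setT f -> measurable_fun setT h ->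
    (forall x, `|f x| <= M) -> (forall x, `|h x| <= N) ->
    Pr f -> Pr h -> Pr (fun x => c * f x + h x)) ->
  (forall (f : T -> R) (M : R), measurable_fun setT f -> (forall x, `|f x| <= M) ->
    (forall e : R, 0 < e -> exists (h : T -> R) (N : R), [/\ measurable_fun setT h,
       forall x, `|h x| <= N, Pr h & forall x, `|f x - h x| <= e]) -> Pr f) ->
  forall (f : T -> R) (M : R), measurable_fun setT f ->
    (forall x, `|f x| <= M) -> Pr f.
Proof.
move=> Pind Plin Plim f M mf fM; apply: (Plim f M) => // e e0.
pose s J (x : T) : R := - M * \1_(setT : set T) x +
  \sum_(j < J) e * \1_[set x | e * j.+1%:R <= f x + M] x.
have mA j : measurable [set x | e * j.+1%:R <= f x + M].
  rewrite -[X in measurable X]setTI; apply: measurable_fun_ler => //.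
  exact: measurable_funD.
have sP J : [/\ measurable_fun setT (s J), Pr (s J) &
    exists N : R, forall x, `|s J x| <= N].
  elim: J => [|J [mJ PJ [N JN]]].
    have -> : s 0%N = (fun x => (- M - 1) * \1_(setT : set T) x + \1_(setT : set T) x).
      by apply/funext => x; rewrite /s big_ord0 indicT/=; lra.
    split.
    - by apply: measurable_funD => //; exact: measurable_funM.
    - by apply: (Plin _ _ _ 1 1) => //; try (exact: Pind); move=> x; rewrite indicT normr1.
    - by exists `|- M - 1 + 1| => x; rewrite indicT mulr1.
  have sE : s J.+1 = fun x => e * \1_[set x | e * J.+1%:R <= f x + M] x + s J x.
    by apply/funext => x; rewrite /s big_ord_recr/= addrCA [in RHS]addrC; lra.
  have b1 A (x : T) : `|\1_A x : R| <= 1.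
    by rewrite indicE; case: (_ \in _); rewrite ?normr1 ?normr0.
  rewrite sE; split.
  - apply: measurable_funD => //; apply: measurable_funM => //.
  - apply: (Plin _ _ _ 1 N) => //; last exact/Pind/mA.
  - exists (e + N) => x; rewrite (le_trans (ler_normD _ _))// lerD//.
    by rewrite normrM gtr0_norm// ler_piMr// ltW.
have [J MJ] : exists J : nat, 2 * M / e <= J%:R.
  by exists (Num.truncn (2 * M / e)).+1; rewrite ltW// truncnS_gt.
have [mJ PJ [N JN]] := sP J.
exists (s J), N; split=> // x.
have fMx : - M <= f x <= M by rewrite -ler_norml.
have /(@count_below R J) : 0 <= (f x + M) / e <= J%:R.
  apply/andP; split; first by apply: divr_ge0; [lra|exact: ltW].
  by apply: le_trans MJ; rewrite ler_pM2r ?invr_gt0//; lra.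
have -> : s J x = e * (\sum_(j < J) (j.+1%:R <= (f x + M) / e)%R%:R) - M.
  rewrite /s indicT mulr1 addrC mulr_sumr; congr (_ - M); apply: eq_bigr => j _.
  rewrite indicE; congr (_ * (nat_of_bool _)%:R); rewrite ler_pdivlMr// mulrC.
  by apply/idP/idP; rewrite inE.
set S := \sum_(_ < _) _ => /andP[S1 S2].
have : e * ((f x + M) / e - 1) <= e * S by rewrite ler_pM2l.
have : e * S <= e * ((f x + M) / e) by rewrite ler_pM2l.
have -> : e * ((f x + M) / e - 1) = f x + M - e by field; rewrite gt_eqF.
have -> : e * ((f x + M) / e) = f x + M by field; rewrite gt_eqF.
by move=> ? ?; rewrite ler_norml; apply/andP; split; lra.
Qed.

End bounded_measurable_ind.

(** * Complex-valued integrals *)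

Section complex_modulus.
Context (R : realType).
Implicit Types z : R[i].
Local Notation normc := Normc.normc.

Lemma normcE2 z : normc z = Num.sqrt (complex.Re z ^+ 2 + complex.Im z ^+ 2).
Proof. by case: z. Qed.

Lemma normc_ge0 z : 0 <= normc z. Proof. by rewrite normcE2 sqrtr_ge0. Qed.

Lemma sqr_normcE z : normc z ^+ 2 = complex.Re z ^+ 2 + complex.Im z ^+ 2.
Proof. by rewrite normcE2 sqr_sqrtr// addr_ge0// sqr_ge0. Qed.

Lemma Re_le_normc z : `|complex.Re z| <= normc z.
Proof. by rewrite normcE2 -sqrtr_sqr ler_wsqrtr// lerDl sqr_ge0. Qed.

Lemma Im_le_normc z : `|complex.Im z| <= normc z.
Proof. by rewrite normcE2 -sqrtr_sqr ler_wsqrtr// lerDr sqr_ge0. Qed.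

Lemma normc_real (x : R) : 0 <= x -> normc (x%:C)%C = x.
Proof. by move=> x0; rewrite normcE2/= expr0n addr0 sqrtr_sqr ger0_norm. Qed.

Lemma normc_one : normc (1 : R[i]) = 1.
Proof. by rewrite normcE2/= expr1n expr0n addr0 sqrtr1. Qed.

Lemma normc_cexpi (x : R) : normc (cexpi x) = 1.
Proof. by rewrite normcE2/= cos2Dsin2 sqrtr1. Qed.

Lemma cexpiD (x y : R) : cexpi (x + y) = cexpi x * cexpi y.
Proof. by apply/eqP; rewrite eq_complex/= cosD sinD eqxx/=; apply/eqP; ring. Qed.

(** The modulus of z is the largest real part of its rotations; with
    [proj_le_normc] this reduces bounds on complex integrals to bounds on real
    ones, where one-sided estimates are available. *)
Lemma normc_le_proj z (M : R) :
  (forall c s : R, c ^+ 2 + s ^+ 2 = 1 -> c * complex.Re z + s * complex.Im z <= M) ->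
  normc z <= M.
Proof.
move=> H; have [z0|z0] := eqVneq (normc z) 0.
  have := H 1 0; have := H (-1) 0; rewrite !expr0n/= !addr0 sqrrN expr1n.
  by rewrite !mul0r !addr0 mul1r mulN1r => /(_ erefl) + /(_ erefl); rewrite z0; lra.
have n0 : 0 < normc z by rewrite lt_def z0 normc_ge0.
have := H (complex.Re z / normc z) (complex.Im z / normc z).
rewrite !expr_div_n -mulrDl -sqr_normcE divff ?expf_neq0// => /(_ erefl).
rewrite mulrAC -expr2 [X in _ + X]mulrAC -expr2 -mulrDl -sqr_normcE expr2.
by rewrite mulfK.
Qed.

Lemma proj_le_normc z (c s : R) : c ^+ 2 + s ^+ 2 = 1 ->
  c * complex.Re z + s * complex.Im z <= normc z.
Proof.
move=> cs; rewrite normcE2; set x := complex.Re z; set y := complex.Im z.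
apply: le_trans (ler_norm _) _; rewrite -sqrtr_sqr ler_wsqrtr//.
have -> : x ^+ 2 + y ^+ 2 = (c ^+ 2 + s ^+ 2) * (x ^+ 2 + y ^+ 2) by rewrite cs mul1r.
by rewrite -subr_ge0 (_ : _ - _ = (c * y - s * x) ^+ 2) ?sqr_ge0//; ring.
Qed.

End complex_modulus.

Section complex_integral.
Context d (T : measurableType d) (R : realType).
Local Notation normc := Normc.normc.
Implicit Types (F : T -> R[i]) (P : probability T R).

Definition cmeasurable F := measurable_fun setT (fun x => complex.Re (F x)) /\
  measurable_fun setT (fun x => complex.Im (F x)).

Definition cbounded F := exists M : R, forall x, normc (F x) <= M.

Lemma cmeasurable_cst (c : R[i]) : cmeasurable (fun=> c). Proof. by []. Qed.

Lemma cmeasurableB F1 F2 : cmeasurable F1 -> cmeasurable F2 ->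
  cmeasurable (fun x => F1 x - F2 x).
Proof.
move=> [r1 i1] [r2 i2]; split.
- rewrite (_ : (fun _ => _) = fun x => complex.Re (F1 x) - complex.Re (F2 x)).
    exact: measurable_funB.
  by apply/funext => x; case: (F1 x); case: (F2 x).
- rewrite (_ : (fun _ => _) = fun x => complex.Im (F1 x) - complex.Im (F2 x)).
    exact: measurable_funB.
  by apply/funext => x; case: (F1 x); case: (F2 x).
Qed.

Lemma cmeasurableM F1 F2 : cmeasurable F1 -> cmeasurable F2 ->
  cmeasurable (fun x => F1 x * F2 x).
Proof.
move=> [r1 i1] [r2 i2]; split.
- rewrite (_ : (fun _ => _) = fun x => complex.Re (F1 x) * complex.Re (F2 x) -
    complex.Im (F1 x) * complex.Im (F2 x)).
    by apply: measurable_funB; exact: measurable_funM.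
  by apply/funext => x; case: (F1 x); case: (F2 x).
- rewrite (_ : (fun _ => _) = fun x => complex.Re (F1 x) * complex.Im (F2 x) +
    complex.Im (F1 x) * complex.Re (F2 x)).
    by apply: measurable_funD; exact: measurable_funM.
  by apply/funext => x; case: (F1 x); case: (F2 x).
Qed.

Lemma cmeasurable_cexpi (f : T -> R) : measurable_fun setT f ->
  cmeasurable (fun x => cexpi (f x)).
Proof.
move=> mf; split.
- exact: measurableT_comp (continuous_measurable_fun (@continuous_cos R)) mf.
- exact: measurableT_comp (continuous_measurable_fun (@continuous_sin R)) mf.
Qed.

Lemma cbounded_cst (c : R[i]) : cbounded (fun=> c).
Proof. by exists (normc c). Qed.

Lemma cboundedM F1 F2 : cbounded F1 -> cbounded F2 -> cbounded (fun x => F1 x * F2 x).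
Proof.
by move=> [M1 h1] [M2 h2]; exists (M1 * M2) => x; rewrite Normc.normcM ler_pM// normc_ge0.
Qed.

Lemma cbounded_cexpi (f : T -> R) : cbounded (fun x => cexpi (f x)).
Proof. by exists 1 => x; rewrite normc_cexpi. Qed.

Lemma integrable_Re P F : cmeasurable F -> cbounded F ->
  P.-integrable setT (fun x => (complex.Re (F x))%:E).
Proof.
move=> [r i] [M h]; apply: (@integrable_bounded _ _ _ P M) => // x.
exact: le_trans (Re_le_normc _) (h x).
Qed.

Lemma integrable_Im P F : cmeasurable F -> cbounded F ->
  P.-integrable setT (fun x => (complex.Im (F x))%:E).
Proof.
move=> [r i] [M h]; apply: (@integrable_bounded _ _ _ P M) => // x.
exact: le_trans (Im_le_normc _) (h x).
Qed.

Lemma cRintegralB P F1 F2 : cmeasurable F1 -> cbounded F1 ->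
  cmeasurable F2 -> cbounded F2 ->
  cRintegral P setT (fun x => F1 x - F2 x) =
  cRintegral P setT F1 - cRintegral P setT F2.
Proof.
move=> m1 b1 m2 b2; apply/eqP; rewrite eq_complex/=.
have ir1 := integrable_Re P m1 b1; have ir2 := integrable_Re P m2 b2.
have ii1 := integrable_Im P m1 b1; have ii2 := integrable_Im P m2 b2.
rewrite -!RintegralB//; apply/andP; split; apply/eqP; apply: eq_Rintegral => x _;
  by case: (F1 x); case: (F2 x).
Qed.

Lemma cRintegralZl P (c : R[i]) F : cmeasurable F -> cbounded F ->
  cRintegral P setT (fun x => c * F x) = c * cRintegral P setT F.
Proof.
move=> m b; case: c => c1 c2; apply/eqP.
rewrite eq_complex /cRintegral/=.
have ir := integrable_Re P m b; have ii := integrable_Im P m b.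
have zr k := integrableZl measurableT k ir.
have zi k := integrableZl measurableT k ii.
apply/andP; split; apply/eqP.
- rewrite -!RintegralZl// -RintegralB//; [|exact: zr|exact: zi].
  by apply: eq_Rintegral => x _; case: (F x).
 - rewrite -!RintegralZl// -RintegralD//; [|exact: zi|exact: zr].
  by apply: eq_Rintegral => x _; case: (F x).
Qed.

(** As [M - w] is nonnegative, its integral against [mu] is at least its
    integral against [a * nu]; a common part [nu] of weight a can thus be split
    off, and the remaining mass 1 - a contributes at most (1 - a) M. *)
Lemma minorized_Rintegral (mu nu : probability T R) (a M N : R) (w : T -> R) :
  0 <= a -> (forall A, measurable A -> (a%:E * nu A <= mu A)%E) ->
  measurable_fun setT w -> (forall x, `|w x| <= N) -> (forall x, w x <= M) ->
  \int[mu]_x w x - a * \int[nu]_x w x <= (1 - a) * M.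
Proof.
move=> a0 numu mw wN wM.
have iw (m : probability T R) : m.-integrable setT (EFin \o w).
  exact: integrable_bounded mw wN.
have iM (m : probability T R) : m.-integrable setT (EFin \o cst M).
  exact: finite_measure_integrable_cst.
have eM (m : probability T R) : \int[m]_x (M - w x) = M - \int[m]_x w x.
  rewrite RintegralB; [|by []|exact: iM|exact: iw].
  by congr (_ - _); exact: Rintegral_prob_cst.
suff : a * \int[nu]_x (M - w x) <= \int[mu]_x (M - w x) by rewrite (eM mu) (eM nu); lra.
have mMw : measurable_fun setT (fun x => (M - w x)%:E).
  by apply/measurable_EFinP; exact: measurable_funB.
have Mw0 x : (0 <= (M - w x)%:E)%E by rewrite lee_fin subr_ge0.
have iMw (m : probability T R) : (\int[m]_x (M - w x)%:E)%E \is a fin_num.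
  by apply: integrable_fin_num => //; exact: (integrableB _ (iM m) (iw m)).
have := @ge0_le_measure_integral _ _ R (mscale (NngNum a0) nu) mu numu
  (fun x => (M - w x)%:E) _ measurableT Mw0 mMw.
rewrite ge0_integral_mscale//= /Rintegral -lee_fin EFinM !fineK//; exact: iMw.
Qed.

Lemma minorized_cRintegral (mu nu : probability T R) (a M : R) F :
  0 <= a -> (forall A, measurable A -> (a%:E * nu A <= mu A)%E) ->
  cmeasurable F -> (forall x, normc (F x) <= M) ->
  normc (cRintegral mu setT F - (a%:C)%C * cRintegral nu setT F) <= (1 - a) * M.
Proof.
move=> a0 numu mF FM; apply: normc_le_proj => c s cs.
have bF : cbounded F by exists M.
pose w x := c * complex.Re (F x) + s * complex.Im (F x).
have ir (m : probability T R) := integrable_Re m mF bF.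
have ii (m : probability T R) := integrable_Im m mF bF.
have iw (m : probability T R) : \int[m]_x w x =
    c * \int[m]_x complex.Re (F x) + s * \int[m]_x complex.Im (F x).
  rewrite RintegralD//; first by rewrite !RintegralZl//; [exact: ii|exact: ir].
    exact: (integrableZl measurableT c (ir m)).
  exact: (integrableZl measurableT s (ii m)).
have mw : measurable_fun setT w.
  by case: mF => ? ?; apply: measurable_funD; exact: measurable_funM.
have wM x : w x <= M by exact: le_trans (proj_le_normc _ cs) (FM x).
have wN x : `|w x| <= M.
  rewrite ler_norml wM andbT -[leRHS]opprK lerN2 /w opprD -!mulNr.
  by apply: le_trans (proj_le_normc _ _) (FM x); rewrite !sqrrN.
have := minorized_Rintegral a0 numu mw wN wM; rewrite !iw; apply: le_trans.
by rewrite /=; nra.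
Qed.

Lemma normc_cRintegral P F (M : R) : cmeasurable F -> (forall x, normc (F x) <= M) ->
  normc (cRintegral P setT F) <= M.
Proof.
(* the trivial minorization, a = 0 *)
move=> mF FM; have := @minorized_cRintegral P P 0 M F (lexx _).
rewrite mul0r subr0 subr0 mul1r; apply => // A _.
by rewrite mul0e measure_ge0.
Qed.

End complex_integral.

(** * Transition operators and their contraction *)

Lemma measurable_kernel_Rintegral (d d' : measure_display) (X : measurableType d)
    (Y : measurableType d') (R : realType) (K : X -> probability Y R)
    (mK : forall U, measurable U -> measurable_fun setT (fun x => K x U))
    (u : Y -> R) (M : R) :
  measurable_fun setT u -> (forall y, `|u y| <= M) ->
  measurable_fun setT (fun x => \int[K x]_y u y).
Proof.
move=> mu uM.
have muM : measurable_fun setT (fun y => (u y + M)%:E).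
  by apply/measurable_EFinP; exact: measurable_funD.
have uM0 y : (0 <= (u y + M)%:E)%E.
  by rewrite lee_fin; have := uM y; rewrite ler_norml => /andP[]; lra.
have mI := @measurable_fun_integral_kernel _ _ X Y R (fun x => K x) mK _ uM0 muM.
(* the shift by M makes the integrand nonnegative *)
rewrite (_ : (fun _ => _) = (fun x => fine (\int[K x]_y (u y + M)%:E)%E - M)).
  by apply: measurable_funB => //; exact: measurableT_comp mI.
apply/funext => x; rewrite -/(Rintegral (K x) setT (fun y => u y + M)).
rewrite RintegralD//.
- by rewrite (Rintegral_prob_cst (K x)) addrK.
- exact: (integrable_bounded _ mu uM).
- exact: finite_measure_integrable_cst.
Qed.

Section transfer_operator.
Context (d : measure_display) (X : measurableType d) (R : realType).
Local Notation normc := Normc.normc.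
Variables (nu : nat -> probability X R) (K : nat -> X -> probability X R).
Variables (a : R) (g : nat -> X -> R) (t : R).
Hypothesis mK : forall k U, measurable U -> measurable_fun setT (fun x => K k x U).
Hypothesis mg : forall k, measurable_fun setT (g k).
Hypothesis a0 : 0 <= a.
Hypothesis a1 : a <= 1.
Hypothesis nuK : forall k x A, (0 < k)%N -> measurable A ->
  (a%:E * nu k A <= K k x A)%E.

Definition transfer k (h : X -> R[i]) x :=
  cRintegral (K k x) setT (fun y => cexpi (t * g k y) * h y).

Let phi k := normc (cRintegral (nu k) setT (fun y => cexpi (t * g k y))).
Let rate k := 1 - a ^+ 2 * (1 - phi k).

Let mcexp k : cmeasurable (fun y => cexpi (t * g k y)).
Proof. by apply: cmeasurable_cexpi; exact: measurable_funM. Qed.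

Let bcexp k : cbounded (fun y => cexpi (t * g k y)).
Proof. exact: cbounded_cexpi. Qed.

Let phi_ge0 k : 0 <= phi k. Proof. exact: normc_ge0. Qed.

Let phi_le1 k : phi k <= 1.
Proof. by apply: normc_cRintegral => // x; rewrite normc_cexpi. Qed.

Let mintegrand k h : cmeasurable h -> cmeasurable (fun y => cexpi (t * g k y) * h y).
Proof. by move=> ?; exact: cmeasurableM. Qed.

Let bintegrand k h (M : R) : (forall y, normc (h y) <= M) ->
  forall y, normc (cexpi (t * g k y) * h y) <= M.
Proof. by move=> hM y; rewrite Normc.normcM normc_cexpi mul1r. Qed.

Lemma cmeasurable_transfer k h (M : R) : cmeasurable h -> (forall y, normc (h y) <= M) ->
  cmeasurable (transfer k h).
Proof.
move=> mh hM; have [mr mi] := mintegrand k mh; have b := bintegrand k hM.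
split; apply: (measurable_kernel_Rintegral (@mK k) _ (M := M)) => // y.
- exact: le_trans (Re_le_normc _) (b y).
- exact: le_trans (Im_le_normc _) (b y).
Qed.

Lemma transfer_le k h (M : R) : cmeasurable h -> (forall y, normc (h y) <= M) ->
  forall x, normc (transfer k h x) <= M.
Proof.
by move=> mh hM x; apply: normc_cRintegral; [exact: mintegrand|exact: bintegrand].
Qed.

(** The shape of a function in the range of [transfer]: the constant has the
    factor a, since it is integrated against the common part [a * nu]. *)
Definition nearly_constant (h : X -> R[i]) (M : R) :=
  exists c : R[i], normc c <= M /\
    forall x, normc (h x - (a%:C)%C * c) <= (1 - a) * M.

Lemma transfer_nearly_constant k h (M : R) : (0 < k)%N -> cmeasurable h ->
  (forall y, normc (h y) <= M) -> nearly_constant (transfer k h) M.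
Proof.
move=> k0 mh hM.
exists (cRintegral (nu k) setT (fun y => cexpi (t * g k y) * h y)); split.
  by apply: normc_cRintegral; [exact: mintegrand|exact: bintegrand].
move=> x; apply: minorized_cRintegral => //.
- by move=> A mA; exact: nuK.
- exact: mintegrand.
- exact: bintegrand.
Qed.

(** Split h into the constant a c and a rest of modulus at most (1 - a) M.  On
    a constant, the operator multiplies by the integral of the wave against
    [K k x], which by minorization is at most (1 - a) + a phi.  Altogether the
    bound is M (1 - a) + a M ((1 - a) + a phi), that is M (1 - a^2 (1 - phi)). *)
Lemma transfer_contracts k h (M : R) : (0 < k)%N -> cmeasurable h -> cbounded h ->
  nearly_constant h M -> forall x, normc (transfer k h x) <= rate k * M.
Proof.
move=> k0 mh bh [c [cM hc]] x; have M0 : 0 <= M := le_trans (normc_ge0 _) cM.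
pose ac := (a%:C)%C * c; pose e := fun y => cexpi (t * g k y).
have me : cmeasurable e := mcexp k; have be : cbounded e := bcexp k.
have -> : transfer k h x =
    cRintegral (K k x) setT (fun y => e y * (h y - ac)) +
    ac * cRintegral (K k x) setT e.
  rewrite -cRintegralZl//.
  rewrite [X in cRintegral _ _ X + _](_ : _ = (fun y => e y * h y - ac * e y)); last first.
    by apply/funext => y; rewrite mulrBr [e y * ac]mulrC.
  rewrite cRintegralB//; first by rewrite subrK.
  - exact: cmeasurableM.
  - exact: cboundedM.
  - by apply: cmeasurableM => //; exact: cmeasurable_cst.
  - by apply: cboundedM => //; exact: cbounded_cst.
apply: le_trans (le_normcD _ _) _.
have A : normc (cRintegral (K k x) setT (fun y => e y * (h y - ac))) <= (1 - a) * M.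
  apply: normc_cRintegral; last exact: bintegrand.
  by apply: mintegrand; apply: cmeasurableB => //; exact: cmeasurable_cst.
have B : normc (cRintegral (K k x) setT e) <= (1 - a) + a * phi k.
  rewrite -[X in normc X](subrK ((a%:C)%C * cRintegral (nu k) setT e)).
  apply: le_trans (le_normcD _ _) _; apply: lerD.
    rewrite -[leRHS]mulr1; apply: minorized_cRintegral => //.
      by move=> A0 mA0; exact: nuK.
    by move=> y; rewrite normc_cexpi.
  by rewrite Normc.normcM normc_real.
rewrite !Normc.normcM normc_real//.
have C : a * normc c * normc (cRintegral (K k x) setT e) <=
    a * M * ((1 - a) + a * phi k).
  by apply: ler_pM => //; rewrite ?mulr_ge0 ?normc_ge0// ler_wpM2l.
apply: le_trans (lerD A C) _; rewrite /rate le_eqVlt; apply/orP; left.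
by apply/eqP; ring.
Qed.

(** Along the chain, [backward n j x] is the conditional expectation of
    exp (i t (X_{n-j+1} + ... + X_n)) given that the state at time n - j is x. *)
Fixpoint backward n j : X -> R[i] :=
  if j is j'.+1 then transfer (n - j') (backward n j') else fun=> 1.

Lemma backward_le1 n j : cmeasurable (backward n j) /\
  forall x, normc (backward n j x) <= 1.
Proof.
elim: j => [|j [mj bj]] /=.
  by split=> [|x]; [exact: cmeasurable_cst|rewrite normc_one].
by split; [exact: cmeasurable_transfer bj|exact: transfer_le].
Qed.

Lemma rate_ge0 k : 0 <= rate k.
Proof.
rewrite /rate; have := phi_ge0 k => p0; have p1 := phi_le1 k.
have : a ^+ 2 <= 1 by rewrite expr_le1.
have := sqr_ge0 a; nra.
Qed.

(** The gain [rate k] relates bounds two steps apart, because the contraction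
    needs a function that one application has already made nearly constant.  The
    product of two consecutive bounds therefore picks up one factor per step,
    whence the invariant on [M1 * M0].  The minimum in the new bound preserves
    the monotonicity of the bounds. *)
Lemma backward_bound n j : (j < n)%N -> exists M0 M1 : R,
  [/\ forall x, normc (backward n j x) <= M0,
      forall x, normc (backward n j.+1 x) <= M1,
      0 <= M1 <= M0 & M1 * M0 <= \prod_(i < j.+1) rate (n - i)].
Proof.
elim: j => [|j IH] jn.
  have c1 : nearly_constant (backward n 0) 1.
    exists 1; split=> [|x /=]; first by rewrite normc_one.
    rewrite mulr1 -[1 in X in normc X]/((1%:C)%C) -rmorphB normc_real ?mulr1//.
    by rewrite subr_ge0.
  exists 1, (rate n); split=> //=.
  - by move=> x; rewrite normc_one.
  - move=> x; rewrite -[leRHS]mulr1 subn0.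
    exact: (transfer_contracts jn (@cmeasurable_cst _ X R 1) (@cbounded_cst _ X R 1) c1).
  - rewrite rate_ge0 /= /rate gerBl mulr_ge0 ?sqr_ge0//.
    by rewrite subr_ge0 phi_le1.
  - by rewrite big_ord_recr big_ord0 /= subn0 mul1r mulr1.
have [M0 [M1 [b0 b1 /andP[M10 M11] M01]]] := IH (ltnW jn).
have [mj bj] := backward_le1 n j; have [mj1 bj1] := backward_le1 n j.+1.
have nj0 : (0 < n - j)%N by rewrite subn_gt0 ltnW.
have nj1 : (0 < n - j.+1)%N by rewrite subn_gt0.
have c1 : nearly_constant (backward n j.+1) M0 by exact: transfer_nearly_constant.
have M00 : 0 <= M0 := le_trans M10 M11.
exists M1, (Num.min M1 (rate (n - j.+1) * M0)); split=> //.
- move=> x; rewrite le_min; apply/andP; split; first exact: transfer_le.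
  by apply: transfer_contracts => //; exists 1.
- by rewrite ge_min lexx le_min M10 mulr_ge0 ?rate_ge0.
- rewrite big_ord_recr /=; apply: (@le_trans _ _ (rate (n - j.+1) * M0 * M1)).
    by rewrite ler_wpM2r// ge_min lexx orbT.
  have -> : rate (n - j.+1) * M0 * M1 = M1 * M0 * rate (n - j.+1) by ring.
  by rewrite ler_wpM2r// rate_ge0.
Qed.

(** The last bound M1 is the smaller one, so its square is at most the product
    of all the rates, and 1 - a^2 (1 - p) <= exp (- a^2 (1 - p^2) / 2): the
    difference 1 - p - (1 - p^2) / 2 is half a square. *)
Lemma normc_backward n x : normc (backward n n x) <=
  expR (- (a ^+ 2 / 4 * \sum_(1 <= k < n.+1) (1 - phi k ^+ 2))).
Proof.
case: n => [|n]; first by rewrite /= normc_one big_geq// mulr0 oppr0 expR0.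
have [M0 [M1 [b0 b1 /andP[M10 M11] M01]]] := backward_bound (ltnSn n).
apply: le_trans (b1 x) _; rewrite -ler_sqr ?nnegrE ?expR_ge0// expr2.
apply: le_trans (ler_wpM2l M10 M11) (le_trans M01 _).
rewrite -expRM_natl big_add1 /= big_mkord.
rewrite (reindex_inj rev_ord_inj)/= mulr_sumr -sumrN mulr_sumr expR_sum.
apply: ler_prod => i _; rewrite rate_ge0/= subKn; last exact: ltn_ord.
apply: le_trans (expR_ge1Dx _); rewrite /rate.
rewrite -subr_ge0; set p := phi _.
rewrite (_ : _ - _ = (a * (1 - p)) ^+ 2 / 2); last by field.
by rewrite divr_ge0// sqr_ge0.
Qed.

End transfer_operator.

(** * Conditioning on the past *)

Section conditional_kernel.
Context (d dX : measure_display) (T : measurableType d) (X : measurableType dX)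
  (R : realType) (P : probability T R).
Variables (G : set (set T)) (eta xi : T -> X) (K : X -> probability X R).
Hypothesis sG : forall E, <<s G >> E -> measurable E.
Hypothesis mxi : measurable_fun setT xi.
Hypothesis meta : measurable_fun setT eta.
Hypothesis mK : forall U, measurable U -> measurable_fun setT (fun x => K x U).
Hypothesis condK : forall E A, <<s G >> E -> measurable A ->
  P (E `&` eta @^-1` A) = (\int[P]_(w in E) K (xi w) A)%E.

Local Notation Tp := (g_sigma_algebraType G).

Lemma measurable_fun_sub (d' : measure_display) (Y : measurableType d') (Z : T -> Y) :
  measurable_fun [set: Tp] Z -> measurable_fun [set: T] Z.
Proof. by move=> mZ _ B mB; apply: sG; exact: mZ. Qed.

Let Ku (u : X -> R) w := \int[K (xi w)]_y u y.

Let mKu (u : X -> R) (M : R) : measurable_fun setT u -> (forall x, `|u x| <= M) ->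
  measurable_fun setT (Ku u).
Proof.
by move=> mu uM; exact: measurableT_comp (measurable_kernel_Rintegral mK mu uM) mxi.
Qed.

Let KuM (u : X -> R) (M : R) : measurable_fun setT u -> (forall x, `|u x| <= M) ->
  forall w, `|Ku u w| <= M.
Proof. by move=> mu uM w; exact: Rintegral_prob_bound. Qed.

Let intZ (Z v : T -> R) (N M : R) : measurable_fun setT Z -> (forall w, `|Z w| <= N) ->
  measurable_fun setT v -> (forall w, `|v w| <= M) ->
  P.-integrable setT (fun w => (Z w * v w)%:E).
Proof.
move=> mZ ZN mv vM; apply: (@integrable_bounded _ _ _ P (N * M)).
  exact: measurable_funM.
by move=> w; rewrite normrM ler_pM.
Qed.

Let intZdiff (Z v1 v2 : T -> R) (N M1 M2 e : R) : 0 <= N ->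
  measurable_fun setT Z -> (forall w, `|Z w| <= N) ->
  measurable_fun setT v1 -> (forall w, `|v1 w| <= M1) ->
  measurable_fun setT v2 -> (forall w, `|v2 w| <= M2) ->
  (forall w, `|v1 w - v2 w| <= e) ->
  `|\int[P]_w (Z w * v1 w) - \int[P]_w (Z w * v2 w)| <= N * e.
Proof.
move=> N0 mZ ZN m1 b1 m2 b2 v12; rewrite -RintegralB//; last 2 first.
- exact: intZ mZ ZN m1 b1.
- exact: intZ mZ ZN m2 b2.
apply: Rintegral_prob_bound.
  by apply: measurable_funB; exact: measurable_funM.
by move=> w; rewrite -mulrBr normrM ler_pM.
Qed.

Let absI (E : set T) w : `|\1_E w : R| <= 1.
Proof. by rewrite indicE; case: (_ \in _); rewrite ?normr1 ?normr0. Qed.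

(** The case where u is an indicator is [condK]. *)
Let cond_indic E (u : X -> R) (M : R) : <<s G >> E ->
  measurable_fun setT u -> (forall x, `|u x| <= M) ->
  \int[P]_w (\1_E w * u (eta w)) = \int[P]_w (\1_E w * Ku u w).
Proof.
move=> sE; have mE : measurable E by exact: sG.
have mI : measurable_fun setT (\1_E : T -> R) by exact: measurable_indic.
apply: (@bounded_measurable_ind _ X R (fun u =>
  \int[P]_w (\1_E w * u (eta w)) = \int[P]_w (\1_E w * Ku u w))) => {u M}.
- move=> A mA.
  have -> : \int[P]_w (\1_E w * \1_A (eta w)) = fine (P (E `&` eta @^-1` A)).
    rewrite -[E `&` _]setIT -integral_indic//; last first.
      by apply: measurableI => //; rewrite -[X in measurable X]setTI; exact: meta.
    by congr fine; apply: eq_integral => w _; rewrite indicI.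
  rewrite condK//; congr fine; rewrite [LHS]integral_mkcond.
  apply: eq_integral => w _; rewrite patchE indicE; case: (w \in E); last by rewrite mul0r.
  rewrite mul1r /Ku /Rintegral integral_indic// setIT fineK//.
  exact: fin_num_measure.
- move=> c f h M N mf mh fM hN Ef Eh.
  have mfe : measurable_fun setT (f \o eta) by exact: measurableT_comp.
  have mhe : measurable_fun setT (h \o eta) by exact: measurableT_comp.
  have i1 := intZ mI (absI E) mfe (fun w => fM (eta w)).
  have i2 := intZ mI (absI E) mhe (fun w => hN (eta w)).
  have j1 := intZ mI (absI E) (mKu mf fM) (KuM mf fM).
  have j2 := intZ mI (absI E) (mKu mh hN) (KuM mh hN).
  have lin v1 v2 : P.-integrable setT (fun w => (\1_E w * v1 w)%:E) ->
      P.-integrable setT (fun w => (\1_E w * v2 w)%:E) ->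
      \int[P]_w (\1_E w * (c * v1 w + v2 w)) =
      c * \int[P]_w (\1_E w * v1 w) + \int[P]_w (\1_E w * v2 w).
    move=> k1 k2; rewrite -RintegralZl// -RintegralD//.
      by apply: eq_Rintegral => w _; ring.
    exact: (integrableZl measurableT c k1).
  rewrite (lin _ _ i1 i2) Ef Eh -(lin _ _ j1 j2).
  apply: eq_Rintegral => w _; congr (_ * _).
  have if_ : (K (xi w)).-integrable setT (EFin \o f) by exact: integrable_bounded mf fM.
  have ih_ : (K (xi w)).-integrable setT (EFin \o h) by exact: integrable_bounded mh hN.
  rewrite /Ku -RintegralZl// -RintegralD//.
  exact: (integrableZl measurableT c if_).
- move=> f M mf fM appr; apply/eqP; rewrite -subr_eq0 -normr_le0.
  apply/ler_addgt0Pr => e e0; rewrite add0r.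
  have [|h [N [mh hN Eh fh]]] := appr (e / 2); first by rewrite divr_gt0.
  have mfe : measurable_fun setT (f \o eta) by exact: measurableT_comp.
  have mhe : measurable_fun setT (h \o eta) by exact: measurableT_comp.
  have A1 := intZdiff ler01 mI (absI E) mfe (fun w => fM (eta w)) mhe
    (fun w => hN (eta w)) (fun w => fh (eta w)).
  have K12 w : `|Ku f w - Ku h w| <= e / 2.
    rewrite -RintegralB//.
    - by apply: Rintegral_prob_bound => //; exact: measurable_funB.
    - exact: integrable_bounded mf fM.
    - exact: integrable_bounded mh hN.
  have A2 := intZdiff ler01 mI (absI E) (mKu mf fM) (KuM mf fM) (mKu mh hN) (KuM mh hN) K12.
  move: A1 A2; rewrite /= Eh !mul1r => A1; rewrite distrC => A2.
  rewrite -(subrKA (\int[P]_w (\1_E w * Ku h w))).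
  by apply: le_trans (ler_normD _ _) _; rewrite [leRHS]splitr lerD.
Qed.

(** The defining equation of the Markov property concerns indicators of events;
    it passes to bounded functions first in the future variable, then in the
    past one. *)
Lemma cond_kernel_Rintegral (Z : T -> R) (u : X -> R) (N M : R) :
  measurable_fun [set: Tp] Z -> (forall w, `|Z w| <= N) ->
  measurable_fun setT u -> (forall x, `|u x| <= M) ->
  \int[P]_w (Z w * u (eta w)) = \int[P]_w (Z w * \int[K (xi w)]_y u y).
Proof.
move=> mZ ZN mu uM; move: Z N mZ ZN.
have mue : measurable_fun setT (u \o eta) by exact: measurableT_comp.
have ueM w := uM (eta w); have mk := mKu mu uM; have kM := KuM mu uM.
have M0 : 0 <= M := le_trans (normr_ge0 _) (uM (eta point)).
apply: (@bounded_measurable_ind _ Tp R (fun Z =>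
  \int[P]_w (Z w * u (eta w)) = \int[P]_w (Z w * Ku u w))).
- by move=> E mE; exact: cond_indic mu uM.
- move=> c f h N1 N2 /measurable_fun_sub mf /measurable_fun_sub mh fN hN Ef Eh.
  have lin (v : T -> R) : measurable_fun setT v -> (forall w, `|v w| <= M) ->
      \int[P]_w ((c * f w + h w) * v w) =
      c * \int[P]_w (f w * v w) + \int[P]_w (h w * v w).
    move=> mv vM; have i1 := intZ mf fN mv vM; have i2 := intZ mh hN mv vM.
    rewrite -RintegralZl// -RintegralD//; last exact: (integrableZl measurableT c i1).
    by apply: eq_Rintegral => w _; ring.
  by rewrite (lin (u \o eta))// (lin (Ku u))// Ef Eh.
- move=> f N1 /measurable_fun_sub mf fN appr; apply/eqP; rewrite -subr_eq0 -normr_le0.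
  apply/ler_addgt0Pr => e e0; rewrite add0r.
  have M1 : 0 < 2 * (M + 1) by lra.
  have [|h [N [/measurable_fun_sub mh hN Eh fh]]] := appr (e / (2 * (M + 1))).
    by rewrite divr_gt0.
  have B (v : T -> R) : measurable_fun setT v -> (forall w, `|v w| <= M) ->
      `|\int[P]_w (f w * v w) - \int[P]_w (h w * v w)| <= e / 2.
    move=> mv vM; have := intZdiff M0 mv vM mf fN mh hN fh.
    under eq_Rintegral do rewrite mulrC.
    under [X in _ - X]eq_Rintegral do rewrite mulrC.
    move=> /le_trans; apply.
    rewrite mulrCA ler_pM2l// invfM mulrCA ler_piMr// ler_pdivrMr; lra.
  have A1 := B _ mue ueM; have A2 := B _ mk kM.
  move: A1 A2; rewrite /= Eh => A1; rewrite distrC => A2.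
  rewrite -(subrKA (\int[P]_w (h w * Ku u w))).
  by apply: le_trans (ler_normD _ _) _; rewrite [leRHS]splitr lerD.
Qed.

End conditional_kernel.

Section conditional_kernel_complex.
Context (d dX : measure_display) (T : measurableType d) (X : measurableType dX)
  (R : realType) (P : probability T R).
Variables (G : set (set T)) (eta xi : T -> X) (K : X -> probability X R).
Hypothesis sG : forall E, <<s G >> E -> measurable E.
Hypothesis mxi : measurable_fun setT xi.
Hypothesis meta : measurable_fun setT eta.
Hypothesis mK : forall U, measurable U -> measurable_fun setT (fun x => K x U).
Hypothesis condK : forall E A, <<s G >> E -> measurable A ->
  P (E `&` eta @^-1` A) = (\int[P]_(w in E) K (xi w) A)%E.
Local Notation normc := Normc.normc.

Lemma cond_kernel_cRintegral (Z : T -> R[i]) (u : X -> R[i]) (N M : R) :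
  @cmeasurable _ (g_sigma_algebraType G) R Z -> (forall w, normc (Z w) <= N) ->
  cmeasurable u -> (forall x, normc (u x) <= M) ->
  cRintegral P setT (fun w => Z w * u (eta w)) =
  cRintegral P setT (fun w => Z w * cRintegral (K (xi w)) setT u).
Proof.
move=> [mZr mZi] ZN [mur mui] uM.
have Zr w := le_trans (Re_le_normc _) (ZN w).
have Zi w := le_trans (Im_le_normc _) (ZN w).
have ur x := le_trans (Re_le_normc _) (uM x).
have ui x := le_trans (Im_le_normc _) (uM x).
have int (f : T -> R) (v : T -> R) : @measurable_fun _ _ (g_sigma_algebraType G) R setT f ->
    (forall w, `|f w| <= N) -> measurable_fun setT v -> (forall w, `|v w| <= M) ->
    P.-integrable setT (fun w => (f w * v w)%:E).
  move=> /(measurable_fun_sub sG) mf fN mv vM.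
  apply: (@integrable_bounded _ _ _ P (N * M)); first exact: measurable_funM.
  by move=> w; rewrite normrM ler_pM.
have mKe (v : X -> R) : measurable_fun setT v -> (forall x, `|v x| <= M) ->
    measurable_fun setT (fun w => \int[K (xi w)]_y v y) /\
    (forall w, `|\int[K (xi w)]_y v y| <= M).
  move=> mv vM; split; last by move=> w; exact: Rintegral_prob_bound.
  exact: measurableT_comp (measurable_kernel_Rintegral mK mv vM) mxi.
have [mKr Kr] := mKe _ mur ur; have [mKi Ki] := mKe _ mui ui.
have mre : measurable_fun setT (fun w => complex.Re (u (eta w))).
  exact: measurableT_comp mur meta.
have mie : measurable_fun setT (fun w => complex.Im (u (eta w))).
  exact: measurableT_comp mui meta.
have ck := cond_kernel_Rintegral sG mxi meta mK condK.
have eRe (v : T -> R[i]) w : complex.Re (Z w * v w) =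
    complex.Re (Z w) * complex.Re (v w) - complex.Im (Z w) * complex.Im (v w).
  by case: (Z w); case: (v w).
have eIm (v : T -> R[i]) w : complex.Im (Z w * v w) =
    complex.Re (Z w) * complex.Im (v w) + complex.Im (Z w) * complex.Re (v w).
  by case: (Z w); case: (v w).
rewrite /cRintegral; congr Complex.
- under eq_Rintegral do rewrite (eRe (u \o eta)).
  under [RHS]eq_Rintegral do rewrite (eRe (fun w => cRintegral (K (xi w)) setT u)).
  rewrite !RintegralB//=; try by [exact: int|apply: int => // w; [exact: ur|exact: ui]].
  congr (_ - _); [exact: (ck _ _ N M mZr Zr mur ur)|exact: (ck _ _ N M mZi Zi mui ui)].
- under eq_Rintegral do rewrite (eIm (u \o eta)).
  under [RHS]eq_Rintegral do rewrite (eIm (fun w => cRintegral (K (xi w)) setT u)).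
  rewrite !RintegralD//=; try by [exact: int|apply: int => // w; [exact: ur|exact: ui]].
  congr (_ + _); [exact: (ck _ _ N M mZr Zr mui ui)|exact: (ck _ _ N M mZi Zi mur ur)].
Qed.

End conditional_kernel_complex.

(** * The characteristic function of a sum along the chain *)

Section chain_charfun.
Context (d dX : measure_display) (T : measurableType d) (X : measurableType dX)
  (R : realType) (P : probability T R).
Variables (xi : nat -> {RV P >-> X}) (Q : nat -> R.-pker X ~> X) (a : R).
Variables (g : nat -> {mfun X >-> R}) (Y : nat -> T -> R).
Hypothesis Yg : forall j w, Y j w = g j (xi j w).
Hypothesis mc : markov_chain xi Q.
Hypothesis a0 : 0 < a.
Hypothesis lb : lower_bound_condition xi Q a.
Local Notation normc := Normc.normc.

Let law k : probability X R := distribution P (xi k).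

Let good_sets : exists X' : nat -> set X, forall k, (1 <= k)%N ->
  [/\ measurable (X' k), law k.-1 (X' k) = 1%E &
   forall A x, measurable A -> X' k x -> (a%:E * law k A <= Q k x A)%E].
Proof.
suff /choice[X' HX'] : forall k, exists X' : set X, (1 <= k)%N ->
  [/\ measurable X', law k.-1 X' = 1%E &
   forall A x, measurable A -> X' x -> (a%:E * law k A <= Q k x A)%E] by exists X'.
move=> k; have [k1|k1] := leqP 1 k; last by exists setT.
by have [X' HX'] := lb k1; exists X'.
Qed.

Let X' := sval (cid good_sets).
Let X'P k : (1 <= k)%N ->
  [/\ measurable (X' k), law k.-1 (X' k) = 1%E &
   forall A x, measurable A -> X' k x -> (a%:E * law k A <= Q k x A)%E].
Proof. exact: (svalP (cid good_sets)). Qed.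

(** Evaluate the lower bound at A = X; some point of [X' 1] is needed, and there
    is one because that set has full measure. *)
Lemma lower_bound_constant_le1 : a <= 1.
Proof.
have [mX X1 H] := X'P (ltnSn 0).
have [x X'x] : exists x, X' 1%N x.
  apply/set0P/negP => /eqP X0; move: X1; rewrite X0 measure0 => /eqP.
  by rewrite eqe eq_sym oner_eq0.
have := H setT x measurableT X'x.
by rewrite probability_setT prob_kernel mule1 lee_fin.
Qed.

(** A version of the kernels which satisfies the lower bound everywhere: outside
    the sets [X' k], which have full measure, they are replaced by the marginal
    laws.  Normalization leaves [Q k x] unchanged, since its mass is 1, and only
    turns it into a probability. *)
Let K k x : probability X R :=
  if `[< (0 < k)%N /\ X' k x >] then (mnormalize (Q k x) (law k) : probability X R) else law k.

Let KE k x A : K k x A = if `[< (0 < k)%N /\ X' k x >] then Q k x A else law k A.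
Proof.
rewrite /K; case: asboolP => // _.
by rewrite /= /mnormalize prob_kernel onee_eq0/= invr1 mule1.
Qed.

Let mK k U : measurable U -> measurable_fun setT (fun x => K k x U).
Proof.
move=> mU; rewrite (_ : (fun _ => _) = fun x => if `[< (0 < k)%N /\ X' k x >] then
   Q k x U else law k U); last by apply/funext => x; exact: KE.
apply: measurable_fun_ifT => //; last exact: measurable_kernel.
apply: (measurable_fun_bool true); rewrite setTI.
have [k0|k0] := boolP (0 < k)%N.
  have [mX _ _] := X'P k0; rewrite (_ : _ @^-1` _ = X' k)//.
  by apply/seteqP; split=> x /=; [move=> /asboolP[]|move=> ?; apply/asboolP].
rewrite (_ : _ @^-1` _ = set0)//.
by apply/seteqP; split=> x //= /asboolP[k1]; case/negP: k0.
Qed.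

Let minK k x A : (0 < k)%N -> measurable A -> (a%:E * law k A <= K k x A)%E.
Proof.
move=> k0 mA; rewrite KE; case: asboolP => [[_ X'x]|_].
  by have [_ _] := X'P k0; exact.
by rewrite -[leRHS]mul1e lee_wpmul2r ?measure_ge0 ?lee_fin ?lower_bound_constant_le1.
Qed.

Let pastgen k := \bigcup_(j in [set j | (j <= k)%N])
  preimage_set_system [set: T] (xi j) measurable.

Let past_measurable k E : <<s pastgen k >> E -> measurable E.
Proof.
apply: smallest_sub; first exact: sigma_algebra_measurable.
by move=> _ [j _] [B mB <-]; exact: measurable_funP.
Qed.

Let condK k E A : <<s pastgen k >> E -> measurable A ->
  P (E `&` xi k.+1 @^-1` A) = (\int[P]_(w in E) K k.+1 (xi k w) A)%E.
Proof.
move=> sE mA; rewrite (mc sE mA); have mE := past_measurable sE.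
have [mX X1 _] := X'P (ltn0Sn k).
have mxiT B : measurable B -> measurable (xi k @^-1` B).
  by move=> mB; rewrite -[X in measurable X]setTI; exact: measurable_funP.
apply: ae_eq_integral => //.
- have : measurable_fun setT (fun w => Q k.+1 (xi k w) A).
    exact: measurableT_comp (measurable_kernel (Q k.+1) A mA) (measurable_funP (xi k)).
  exact: measurable_funTS.
- have : measurable_fun setT (fun w => K k.+1 (xi k w) A).
    exact: measurableT_comp (mK k.+1 mA) (measurable_funP (xi k)).
  exact: measurable_funTS.
exists (xi k @^-1` (~` X' k.+1)); split; first by apply: mxiT; exact: measurableC.
  have := probability_setC (law k) mX.
  by rewrite X1 -EFinB subrr.
move=> w /=; apply: contra_not => Xw _; rewrite KE.
by case: asboolP => // -[]; split=> //; exact: contrapT.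
Qed.

Let measurable_xi_past k j : (j <= k)%N ->
  measurable_fun [set: g_sigma_algebraType (pastgen k)] (xi j).
Proof.
move=> jk _ B mB; apply: sub_sigma_algebra; exists j => //=.
by exists B.
Qed.

Let mg k : measurable_fun setT (g k). Proof. exact: measurable_funP. Qed.

Let mS k : measurable_fun [set: g_sigma_algebraType (pastgen k)] (partial_sum Y k).
Proof.
rewrite (_ : partial_sum Y k =
   fun w => \sum_(i < k) g i.+1 (xi i.+1 w)); last first.
  by apply/funext => w; rewrite /partial_sum big_add1/= big_mkord;
    apply: eq_bigr => i _; rewrite Yg.
apply: measurable_sum => i.
by apply: measurableT_comp => //; exact: measurable_xi_past.
Qed.

Variable t : R.

(** Conditioning on the past up to time n - j - 1 replaces the factor of time
    n - j by its integral against the kernel, which is one more application of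
    [transfer]. *)
Let charfun_backward n j : (j <= n)%N ->
  charfun P (partial_sum Y n) t = cRintegral P setT (fun w =>
    cexpi (t * partial_sum Y (n - j) w) * backward K (fun k => g k) t n j (xi (n - j) w)).
Proof.
elim: j => [|j IH] jn.
  rewrite subn0 /charfun; congr (cRintegral P setT).
  by apply/funext => w; rewrite /= mulr1.
rewrite IH 1?ltnW//=; set k := (n - j.+1)%N.
have -> : (n - j = k.+1)%N by rewrite /k subnSK.
have [mb bb] := @backward_le1 _ _ _ K (fun k => g k) t mK mg n j.
rewrite -(@cond_kernel_cRintegral _ _ _ _ _ P (pastgen k) (xi k.+1) (xi k) (K k.+1)
  (@past_measurable k) _ _ (@mK k.+1) (@condK k)
  (fun w => cexpi (t * partial_sum Y k w))
  (fun y => cexpi (t * g k.+1 y) * backward K (fun k => g k) t n j y) 1 1); last 6 first.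
- exact: measurable_funP.
- exact: measurable_funP.
- by apply: cmeasurable_cexpi; exact: measurable_funM.
- by move=> w; rewrite normc_cexpi.
- by apply: cmeasurableM => //; apply: cmeasurable_cexpi; exact: measurable_funM.
- by move=> x; rewrite Normc.normcM normc_cexpi mul1r.
congr (cRintegral P setT); apply/funext => w.
rewrite mulrA -cexpiD -mulrDr -Yg; congr (cexpi (t * _) * _).
by rewrite /partial_sum big_nat_recr.
Qed.

(** With j = n in [charfun_backward] no term of the sum is left, and the
    expectation is bounded by the supremum of [backward n n]. *)
Lemma normc_charfun_partial_sum n :
  normc (charfun P (partial_sum Y n) t) <=
  expR (- (a ^+ 2 / 4 * \sum_(1 <= k < n.+1) (1 - normc (charfun P (Y k) t) ^+ 2))).
Proof.
have phiE k : normc (cRintegral (law k) setT (fun y => cexpi (t * g k y))) =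
    normc (charfun P (Y k) t).
  have mr : measurable_fun setT (fun y => cos (t * g k y)).
    apply: measurableT_comp; last exact: measurable_funM.
    exact: continuous_measurable_fun (@continuous_cos R).
  have mi : measurable_fun setT (fun y => sin (t * g k y)).
    apply: measurableT_comp; last exact: measurable_funM.
    exact: continuous_measurable_fun (@continuous_sin R).
  have pf (u : X -> R) : measurable_fun setT u -> (forall x, `|u x| <= 1) ->
      \int[law k]_x u x = \int[P]_w u (xi k w).
    move=> mu u1; congr fine.
    rewrite (integral_distribution (f := EFin \o u))//; first exact/measurable_EFinP.
    by apply: (@integrable_bounded _ _ _ P 1) => //; exact: measurableT_comp.
  rewrite /charfun /cRintegral/= pf//; last by move=> x; exact: cos_max.
  rewrite pf//; last by move=> x; exact: sin_max.
  by congr (normc (Complex _ _)); apply: eq_Rintegral => w _; rewrite Yg.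
rewrite (charfun_backward (leqnn n)) subnn.
under eq_bigr do rewrite -phiE.
have [mb bb] := @backward_le1 _ _ _ K (fun k => g k) t mK mg n n.
apply: normc_cRintegral.
  apply: cmeasurableM.
    apply: cmeasurable_cexpi; apply: measurable_funM => //.
    exact: (measurable_fun_sub (@past_measurable 0%N) (@mS 0%N)).
  by case: mb => mr mi; split; [apply: measurableT_comp mr _|apply: measurableT_comp mi _].
move=> w; rewrite Normc.normcM normc_cexpi mul1r.
exact: (@normc_backward _ _ _ law K a _ t mK mg (ltW a0) lower_bound_constant_le1 minK).
Qed.

End chain_charfun.

(** * Derivatives, even integrals and the Poisson kernel *)

Section derivatives.
Context (R : realType).
Implicit Types t c : R.

Lemma is_derive_mulr t c : is_derive t 1 (fun t : R => t * c) c.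
Proof.
have := @is_deriveM _ _ (@id R) (cst c) t 1 1 0 (is_derive_id _ _) (is_derive_cst _ _ _).
by rewrite scaler0 add0r -[c *: 1]/(c * 1) mulr1.
Qed.

Lemma is_derive_cosM t c : is_derive t 1 (fun t : R => cos (t * c)) (- sin (t * c) * c).
Proof. exact: (@is_derive1_comp _ cos (fun t => t * c) t _ _ _ (is_derive_mulr t c)). Qed.

Lemma is_derive_sinM t c : is_derive t 1 (fun t : R => sin (t * c)) (cos (t * c) * c).
Proof. exact: (@is_derive1_comp _ sin (fun t => t * c) t _ _ _ (is_derive_mulr t c)). Qed.

Lemma is_derive_expM t c : is_derive t 1 (fun t : R => expR (t * c)) (expR (t * c) * c).
Proof. exact: (@is_derive1_comp _ expR (fun t => t * c) t _ _ _ (is_derive_mulr t c)). Qed.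

Lemma is_derive_mul (f g : R -> R) t df dg : is_derive t 1 f df -> is_derive t 1 g dg ->
  is_derive t 1 (fun t => f t * g t) (f t * dg + g t * df).
Proof. by move=> ? ?; exact: (@is_deriveM _ _ f g t 1 df dg). Qed.

Lemma is_derive_add (f g : R -> R) t df dg : is_derive t 1 f df -> is_derive t 1 g dg ->
  is_derive t 1 (fun t => f t + g t) (df + dg).
Proof. by move=> ? ?; exact: (@is_deriveD _ _ _ f g t 1 df dg). Qed.

Lemma is_derive_derive1 (f : R -> R) t df : is_derive t 1 f df -> derive1 f t = df.
Proof. by move=> [_ <-]; rewrite derive1E. Qed.

Lemma is_derive_continuous (f : R -> R) t df : is_derive t 1 f df -> {for t, continuous f}.
Proof. by move=> [h _]; apply: differentiable_continuous; exact/derivable1_diffP. Qed.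

End derivatives.

Ltac solve_derive := repeat first [exact: is_derive_cst | exact: is_derive_id
  | exact: is_derive_expM | exact: is_derive_cosM | exact: is_derive_sinM
  | apply: is_derive_add | apply: is_derive_mul].

Section even_integrals.
Context (R : realType).
Local Notation mu := (@lebesgue_measure R).

(** Nonnegativity makes the value on the half-line yield integrability too. *)
Lemma even_integral (f : R -> R) (I : R) : (forall x, 0 <= f x) -> continuous f ->
  (forall x, f (- x) = f x) -> (\int[mu]_(x in `[0%R, +oo[) (f x)%:E = I%:E)%E ->
  mu.-integrable setT (EFin \o f) /\ \int[mu]_x f x = 2 * I.
Proof.
move=> f0 cf ef If.
have E : (\int[mu]_x (f x)%:E = (2 * I)%:E)%E.
  rewrite ge0_symfun_integralT//; last by move=> x; rewrite /= ef.
  by rewrite -set_itvcy If -EFinM.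
split; last by rewrite /Rintegral E.
apply/integrableP; split.
  by apply/measurable_EFinP; exact: continuous_measurable_fun.
by under eq_integral do rewrite /= ger0_norm//; rewrite E ltry.
Qed.

Lemma continuous_abs : continuous (fun t : R => `|t|).
Proof. by move=> t; exact: norm_continuous. Qed.

Section poisson.
Variable e : R.
Hypothesis e0 : 0 < e.

Let continuous_exp_cos x : continuous (fun t : R => expR (t * - e) * (1 + cos (t * x))).
Proof. by move=> t; apply: is_derive_continuous; solve_derive. Qed.

(** The summand 1 keeps the integrand nonnegative, so that the fundamental
    theorem on the half-line applies; F below is an explicit primitive. *)
Let half x : (\int[mu]_(t in `[0%R, +oo[) (expR (t * - e) * (1 + cos (t * x)))%:E =
  (e^-1 + e / (e ^+ 2 + x ^+ 2))%:E)%E.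
Proof.
have ex0 : 0 < e ^+ 2 + x ^+ 2 by rewrite ltr_pwDl ?exprn_gt0// sqr_ge0.
pose D := (e ^+ 2 + x ^+ 2)^-1.
pose F (t : R) : R := expR (t * - e) * (x * D * sin (t * x) + - e * D * cos (t * x) + - e^-1).
have dF (t : R) : is_derive t 1 F (expR (t * - e) * (1 + cos (t * x))).
  rewrite /F; apply: is_derive_eq; rewrite /GRing.scale/= /D. by field; rewrite !gt_eqF.
rewrite (@ge0_continuous_FTC2y _ _ F 0 0).
- by rewrite /F !mul0r sin0 cos0 expR0 -EFinB; congr EFin; rewrite /D; ring.
- by move=> t _; rewrite mulr_ge0 ?expR_ge0//; have := cos_geN1 (t * x); lra.
- exact: continuous_subspaceT.
- have cE : expR (t * - e) @[t --> +oo] --> 0.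
    rewrite (_ : (fun _ => _) = (fun x : R => expR (- x)) \o (fun t => t * e)); last first.
      by apply/funext => t; rewrite /= mulrN.
    apply: (@cvg_comp _ _ _ _ _ _ (pinfty_nbhs R)); last exact: cvgr_expR.
    exact: gt0_cvgMly.
  pose M := `|x * D| + `|e * D| + e^-1.
  have FM t : `|F t| <= M * expR (t * - e).
    rewrite /F normrM ger0_norm ?expR_ge0// mulrC ler_wpM2r ?expR_ge0//.
    apply: le_trans (ler_normD _ _) _; rewrite /M normrN [`|e^-1|]gtr0_norm ?invr_gt0//.
    rewrite lerD2r.
    apply: le_trans (ler_normD _ _) _; rewrite !mulNr normrN !normrM lerD//.
      by rewrite -[leRHS]mulr1 ler_wpM2l ?mulr_ge0// sin_max.
    by rewrite -[leRHS]mulr1 ler_wpM2l ?mulr_ge0// cos_max.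
  have cM : M * expR (t * - e) @[t --> +oo] --> 0.
    by rewrite -(mulr0 M); apply: cvgM => //; exact: cvg_cst.
  apply: (@squeeze_cvgr _ _ _ _ (fun t => - (M * expR (t * - e))) (fun t => M * expR (t * - e))) => //.
    by apply: nearW => t; rewrite -ler_norml.
  by rewrite -oppr0; exact: cvgN.
- by move=> t _; have [] := dF t.
- by apply: cvg_at_right_filter; exact: (is_derive_continuous (dF 0)).
- by move=> t _; exact: is_derive_derive1.
Qed.

(** The integral of exp (- e |t|) (1 + cos (t x)) is known from [even_integral];
    its value at x = 0 determines the integral of exp (- e |t|), which is then
    subtracted. *)
Lemma poisson_integral x :
  mu.-integrable setT (fun t => (expR (- (e * `|t|)))%:E) /\
  \int[mu]_t (expR (- (e * `|t|)) * cos (t * x)) = 2 * e / (e ^+ 2 + x ^+ 2).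
Proof.
pose f y t := expR (- (e * `|t|)) * (1 + cos (t * y)).
have fP y : mu.-integrable setT (EFin \o f y) /\
    \int[mu]_t f y t = 2 * (e^-1 + e / (e ^+ 2 + y ^+ 2)).
  apply: even_integral.
  - by move=> t; rewrite mulr_ge0 ?expR_ge0//; have := cos_geN1 (t * y); lra.
  - have -> : f y = (fun t => expR (t * - e) * (1 + cos (t * y))) \o (fun t => `|t|).
      apply/funext => t; rewrite /f /= mulrN [`|t| * e]mulrC; congr (_ * (1 + _)).
      by case: (ger0P t) => // _; rewrite mulNr cosN.
    by move=> t; apply: continuous_comp; [exact: continuous_abs|exact: continuous_exp_cos].
  - by move=> t; rewrite /f normrN mulNr cosN.
  - rewrite -half; apply: eq_integral => t; rewrite inE/= in_itv/= andbT => t0.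
    by rewrite /f ger0_norm// mulrN [t * e]mulrC.
have [i0 I0] := fP 0; have [ix Ix] := fP x.
have iE : mu.-integrable setT (fun t => (expR (- (e * `|t|)))%:E).
  apply: (@integrable_le _ _ _ mu _ (f 0)) => //.
    have -> : (fun t => expR (- (e * `|t|))) = expR \o (fun t : R => - (e * `|t|)) by [].
    by apply: measurableT_comp => //; apply: measurableT_comp => //;
       apply: measurable_funM => //; exact: measurableT_comp.
  by move=> t; rewrite ger0_norm ?expR_ge0// /f mulr0 cos0 ler_peMr ?expR_ge0//; lra.
split=> //.
have IE : 2 * \int[mu]_t expR (- (e * `|t|)) = 4 / e.
  rewrite -RintegralZl//; transitivity (\int[mu]_t f 0 t).
    by apply: eq_Rintegral => t _; rewrite /f mulr0 cos0; ring.
  by rewrite I0 expr0n addr0; field; rewrite gt_eqF.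
transitivity (\int[mu]_t (f x t - expR (- (e * `|t|)))).
  by apply: eq_Rintegral => t _; rewrite /f; ring.
rewrite RintegralB// Ix; set I := \int[mu]_t _ in IE *.
have -> : I = 2 / e by lra.
by field; rewrite !gt_eqF// ltr_pwDl ?exprn_gt0// sqr_ge0.
Qed.
End poisson.
End even_integrals.

(** * Fourier inversion *)

Section trigonometric_integrals.
Context (d : measure_display) (T : measurableType d) (R : realType).
Variable mu : {measure set T -> \bar R}.
Variables (h Y : T -> R).
Hypothesis ih : mu.-integrable setT (EFin \o h).
Hypothesis mY : measurable_fun setT Y.

Let mh : measurable_fun setT h.
Proof. by apply/measurable_EFinP; exact: measurable_int ih. Qed.

Lemma integrable_mul_wave (c : R -> R) : continuous c -> (forall x, `|c x| <= 1) ->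
  forall t, mu.-integrable setT (fun y => (h y * c (t * Y y))%:E).
Proof.
move=> cc c1 t; apply: (integrable_mulr (M := 1) ih) => //.
by apply: measurableT_comp; [exact: continuous_measurable_fun|exact: measurable_funM].
Qed.

(** Dominated convergence with bound |h|.  With Y the identity these are
    Fourier transforms of h; with h = 1 they are characteristic functions. *)
Lemma continuous_wave_integral (c : R -> R) : continuous c -> (forall x, `|c x| <= 1) ->
  continuous (fun t : R => \int[mu]_y (h y * c (t * Y y)) : R).
Proof.
move=> cc c1 t.
have := @continuity_under_integral R _ T mu (fun t y => h y * c (t * Y y)) setT
  measurableT (t - 1) (t + 1) _ _ (fun y => `|h y|) _ _ t.
apply.
- by move=> s _; exact: integrable_mul_wave.
- apply: aeW => y _ s _.
  have cY : {for s, continuous (c \o (fun s : R => s * Y y))}.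
    by apply: continuous_comp; [exact: is_derive_continuous (is_derive_mulr s (Y y))|exact: cc].
  by apply: cvgM; [exact: cvg_cst|exact: cY].
- exact: integrable_norm.
- by move=> s _; apply: aeW => y _; rewrite normrM ler_piMr.
- by rewrite inE/= in_itv/= ltrBlDr ltrDl ltr01.
Qed.

End trigonometric_integrals.

Section cauchy_kernel.
Context (R : realType).
Local Notation mu := (@lebesgue_measure R).

Lemma integral_oneDsqrV : mu.-integrable setT (fun x : R => ((1 + x ^+ 2)^-1)%:E) /\
  \int[mu]_x (1 + x ^+ 2)^-1 = pi :> R.
Proof.
have [|||| i I] := @even_integral R (fun x => (1 + x ^+ 2)^-1) (pi / 2).
- by move=> x; rewrite invr_ge0 addr_ge0// sqr_ge0.
- exact: continuous_oneDsqrV.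
- by move=> x; rewrite sqrrN.
- exact: integral0y_oneDsqr.
- by split=> //; rewrite I; field.
Qed.

Lemma integral_cauchy (e x : R) : 0 < e ->
  mu.-integrable setT (fun y => (2 * e / (e ^+ 2 + (y - x) ^+ 2))%:E) /\
  \int[mu]_y (2 * e / (e ^+ 2 + (y - x) ^+ 2)) = 2 * pi.
Proof.
move=> e0; have [i I] := integral_oneDsqrV; have e1 : 0 < e^-1 by rewrite invr_gt0.
have eE y : 2 / e * (1 + (e^-1 * y + - x / e) ^+ 2)^-1 = 2 * e / (e ^+ 2 + (y - x) ^+ 2).
  have p1 : 0 < e ^+ 2 + (y - x) ^+ 2 by rewrite ltr_pwDl ?exprn_gt0// sqr_ge0.
  rewrite (_ : 1 + (e^-1 * y + - x / e) ^+ 2 = (e ^+ 2 + (y - x) ^+ 2) / e ^+ 2).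
    by field; rewrite !gt_eqF.
  by field; rewrite gt_eqF.
have i1 := integrable_affine (- x / e) e1 i.
have I1 := Rintegral_affine (- x / e) e1 i.
split.
  apply: eq_integrable (integrableZl measurableT (2 / e) i1) => //.
  by move=> y _; rewrite -EFinM eE.
transitivity (2 / e * \int[mu]_y (1 + (e^-1 * y + - x / e) ^+ 2)^-1).
  by rewrite -RintegralZl//; apply: eq_Rintegral => y _; rewrite eE.
by rewrite -I I1; field; rewrite gt_eqF.
Qed.

End cauchy_kernel.

Section fourier_inversion.
Context (R : realType).
Local Notation mu := (@lebesgue_measure R).
Variable h : R -> R.
Hypothesis ch : continuous h.
Hypothesis ih : mu.-integrable setT (EFin \o h).
Variable x : R.

Let C t := \int[mu]_y (h y * cos (t * (y - x))).
Let p (e y : R) := 2 * e / (e ^+ 2 + (y - x) ^+ 2).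

Let mh : measurable_fun setT h. Proof. exact: continuous_measurable_fun. Qed.

Let mC : measurable_fun setT C.
Proof.
apply: continuous_measurable_fun; apply: continuous_wave_integral => //.
- exact: measurable_funB.
- exact: continuous_cos.
- exact: cos_max.
Qed.

Let p_ge0 (e y : R) : 0 < e -> 0 <= p e y.
Proof. by move=> e0; rewrite /p divr_ge0 ?addr_ge0 ?sqr_ge0 ?mulr_ge0// ltW. Qed.

Let mp (e : R) : 0 < e -> measurable_fun setT (p e).
Proof.
move=> e0; have [i _] := integral_cauchy x e0.
by apply/measurable_EFinP; exact: measurable_int i.
Qed.

Let pM (e y : R) : 0 < e -> p e y <= 2 / e.
Proof.
move=> e0; rewrite /p ler_pdivrMr; last by rewrite ltr_pwDl ?exprn_gt0// sqr_ge0.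
rewrite mulrDr (_ : 2 / e * e ^+ 2 = 2 * e); last by field; rewrite gt_eqF.
by rewrite lerDl mulr_ge0 ?sqr_ge0// divr_ge0// ltW.
Qed.

(** The factor exp (- e |t|) makes the double integral absolutely convergent, so
    that Fubini applies and the Poisson kernel appears. *)
Let abel (e : R) : 0 < e ->
  \int[mu]_t (expR (- (e * `|t|)) * C t) = \int[mu]_y (h y * p e y).
Proof.
move=> e0; have [ie _] := poisson_integral e0 0.
have me : measurable_fun setT (fun t : R => expR (- (e * `|t|))).
  by apply/measurable_EFinP; exact: measurable_int ie.
transitivity (\int[mu]_t \int[mu]_y (expR (- (e * `|t|)) * (h y * cos (t * (y - x))))).
  apply: eq_Rintegral => t _; rewrite RintegralZl//.
  apply: integrable_mul_wave => //; [exact: measurable_funB|exact: continuous_cos|exact: cos_max].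
rewrite (@Rintegral_Fubini _ _ (measurableTypeR R) (measurableTypeR R) R mu mu
  (fun t y => expR (- (e * `|t|)) * (h y * cos (t * (y - x))))
  (fun t => expR (- (e * `|t|))) (fun y => `|h y|)).
- apply: eq_Rintegral => y _; rewrite /p -(poisson_integral e0 (y - x)).2 -RintegralZl//.
    by apply: eq_Rintegral => t _; ring.
  apply: (integrable_mulr (M := 1) ie) => //; last by move=> ?; exact: cos_max.
  apply: measurableT_comp; last exact: measurable_funM.
  exact: continuous_measurable_fun (@continuous_cos R).
- apply: measurable_funM; first exact: measurableT_comp me _.
  apply: measurable_funM; first exact: measurableT_comp mh _.
  apply: measurableT_comp; first exact: continuous_measurable_fun (@continuous_cos R).
  by apply: measurable_funM => //; apply: measurable_funB.
- exact: ie.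
- exact: integrable_norm.
- move=> t y; rewrite normrM ger0_norm ?expR_ge0// ler_wpM2l ?expR_ge0//.
  by rewrite normrM ler_piMr// cos_max.
Qed.

(** The kernels p e are an approximate identity: near x the continuity of h is
    used, and at distance at least dl from x the kernel p e is at most e times
    the functions collected in the integrable D. *)
Let cauchy_approx (eta : R) : 0 < eta -> exists D : R, forall e : R, 0 < e <= 1 ->
  `|\int[mu]_y (h y * p e y) - 2 * pi * h x| <= eta * (2 * pi) + e * D.
Proof.
move=> eta0.
have chx : h y @[y --> x] --> h x by exact: ch.
have /cvgrPdist_le/(_ eta eta0)[dl /= dl0 hdl] := chx.
pose D y := 2 / dl ^+ 2 * `|h y| + `|h x| * (1 + dl ^-2) * (2 * 1 / (1 ^+ 2 + (y - x) ^+ 2)).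
have [iq Iq] := integral_cauchy x (@ltr01 R).
have iD : mu.-integrable setT (EFin \o D).
  have i1 := integrableZl measurableT (2 / dl ^+ 2) (integrable_norm ih).
  exact: (integrableD measurableT i1
    (integrableZl measurableT (`|h x| * (1 + dl ^-2)) iq)).
exists (\int[mu]_y D y) => e /andP[e0 e1].
have [ip Ip] := integral_cauchy x e0.
have ihp : mu.-integrable setT (fun y => (h y * p e y)%:E).
  apply: (integrable_mulr (M := 2 / e) ih); first exact: mp.
  by move=> y; rewrite ger0_norm ?p_ge0// pM.
have ixp : mu.-integrable setT (fun y => (h x * p e y)%:E).
  exact: (integrableZl measurableT (h x) ip).
have -> : \int[mu]_y (h y * p e y) - 2 * pi * h x = \int[mu]_y ((h y - h x) * p e y).
  rewrite -Ip mulrC -RintegralZl// -RintegralB//.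
  by apply: eq_Rintegral => y _; rewrite /p; ring.
rewrite -Ip -!RintegralZl// -RintegralD//; last 2 first.
- exact: (integrableZl measurableT eta ip).
- exact: (integrableZl measurableT e iD).
apply: Rintegral_bound.
- exact: (integrableD measurableT (integrableZl measurableT eta ip)
    (integrableZl measurableT e iD)).
- by apply: measurable_funM; [exact: measurable_funB|exact: mp].
move=> y; rewrite normrM (ger0_norm (p_ge0 y e0)).
have D0 : 0 <= D y.
  rewrite /D addr_ge0// !mulr_ge0 ?invr_ge0 ?addr_ge0 ?sqr_ge0 ?exprn_ge0 ?invr_ge0 ?sqr_ge0//.
have P0 : 0 <= p e y by exact: p_ge0.
have [yd|yd] := ltP `|x - y| dl.
  apply: (@le_trans _ _ (eta * p e y)); last by rewrite lerDl mulr_ge0// ltW.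
  by apply: ler_pM => //; rewrite distrC; exact: hdl.
apply: (@le_trans _ _ (e * D y)); last by rewrite lerDr; apply: mulr_ge0 => //; exact: ltW.
have d2 : dl ^+ 2 <= (y - x) ^+ 2.
  by rewrite -[(y - x) ^+ 2]real_normK ?num_real// distrC lerXn2r ?nnegrE// ltW.
have d20 : 0 < dl ^+ 2 by rewrite exprn_gt0.
have yx0 : 0 < (y - x) ^+ 2 by exact: lt_le_trans d2.
have eyx : 0 < e ^+ 2 + (y - x) ^+ 2 by rewrite ltr_pwDl ?exprn_gt0// sqr_ge0.
have eyx2 : (y - x) ^+ 2 <= e ^+ 2 + (y - x) ^+ 2 by rewrite lerDr sqr_ge0.
have p1 : p e y <= e * (2 / dl ^+ 2).
  rewrite /p [2 * e]mulrC -mulrA; apply: ler_wpM2l; first exact: ltW.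
  by apply: ler_wpM2l => //; rewrite lef_pV2 ?posrE//; exact: le_trans eyx2.
have p2 : p e y <= e * ((1 + dl ^-2) * (2 * 1 / (1 ^+ 2 + (y - x) ^+ 2))).
  rewrite /p expr1n mulr1 [2 * e]mulrC -mulrA; apply: ler_wpM2l; first exact: ltW.
  rewrite [leRHS]mulrCA; apply: ler_wpM2l => //.
  apply: (@le_trans _ _ ((y - x) ^+ 2)^-1); first by rewrite lef_pV2 ?posrE.
  rewrite ler_pdivlMr; last by rewrite ltr_pwDl ?sqr_ge0.
  by rewrite mulrDr mulr1 mulVf ?gt_eqF// addrC lerD2l lef_pV2.
apply: (@le_trans _ _ (`|h y| * p e y + `|h x| * p e y)).
  by rewrite -[leRHS]mulrDl; apply: ler_pM => //; exact: ler_normB.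
have -> : e * D y = `|h y| * (e * (2 / dl ^+ 2)) +
    `|h x| * (e * ((1 + dl ^- 2) * (2 * 1 / (1 ^+ 2 + (y - x) ^+ 2)))).
  by rewrite /D; ring.
by apply: lerD; exact: ler_wpM2l.
Qed.

(** Let e tend to 0 in [abel]: the left side converges by dominated convergence,
    the right side by [cauchy_approx]. *)
Lemma fourier_inversion : mu.-integrable setT (EFin \o C) ->
  \int[mu]_t C t = 2 * pi * h x.
Proof.
move=> iC; pose e n : R := n.+1%:R^-1.
have e0 n : 0 < e n by rewrite invr_gt0.
have e1 n : e n <= 1 by rewrite invf_le1// ler1n.
have cA : \int[mu]_t (expR (- (e n * `|t|)) * C t) @[n --> \oo] --> \int[mu]_t C t.
  apply: (@cvg_Rintegral _ (measurableTypeR R) R mu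
    (fun n t => expR (- (e n * `|t|)) * C t) C (fun t => `|C t|)) => //.
  - move=> n; apply: measurable_funM => //; have [ie _] := poisson_integral (e0 n) 0.
    by apply/measurable_EFinP; exact: measurable_int ie.
  - move=> t; rewrite -[X in _ --> X]mul1r; apply: cvgM; last exact: cvg_cst.
    have c0 : - (e n * `|t|) @[n --> \oo] --> (0 : R).
      rewrite -oppr0 -[in X in _ --> - X](mul0r `|t|).
      by apply: cvgN; apply: cvgM; [exact: cvg_harmonic|exact: cvg_cst].
    by rewrite -expR0; exact: (cvg_comp _ _ c0 (@continuous_expR R 0)).
  - exact: integrable_norm.
  - apply: nearW => n t; rewrite normrM ger0_norm ?expR_ge0// ler_piMl//.
    by rewrite expR_le1 oppr_le0 mulr_ge0// ltW.
apply/eqP; rewrite -subr_eq0 -normr_le0; apply/ler_addgt0Pr => eta eta0; rewrite add0r.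
have eta1 : 0 < eta / (2 * pi) by rewrite divr_gt0// mulr_gt0// pi_gt0.
have [D HD] := cauchy_approx eta1.
have cL : `|\int[mu]_t (expR (- (e n * `|t|)) * C t) - 2 * pi * h x| @[n --> \oo] -->
   `|\int[mu]_t C t - 2 * pi * h x|.
  by apply: cvg_norm; apply: cvgB => //; exact: cvg_cst.
have cR : eta / (2 * pi) * (2 * pi) + e n * D @[n --> \oo] --> eta.
  rewrite -[X in _ --> X]addr0; apply: cvgD.
    rewrite [X in _ --> X](_ : _ = eta / (2 * pi) * (2 * pi)); first exact: cvg_cst.
    by rewrite divfK// mulf_neq0// gt_eqF// pi_gt0.
  by rewrite -(mul0r D); apply: cvgM; [exact: cvg_harmonic|exact: cvg_cst].
apply: (ler_cvg_to cL cR); apply: nearW => n.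
by rewrite abel//; apply: HD; rewrite e0 e1.
Qed.

End fourier_inversion.

(** * The triangle function and the Fejer kernel *)

Section fejer_kernel.
Context (R : realType).
Local Notation mu := (@lebesgue_measure R).

Lemma FTC_is_derive (f F : R -> R) (a b : R) : a < b -> continuous f ->
  (forall t : R, is_derive t 1 F (f t)) ->
  (\int[mu]_(t in `[a, b]) (f t)%:E = (F b - F a)%:E)%E.
Proof.
move=> ab cf dF; have cF : continuous F by move=> t; exact: is_derive_continuous (dF t).
rewrite (@continuous_FTC2 _ f F)//.
- exact: continuous_subspaceT.
- split=> [t _||]; first by have [] := dF t.
  + by apply: cvg_at_right_filter; exact: cF.
  + by apply: cvg_at_left_filter; exact: cF.
- by move=> t _; exact: is_derive_derive1.
Qed.

(** The Fourier transform of w when w is even. *)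
Definition cos_transform (w : R -> R) (x : R) := \int[mu]_t (w t * cos (t * x)).

Definition tri (t : R) : R := Num.max 0 (1 - `|t|).

Lemma tri_ge0 t : 0 <= tri t. Proof. by rewrite /tri le_max lexx. Qed.

Lemma tri_le1 t : tri t <= 1.
Proof. by rewrite /tri ge_max ler01 gerBl normr_ge0. Qed.

Lemma triN t : tri (- t) = tri t. Proof. by rewrite /tri normrN. Qed.

Lemma tri0 : tri 0 = 1.
Proof. by rewrite /tri normr0 subr0; apply/max_idPr. Qed.

Lemma tri_eq0 t : 1 <= `|t| -> tri t = 0.
Proof. by move=> t1; apply/max_idPl; rewrite subr_le0. Qed.

Lemma continuous_tri : continuous tri.
Proof.
move=> t; apply: (@continuous_max _ _ (fun=> 0) (fun t => 1 - `|t|)); first exact: cvg_cst.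
by apply: cvgB; [exact: cvg_cst|exact: continuous_abs].
Qed.

(** As for the Poisson kernel, 1 + cos is used for its sign, and a primitive F
    on [0, 1] gives the value. *)
Let tri_cos_half x (F : R -> R) :
  (forall t : R, is_derive t 1 F ((1 - t) * (1 + cos (t * x)))) ->
  mu.-integrable setT (fun t => (tri t * (1 + cos (t * x)))%:E) /\
  \int[mu]_t (tri t * (1 + cos (t * x))) = 2 * (F 1 - F 0).
Proof.
move=> dF.
have cc : continuous (fun t : R => 1 + cos (t * x)).
  by move=> t; apply: is_derive_continuous; solve_derive.
apply: even_integral.
- by move=> t; rewrite mulr_ge0 ?tri_ge0//; have := cos_geN1 (t * x); lra.
- by move=> t; apply: cvgM; [exact: continuous_tri|exact: cc].
- by move=> t; rewrite triN mulNr cosN.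
rewrite -(@FTC_is_derive (fun t => (1 - t) * (1 + cos (t * x))) F)//.
  rewrite integral_mkcond [RHS]integral_mkcond; apply: eq_integral => t _.
  rewrite !patchE !mem_setE !in_itv/= andbT.
  have [t0/=|//] := leP 0 t; have [t1|t1] := leP t 1.
    by rewrite /tri ger0_norm//; congr (_ * _)%:E; apply/max_idPr; rewrite subr_ge0.
  by rewrite tri_eq0 ?mul0r// ger0_norm// ltW.
by move=> t; apply: cvgM; [apply: cvgB; [exact: cvg_cst|exact: cvg_id]|exact: cc].
Qed.

Lemma integral_tri : mu.-integrable setT (EFin \o tri) /\ \int[mu]_t tri t = 1.
Proof.
have [|i I] := @tri_cos_half 0 (fun t => 2 * t - t * t).
  by move=> t; apply: is_derive_eq; rewrite /GRing.scale/= mulr0 cos0; ring.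
have iT : mu.-integrable setT (EFin \o tri).
  apply: (@integrable_le _ _ _ mu _ _ _ i).
    exact: continuous_measurable_fun continuous_tri.
  by move=> t; rewrite mulr0 cos0 ger0_norm ?tri_ge0// ler_peMr ?tri_ge0//; lra.
split=> //; move: I; under eq_Rintegral do rewrite mulr0 cos0 mulrC.
by rewrite RintegralZl//; lra.
Qed.

Lemma cos_transform_tri x : x != 0 -> cos_transform tri x = 2 * (1 - cos x) / x ^+ 2.
Proof.
move=> x0; have [iT IT] := integral_tri.
have [|i I] := @tri_cos_half x (fun t => t - 2^-1 * (t * t) +
    x^-1 * ((1 - t) * sin (t * x)) - (x ^+ 2)^-1 * cos (t * x)).
  by move=> t; apply: is_derive_eq; rewrite /GRing.scale/=; field.
transitivity (\int[mu]_t (tri t * (1 + cos (t * x)) - tri t)).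
  by apply: eq_Rintegral => t _; ring.
by rewrite RintegralB// I IT !mul0r !mul1r sin0 cos0 subrr; field.
Qed.

Let fejer := cos_transform tri.

Lemma continuous_fejer : continuous fejer.
Proof.
have [iT _] := integral_tri.
have -> : fejer = fun x => \int[mu]_t (tri t * cos (x * t)).
  by apply/funext => x; apply: eq_Rintegral => t _; rewrite [x * t]mulrC.
by apply: continuous_wave_integral => //; [exact: continuous_cos|exact: cos_max].
Qed.

Lemma fejer_ge0 x : 0 <= fejer x.
Proof.
have [->|x0] := eqVneq x 0.
  by apply: Rintegral_ge0 => t _; rewrite mulr0 cos0 mulr1 tri_ge0.
by rewrite /fejer cos_transform_tri// divr_ge0 ?sqr_ge0// mulr_ge0// subr_ge0.
Qed.

Lemma fejer_le x : fejer x * x ^+ 2 <= 4.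
Proof.
have [->|x0] := eqVneq x 0; first by rewrite expr0n/= mulr0.
rewrite /fejer cos_transform_tri// divfK ?expf_neq0//.
by have := cos_geN1 x; lra.
Qed.

Lemma fejer_le1 x : fejer x <= 1.
Proof.
have [iT IT] := integral_tri; rewrite -IT; apply: le_Rintegral => //.
  apply: (integrable_mulr (M := 1) iT); last by move=> ?; exact: cos_max.
  apply: measurableT_comp; last exact: measurable_funM.
  exact: continuous_measurable_fun (@continuous_cos R).
by move=> t _; rewrite ler_piMr ?tri_ge0// cos_le1.
Qed.

(** A lower bound that degenerates only at the zeros of the Fejer kernel, the
    nonzero multiples of 2 pi. *)
Lemma fejer_lower x : 2 * (1 - cos x) <= fejer x * (1 + x ^+ 2).
Proof.
have [->|x0] := eqVneq x 0.
  by rewrite cos0 subrr mulr0 mulr_ge0 ?fejer_ge0// addr_ge0// sqr_ge0.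
have E : fejer x * x ^+ 2 = 2 * (1 - cos x).
  by rewrite /fejer cos_transform_tri// divfK// expf_neq0.
by rewrite -E [leRHS]mulrDr mulr1 lerDr fejer_ge0.
Qed.

Lemma fejer_upper x : fejer x <= 5 * (1 + x ^+ 2)^-1.
Proof.
rewrite ler_pdivlMr; last by rewrite ltr_pwDl ?sqr_ge0.
by rewrite mulrDr mulr1; have := fejer_le1 x; have := fejer_le x; lra.
Qed.

Lemma integrable_fejer : mu.-integrable setT (EFin \o fejer).
Proof.
have [i _] := @integral_oneDsqrV R.
apply: (@integrable_le _ _ _ mu _ _ _ (integrableZl measurableT 5 i)).
  exact: continuous_measurable_fun continuous_fejer.
by move=> x; rewrite ger0_norm ?fejer_ge0//; exact: fejer_upper.
Qed.

(** Fourier inversion of the triangle function at 0. *)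
Lemma integral_fejer : \int[mu]_x fejer x = 2 * pi.
Proof.
have [iT _] := integral_tri.
have CE : (fun t => \int[mu]_y (tri y * cos (t * (y - 0)))) = fejer.
  apply/funext => t; apply: eq_Rintegral => y _.
  by rewrite subr0 [t * y]mulrC.
have := @fourier_inversion R tri continuous_tri iT 0.
by rewrite CE tri0 mulr1; apply; exact: integrable_fejer.
Qed.

End fejer_kernel.

(** * Rescaled transforms *)

Section cutoff.
Context (R : realType).
Local Notation mu := (@lebesgue_measure R).

(** Used both to restrict the frequencies and as the weight of the lattice
    case. *)
Definition cutoff (k t : R) : R := \1_(`[- k, k]%classic : set R) t.

Lemma cutoffE k t : cutoff k t = (`|t| <= k)%R%:R.
Proof. by rewrite /cutoff indicE mem_setE in_itv/= ler_norml. Qed.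

Lemma integrable_cutoff k : mu.-integrable setT (EFin \o cutoff k).
Proof. exact: integrable_indic_itv. Qed.

Lemma measurable_cutoff k : measurable_fun setT (cutoff k).
Proof. exact: measurable_indic. Qed.

Lemma cutoff_le1 k t : `|cutoff k t| <= 1.
Proof. by rewrite ger0_norm cutoffE ?ler0n//; case: (`|t| <= k); rewrite ?lexx ?ler01. Qed.

End cutoff.

Section scaled_convergence.
Context (R : realType).
Local Notation mu := (@lebesgue_measure R).
Variables (B : nat -> R) (w : R -> R) (delta kappa : R).
Hypothesis By : B n @[n --> \oo] --> +oo.
Hypothesis iw : mu.-integrable setT (EFin \o w).
Hypothesis w1 : forall t, `|w t| <= 1.
Hypothesis wk : forall t, kappa < `|t| -> w t = 0.
Hypothesis w0 : w t @[t --> (0 : R)] --> (1 : R).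
Hypothesis delta0 : 0 < delta.

Let mw : measurable_fun setT w.
Proof. by apply/measurable_EFinP; exact: measurable_int iw. Qed.

Lemma near_B_gt (M : R) : \forall n \near \oo, M < B n.
Proof. by have /cvgryPgt := By; exact. Qed.

Lemma cvg_divB (s : R) : s / B n @[n --> \oo] --> (0 : R).
Proof.
apply/cvgrPdist_le => e e0; have := near_B_gt (Num.max 0 (`|s| / e)).
apply: filterS => n; rewrite gt_max => /andP[B0 sB].
rewrite sub0r normrN normrM normfV [`|B n|]gtr0_norm// ler_pdivrMr//.
by rewrite mulrC -ler_pdivrMr// ltW.
Qed.

(** The region |s| <= delta B_n is treated by dominated convergence, where
    w (s / B_n) tends to 1.  Outside it the weight restricts s to
    |s| <= kappa B_n, a set of measure O(B_n), on which the transform is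
    o(1 / B_n). *)
Lemma cvg_scaled_L1 (u : nat -> R -> R) (uL D : R -> R) :
  (forall n, measurable_fun setT (u n)) -> (forall n t, `|u n t| <= 1) ->
  mu.-integrable setT (EFin \o uL) -> mu.-integrable setT (EFin \o D) ->
  (forall s, u n (s / B n) @[n --> \oo] --> uL s) ->
  (\forall n \near \oo, forall s : R, `|s| <= delta * B n -> `|u n (s / B n)| <= D s) ->
  (forall e : R, 0 < e -> \forall n \near \oo, forall t : R, delta <= `|t| <= kappa ->
     B n * `|u n t| <= e) ->
  forall e : R, 0 < e -> \forall n \near \oo,
    \int[mu]_s `|w (s / B n) * u n (s / B n) - uL s| <= e.
Proof.
move=> mu_ u1 iL iD cu uD tail e e0.
have mL : measurable_fun setT uL by apply/measurable_EFinP; exact: measurable_int iL.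
have mdiv n : measurable_fun setT (fun s : R => s / B n) by exact: measurable_funM.
have mwu n : measurable_fun setT (fun s : R => w (s / B n) * u n (s / B n)).
  by apply: measurable_funM; [exact: measurableT_comp mw (mdiv n)|exact: measurableT_comp (mu_ n) (mdiv n)].
pose f n (s : R) : R := `|cutoff (delta * B n) s * (w (s / B n) * u n (s / B n)) - uL s|.
have mf n : measurable_fun setT (f n).
  apply: measurableT_comp => //; apply: measurable_funB => //.
  by apply: measurable_funM => //; exact: measurable_cutoff.
have f0 : \int[mu]_s f n s @[n --> \oo] --> \int[mu]_s (0 : R).
  apply: (@cvg_Rintegral _ (measurableTypeR R) R mu f (fun=> 0)
    (fun s : R => `|D s| + `|uL s|)) => //.
  - move=> s; suff : f n s @[n --> \oo] --> `|uL s - uL s| by rewrite subrr normr0.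
    apply: cvg_norm; apply: cvgB; last exact: cvg_cst.
    have -> : uL s = 1 * (1 * uL s) by rewrite !mul1r.
    apply: cvgM.
      apply: cvg_near_cst; have := near_B_gt (`|s| / delta).
      apply: filterS => n; rewrite ltr_pdivrMr// mulrC => sB.
      by rewrite cutoffE ltW.
    by apply: cvgM => //; exact: (cvg_comp _ _ (cvg_divB s) w0).
  - exact: (integrableD measurableT (integrable_norm iD) (integrable_norm iL)).
  - apply: filterS uD => n uD s; rewrite /f ger0_norm//.
    apply: le_trans (ler_normB _ _) _; rewrite lerD2r cutoffE.
    have [sB|_] := leP `|s| _; last by rewrite mul0r normr0.
    rewrite mul1r normrM (le_trans _ (ler_norm _))// (le_trans _ (uD s sB))//.
    by rewrite ler_piMl.
rewrite Rintegral_cst//= mul0r in f0.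
pose I := \int[mu]_t cutoff kappa t.
have I0 : 0 <= I by apply: Rintegral_ge0 => t _; rewrite cutoffE ler0n.
have I1 : 0 < I + 1 by lra.
have e2 : 0 < e / 2 / (I + 1) by rewrite !divr_gt0.
have /cvgrPdist_le/(_ (e / 2)) := f0; rewrite divr_gt0// => /(_ erefl) fe.
have tl := tail _ e2; have Bp := near_B_gt 0.
near=> n.
have B0 : 0 < B n by near: n.
have F : \int[mu]_s f n s <= e / 2.
  have : `|0 - \int[mu]_s f n s| <= e / 2 by near: n.
  by rewrite sub0r normrN; apply: le_trans; exact: ler_norm.
have Bi : 0 < (B n)^-1 by rewrite invr_gt0.
have iC : mu.-integrable setT (fun s => (cutoff kappa ((B n)^-1 * s + 0))%:E).
  exact: (integrable_affine 0 Bi (integrable_cutoff kappa)).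
have IC : \int[mu]_s cutoff kappa ((B n)^-1 * s + 0) = B n * I.
  rewrite /I (Rintegral_affine 0 Bi (integrable_cutoff kappa)).
  by rewrite mulrA divff ?mul1r// gt_eqF.
have if_ : mu.-integrable setT (EFin \o f n).
  apply: (@integrable_le _ _ _ mu (f n)
    (fun s : R => cutoff (delta * B n) s + `|uL s|) (mf n)).
    exact: (integrableD measurableT (integrable_cutoff _) (integrable_norm iL)).
  move=> s; rewrite /f normr_id (le_trans (ler_normB _ _))// lerD2r normrM.
  rewrite [`|cutoff _ _|]ger0_norm; last by rewrite cutoffE ler0n.
  by rewrite ler_piMr ?normrM ?mulr_ile1// cutoffE ler0n.
(* the outer region has measure at most B_n * I, so that an integrand bounded
   by c contributes at most e / 2 *)
pose c := e / 2 / (I + 1) / B n.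
have icC : mu.-integrable setT (fun s => (c * cutoff kappa ((B n)^-1 * s + 0))%:E).
  exact: (integrableZl measurableT c iC).
apply: (@le_trans _ _ (\int[mu]_s (f n s + c * cutoff kappa ((B n)^-1 * s + 0)))).
  rewrite -[leLHS]ger0_norm; last by apply: Rintegral_ge0.
  apply: Rintegral_bound; first exact: (integrableD measurableT if_ icC).
    by apply: measurableT_comp => //; exact: (measurable_funB (mwu n) mL).
  move=> s; rewrite normr_id addr0 [_^-1 * s]mulrC /f !cutoffE.
  have c0 : 0 <= c by rewrite /c divr_ge0// ltW.
  have [sB|sB] := leP `|s| (delta * B n).
    by rewrite mul1r lerDl mulr_ge0// ler0n.
  rewrite mul0r sub0r normrN.
  have [sk|sk] := leP `|s / B n| kappa; last first.
    by rewrite wk// mul0r sub0r normrN mulr0 addr0.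
  rewrite mulr1 [leRHS]addrC (le_trans (ler_normB _ _))// lerD2r normrM.
  apply: le_trans (ler_piMl _ (w1 _)) _ => //.
  rewrite /c ler_pdivlMr// mulrC.
  have H : forall t : R, delta <= `|t| <= kappa -> B n * `|u n t| <= e / 2 / (I + 1) by near: n.
  apply: H; rewrite sk andbT normrM normfV [`|B n|]gtr0_norm// ler_pdivlMr//.
  exact: ltW.
rewrite RintegralD// RintegralZl// IC [leRHS]splitr lerD//.
rewrite /c mulrA divfK ?gt_eqF// mulrAC ler_pdivrMr//.
by rewrite ler_wpM2l// ?lerDl// ltW// divr_gt0.
Unshelve. all: by end_near. Qed.

End scaled_convergence.

(** * The local limit for kernels with compactly supported transform *)

Section expectations_of_waves.
Context (d : measure_display) (T : measurableType d) (R : realType)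
  (P : probability T R).
Local Notation mu := (@lebesgue_measure R).
Variable (S : T -> R).
Hypothesis mS : measurable_fun setT S.

Definition Ecos (t : R) := \int[P]_o cos (t * S o).
Definition Esin (t : R) := \int[P]_o sin (t * S o).

Let mwave (c : R -> R) (t : R) : continuous c -> measurable_fun setT (fun o => c (t * S o)).
Proof.
by move=> cc; apply: measurableT_comp; [exact: continuous_measurable_fun|exact: measurable_funM].
Qed.

Lemma Ecos_le1 t : `|Ecos t| <= 1.
Proof.
apply: Rintegral_prob_bound; first by apply: mwave; exact: continuous_cos.
by move=> o; exact: cos_max.
Qed.

Lemma Esin_le1 t : `|Esin t| <= 1.
Proof.
apply: Rintegral_prob_bound; first by apply: mwave; exact: continuous_sin.
by move=> o; exact: sin_max.
Qed.

Let continuous_E (c : R -> R) : continuous c -> (forall x, `|c x| <= 1) ->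
  continuous (fun t : R => \int[P]_o c (t * S o) : R).
Proof.
move=> cc c1.
have -> : (fun t : R => \int[P]_o c (t * S o)) = fun t : R => \int[P]_o (1 * c (t * S o)).
  by apply/funext => t; apply: eq_Rintegral => o _; rewrite mul1r.
apply: (@continuous_wave_integral _ T R P (fun=> 1) S) => //.
exact: finite_measure_integrable_cst.
Qed.

Lemma measurable_Ecos : measurable_fun setT Ecos.
Proof.
apply: continuous_measurable_fun; apply: continuous_E; [exact: continuous_cos|exact: cos_max].
Qed.

Lemma measurable_Esin : measurable_fun setT Esin.
Proof.
apply: continuous_measurable_fun; apply: continuous_E; [exact: continuous_sin|exact: sin_max].
Qed.

Lemma Ecos_shift (t v : R) :
  \int[P]_o cos (t * (S o + v)) = cos (t * v) * Ecos t - sin (t * v) * Esin t.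
Proof.
have ic : P.-integrable setT (fun o => (cos (t * S o))%:E).
  apply: (@integrable_bounded _ _ _ P 1); first by apply: mwave; exact: continuous_cos.
  by move=> o; exact: cos_max.
have is_ : P.-integrable setT (fun o => (sin (t * S o))%:E).
  apply: (@integrable_bounded _ _ _ P 1); first by apply: mwave; exact: continuous_sin.
  by move=> o; exact: sin_max.
rewrite -!RintegralZl// -RintegralB//.
- by apply: eq_Rintegral => o _; rewrite mulrDr cosD; ring.
- exact: (integrableZl measurableT (cos (t * v)) ic).
- exact: (integrableZl measurableT (sin (t * v)) is_).
Qed.

(** Fubini, and the addition formula to separate the shift v. *)
Lemma cos_transform_expectation (w : R -> R) (v : R) : mu.-integrable setT (EFin \o w) ->
  \int[P]_o cos_transform w (S o + v) =
  \int[mu]_t (w t * (cos (t * v) * Ecos t - sin (t * v) * Esin t)).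
Proof.
move=> iw; have mw : measurable_fun setT w by apply/measurable_EFinP; exact: measurable_int iw.
rewrite (@Rintegral_Fubini _ _ T (measurableTypeR R) R P mu
  (fun o t => w t * cos (t * (S o + v))) (fun=> 1) (fun t => `|w t|)).
- apply: eq_Rintegral => t _; rewrite RintegralZl// ?Ecos_shift//.
  apply: (@integrable_bounded _ _ _ P 1); last by move=> o; exact: cos_max.
  apply: measurableT_comp; first exact: continuous_measurable_fun (@continuous_cos R).
  by apply: measurable_funM => //; exact: measurable_funD.
- apply: measurable_funM; first exact: measurableT_comp mw _.
  apply: measurableT_comp; first exact: continuous_measurable_fun (@continuous_cos R).
  apply: measurable_funM => //; apply: measurable_funD => //.
  exact: measurableT_comp mS _.
- exact: finite_measure_integrable_cst.
- exact: integrable_norm.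
- by move=> o t; rewrite mul1r normrM ler_piMr// cos_max.
Qed.

End expectations_of_waves.

Section kernel_local_limit.
Context (d : measure_display) (T : measurableType d) (R : realType)
  (P : probability T R).
Local Notation mu := (@lebesgue_measure R).
Variables (S : nat -> T -> R) (B : nat -> R) (cL sL hL : R -> R) (delta : R) (D : R -> R).
Hypothesis mS : forall n, measurable_fun setT (S n).
Hypothesis By : B n @[n --> \oo] --> +oo.
Hypothesis icL : mu.-integrable setT (EFin \o cL).
Hypothesis isL : mu.-integrable setT (EFin \o sL).
Hypothesis hLE : forall x,
  2 * pi * hL x = \int[mu]_s (cL s * cos (s * x) + sL s * sin (s * x)).
Hypothesis cvg_c : forall s, Ecos P (S n) (s / B n) @[n --> \oo] --> cL s.
Hypothesis cvg_s : forall s, Esin P (S n) (s / B n) @[n --> \oo] --> sL s.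
Hypothesis delta0 : 0 < delta.
Hypothesis iD : mu.-integrable setT (EFin \o D).
Hypothesis dom_c : \forall n \near \oo, forall s : R, `|s| <= delta * B n ->
  `|Ecos P (S n) (s / B n)| <= D s.
Hypothesis dom_s : \forall n \near \oo, forall s : R, `|s| <= delta * B n ->
  `|Esin P (S n) (s / B n)| <= D s.

Variables (w : R -> R) (kappa : R).
Hypothesis iw : mu.-integrable setT (EFin \o w).
Hypothesis w1 : forall t, `|w t| <= 1.
Hypothesis wk : forall t, kappa < `|t| -> w t = 0.
Hypothesis w0 : w t @[t --> (0 : R)] --> (1 : R).
Hypothesis tail_c : forall e : R, 0 < e -> \forall n \near \oo, forall t : R,
  delta <= `|t| <= kappa -> B n * `|Ecos P (S n) t| <= e.
Hypothesis tail_s : forall e : R, 0 < e -> \forall n \near \oo, forall t : R,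
  delta <= `|t| <= kappa -> B n * `|Esin P (S n) t| <= e.

(** After the substitution t = s / B_n both quantities are integrals over s in
    which v only occurs in factors cos and sin; the difference is thus bounded,
    uniformly in v, by the L^1 distances of [cvg_scaled_L1]. *)
Lemma kernel_local_limit (e : R) : 0 < e -> \forall n \near \oo, forall v : R,
  `|B n * \int[P]_o cos_transform w (S n o + v) - 2 * pi * hL (- (v / B n))| <= e.
Proof.
move=> e0; have e20 : 0 < e / 2 by rewrite divr_gt0.
have mw : measurable_fun setT w by apply/measurable_EFinP; exact: measurable_int iw.
have mcL : measurable_fun setT cL by apply/measurable_EFinP; exact: measurable_int icL.
have msL : measurable_fun setT sL by apply/measurable_EFinP; exact: measurable_int isL.
have near_c := cvg_scaled_L1 By iw w1 wk w0 delta0 (fun n => measurable_Ecos P (mS n))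
  (fun n => Ecos_le1 P (mS n)) icL iD cvg_c dom_c tail_c e20.
have near_s := cvg_scaled_L1 By iw w1 wk w0 delta0 (fun n => measurable_Esin P (mS n))
  (fun n => Esin_le1 P (mS n)) isL iD cvg_s dom_s tail_s e20.
have B0 := near_B_gt By 0.
near=> n; move=> v.
have Bn : 0 < B n by near: n.
have Bi : 0 < (B n)^-1 by rewrite invr_gt0.
have cE : \int[mu]_s `|w (s / B n) * Ecos P (S n) (s / B n) - cL s| <= e / 2 by near: n.
have sE : \int[mu]_s `|w (s / B n) * Esin P (S n) (s / B n) - sL s| <= e / 2 by near: n.
have mcos (x : R) : measurable_fun setT (fun s : R => cos (s * x)).
  apply: measurableT_comp; last exact: measurable_funM.
  exact: continuous_measurable_fun (@continuous_cos R).
have msin (x : R) : measurable_fun setT (fun s : R => sin (s * x)).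
  apply: measurableT_comp; last exact: measurable_funM.
  exact: continuous_measurable_fun (@continuous_sin R).
have iwu (u : R -> R) : measurable_fun setT u -> (forall t, `|u t| <= 1) ->
    mu.-integrable setT (fun t => (w t * u t)%:E).
  by move=> mu_ u1; exact: (integrable_mulr iw mu_ u1).
have iwc := iwu _ (measurable_Ecos P (mS n)) (Ecos_le1 P (mS n)).
have iws := iwu _ (measurable_Esin P (mS n)) (Esin_le1 P (mS n)).
have sc (f : R -> R) : mu.-integrable setT (EFin \o f) ->
    mu.-integrable setT (fun s => (f (s / B n))%:E).
  move=> if_; apply: eq_integrable (integrable_affine 0 Bi if_) => // s _ /=.
  by rewrite addr0 mulrC.
have iwc' := sc _ iwc; have iws' := sc _ iws.
pose q t := w t * (cos (t * v) * Ecos P (S n) t - sin (t * v) * Esin P (S n) t).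
have iq : mu.-integrable setT (EFin \o q).
  have i1 := integrable_mulr iwc (mcos v) (fun s => cos_max (s * v)).
  have i2 := integrable_mulr iws (msin v) (fun s => sin_max (s * v)).
  apply: eq_integrable (integrableB measurableT i1 i2) => // s _.
  by rewrite /= -EFinB; congr EFin; rewrite /q; ring.
have -> : B n * \int[P]_o cos_transform w (S n o + v) = \int[mu]_s q (s / B n).
  rewrite cos_transform_expectation// -/(q _) (Rintegral_affine 0 Bi iq).
  rewrite mulrA divff ?gt_eqF// mul1r; apply: eq_Rintegral => s _.
  by rewrite addr0 mulrC.
have iJ (x : R) : mu.-integrable setT (fun s => (cL s * cos (s * x) + sL s * sin (s * x))%:E).
  have i1 := integrable_mulr icL (mcos x) (fun s => cos_max (s * x)).
  have i2 := integrable_mulr isL (msin x) (fun s => sin_max (s * x)).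
  exact: (integrableD measurableT i1 i2).
rewrite hLE -RintegralB; [|by []|exact: (sc _ iq)|exact: iJ].
have iA := integrable_norm (integrableB measurableT iwc' icL).
have iB := integrable_norm (integrableB measurableT iws' isL).
rewrite [e]splitr; apply: le_trans (lerD cE sE).
rewrite -RintegralD//; apply: Rintegral_bound; first exact: (integrableD measurableT iA iB).
  apply: measurable_funB.
    by apply/measurable_EFinP; exact: measurable_int (sc _ iq).
  by apply/measurable_EFinP; exact: measurable_int (iJ _).
move=> s; rewrite /q mulrN sinN cosN mulrA mulrAC.
set a := cos _; set b := sin _; set C := Ecos _ _ _; set D' := Esin _ _ _.
set W := w _.
have -> : W * (a * C - b * D') - (cL s * a + sL s * - b) =
  (W * C - cL s) * a - (W * D' - sL s) * b by ring.
apply: le_trans (ler_normB _ _) _; rewrite !normrM.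
by apply: lerD; rewrite ler_piMr ?cos_max ?sin_max.
Unshelve. all: by end_near. Qed.

End kernel_local_limit.

(** * Conditions A and B as bounds on transforms *)

Section conditions_on_charfuns.
Context (R : realType).
Local Notation mu := (@lebesgue_measure R).
Variables (a : R) (f : nat -> R -> R[i]) (B : nat -> R) (psi : nat -> R -> R).
Hypothesis By : B n @[n --> \oo] --> +oo.
Hypothesis psiE : forall n t, psi n t <= expR (- (a ^+ 4 / 2 ^+ 4 *
  \sum_(1 <= k < n.+1) (1 - Normc.normc (f k t) ^+ 2))).
Hypothesis psi1 : forall n t, psi n t <= 1.

(** The dominating function is 1 on [-1, 1] and exp (- G |s|) elsewhere. *)
Lemma condition_A_dominates : condition_A a f B ->
  exists (delta : R) (D : R -> R), [/\ 0 < delta, mu.-integrable setT (EFin \o D) &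
    \forall n \near \oo, forall s : R, `|s| <= delta * B n -> psi n (s / B n) <= D s].
Proof.
move=> [delta [n0 [G [d0 [mG G0] AG iG]]]].
pose A := [set u : R | 1 <= `|u|].
have mA : measurable A.
  by rewrite -[X in measurable X]setTI; apply: measurable_fun_ler => //; exact: measurableT_comp.
pose D (s : R) : R := cutoff 1 s + ((fun u : R => expR (- G `|u|)) \_ A) s.
exists delta, D; split=> //.
  have iG' : mu.-integrable setT (EFin \o ((fun u : R => expR (- G `|u|)) \_ A)).
    rewrite -restrict_EFin.
    exact: (proj1 (@integrable_mkcond _ (measurableTypeR R) R mu A _ mA) iG).
  exact: (integrableD measurableT (integrable_cutoff 1) iG').
exists n0.+1 => // n /= n0n s sB; rewrite /D.
have [s1|s1] := leP 1 `|s|.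
  apply: (@le_trans _ _ (expR (- G `|s|))); last first.
    by rewrite patchE mem_set// lerDr cutoffE ler0n.
  apply: le_trans (psiE _ _) _; rewrite ler_expR lerN2 ltW//.
  by apply: AG => //; rewrite s1.
apply: le_trans (psi1 _ _) _; rewrite cutoffE (ltW s1) lerDl.
by rewrite patchE; case: ifP => // _; exact: expR_ge0.
Qed.

(** Near u the exponent is at least c(u) ln B_n, so that
    B_n * psi n <= B_n ^ (1 - c(u)), which tends to 0; the compact set of
    frequencies is covered by finitely many such neighbourhoods. *)
Lemma condition_B_tail (U : set R) (delta kappa : R) : condition_B_on a f B U ->
  (forall t : R, delta <= `|t| <= kappa -> U t) -> 0 < delta ->
  forall e : R, 0 < e -> \forall n \near \oo, forall t : R,
    delta <= `|t| <= kappa -> B n * psi n t <= e.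
Proof.
move=> cB KU d0 e e0.
pose K : set R := `[delta, kappa]%classic `|` `[- kappa, - delta]%classic.
have KP t : delta <= `|t| <= kappa -> K t.
  case: (ger0P t) => t0; first by left; rewrite /= in_itv.
  by move=> /andP[? ?]; right; rewrite /= in_itv/=; apply/andP; split; lra.
have PK t : K t -> delta <= `|t| <= kappa.
  move=> [|] /=; rewrite in_itv/= => /andP[t1 t2].
    by rewrite ger0_norm ?t1// (le_trans (ltW d0)).
  by rewrite ler0_norm; [apply/andP; split; lra|lra].
have cK : compact K by apply: compactU; exact: segment_compact.
have /compact_near_coveringP cov := cK.
suff : \forall n \near \oo, K `<=` [set t | B n * psi n t <= e].
  by apply: filterS => n H t /KP; exact: H.
apply: (cov nat \oo (fun n t => B n * psi n t <= e)) => u Ku.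
have [eps [c [n0 [eps0 c1 H]]]] := cB u (KU u (PK u Ku)).
(* the threshold is the value of B_n at which B_n ^ (1 - c) = e *)
have Blarge : \forall n \near \oo, 1 < B n /\ B n * expR (- (c * ln (B n))) <= e.
  have := near_B_gt By (Num.max 1 (expR (- ln e / (c - 1)))).
  apply: filterS => n; rewrite gt_max => /andP[B1 Be]; split=> //.
  have B0 : 0 < B n by exact: lt_trans B1.
  have lnB : - ln e / (c - 1) < ln (B n) by rewrite -[ltLHS]expRK ltr_ln ?posrE ?expR_gt0.
  rewrite -[X in X * _](lnK B0) -expRD -[leRHS](lnK e0) ler_expR.
  by move: lnB; rewrite ltr_pdivrMr ?subr_gt0//; nra.
exists (ball u eps, [set n | (n0 < n)%N /\ 1 < B n /\ B n * expR (- (c * ln (B n))) <= e]).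
  split; first exact: nbhsx_ballx.
  by apply: filterI => //; exists n0.+1.
move=> [t n] /= [ut [n0n [B1 Be]]].
apply: le_trans Be; have B0 : 0 < B n by exact: lt_trans B1.
rewrite ler_pM2l//; apply: le_trans (psiE _ _) _; rewrite ler_expR lerN2.
have tu : `|t - u| <= eps by rewrite distrC ltW.
have lnB0 : 0 < ln (B n) by rewrite ln_gt0.
have := H t n tu n0n; set Sg := \sum_(_ <= _ < _) _ => cS.
rewrite -ler_pdivlMr//; apply: le_trans cS _.
by rewrite le_eqVlt; apply/orP; left; apply/eqP; field; rewrite gt_eqF.
Qed.

End conditions_on_charfuns.

Section supremum.
Context (R : realType).

Lemma cvg_ereal_sup0 (U : set R) (F : nat -> R -> R) : U !=set0 ->
  (forall e : R, 0 < e -> \forall n \near \oo, forall u, U u -> `|F n u| <= e) ->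
  ereal_sup [set (`|F n u|)%:E | u in U] @[n --> \oo] --> 0%E.
Proof.
move=> [u0 Uu0] H.
have bnd e : 0 < e -> \forall n \near \oo,
    (0 <= ereal_sup [set (`|F n u|)%:E | u in U] <= e%:E)%E.
  move=> e0; apply: filterS (H _ e0) => n Hn; apply/andP; split.
    apply: (@le_trans _ _ (`|F n u0|)%:E); first by rewrite lee_fin.
    by apply: ereal_sup_ubound; exists u0.
  by apply: ge_ereal_sup => _ [u Uu <-]; rewrite lee_fin; exact: Hn.
apply/fine_cvgP; split.
  apply: filterS (bnd 1 ltr01) => n /andP[s0 s1].
  by rewrite fin_numElt (lt_le_trans _ s0)//= (le_lt_trans s1)// ltry.
apply/cvgrPdist_le => e e0; apply: filterS (bnd e e0) => n /andP[s0 s1].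
rewrite sub0r normrN /= ger0_norm ?fine_ge0//.
rewrite -lee_fin fineK//.
by rewrite fin_numElt (lt_le_trans _ s0)//= (le_lt_trans s1)// ltry.
Qed.

End supremum.

(** * The density of the limit law *)

Section limit_density.
Context (d : measure_display) (T : measurableType d) (R : realType)
  (P : probability T R) (L : {RV P >-> R}) (h : R -> R).
Local Notation mu := (@lebesgue_measure R).
Hypothesis iL : cintegrable mu [set: R] (charfun P L).
Hypothesis ch : continuous h.
Hypothesis dh : is_density L h.

Lemma integrable_Ecos_L : mu.-integrable setT (EFin \o Ecos P L).
Proof. by case: iL. Qed.

Lemma integrable_Esin_L : mu.-integrable setT (EFin \o Esin P L).
Proof. by case: iL. Qed.

Let cL := Ecos P L.
Let sL := Esin P L.

Let mcos (x : R) : measurable_fun setT (fun s : R => cos (s * x)).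
Proof.
apply: measurableT_comp; last exact: measurable_funM.
exact: continuous_measurable_fun (@continuous_cos R).
Qed.

Let msin (x : R) : measurable_fun setT (fun s : R => sin (s * x)).
Proof.
apply: measurableT_comp; last exact: measurable_funM.
exact: continuous_measurable_fun (@continuous_sin R).
Qed.

Let integrable_wave x : mu.-integrable setT
  (fun s => (cL s * cos (s * x) + sL s * sin (s * x))%:E).
Proof.
have i1 := integrable_mulr integrable_Ecos_L (mcos x) (fun s => cos_max (s * x)).
have i2 := integrable_mulr integrable_Esin_L (msin x) (fun s => sin_max (s * x)).
exact: (integrableD measurableT i1 i2).
Qed.

(** The Fourier transform of the density is the characteristic function of L,
    which is integrable. *)
Lemma density_inversion x :
  2 * pi * h x = \int[mu]_s (cL s * cos (s * x) + sL s * sin (s * x)).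
Proof.
have CE (t : R) : \int[mu]_y (h y * cos (t * (y - x))) = cL t * cos (t * x) + sL t * sin (t * x).
  have mc : measurable_fun setT (fun y : R => cos (t * (y - x))).
    apply: measurableT_comp; first exact: continuous_measurable_fun (@continuous_cos R).
    by apply: measurable_funM => //; exact: measurable_funB.
  have := Rintegral_density dh mc (fun y : R => cos_max (t * (y - x))).
  under [X in _ = X]eq_Rintegral do rewrite mulrC.
  move=> <-; rewrite (Ecos_shift P (measurable_funP L) t (- x)).
  by rewrite mulrN cosN sinN /cL /sL; ring.
have := @fourier_inversion R h ch (integrable_density dh) x.
rewrite (_ : (fun t => _) = (fun s => cL s * cos (s * x) + sL s * sin (s * x))).
  by move=> <- //; exact: integrable_wave.
by apply/funext => t; exact: CE.
Qed.

Let H s := `|cL s| + `|sL s|.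

Let iH : mu.-integrable setT (EFin \o H).
Proof.
exact: (integrableD measurableT (integrable_norm integrable_Ecos_L)
  (integrable_norm integrable_Esin_L)).
Qed.

Lemma density_bounded : exists M : R, 0 <= M /\ forall x, `|h x| <= M.
Proof.
have pi2 : 0 < 2 * pi :> R by rewrite mulr_gt0// pi_gt0.
exists ((\int[mu]_s H s) / (2 * pi)); split.
  by rewrite divr_ge0 ?(ltW pi2)//; apply: Rintegral_ge0 => s _; rewrite addr_ge0.
move=> x; rewrite ler_pdivlMr// mulrC -[X in X * _]gtr0_norm// -normrM density_inversion.
apply: Rintegral_bound => //.
  by apply/measurable_EFinP; exact: measurable_int (integrable_wave x).
move=> s; apply: le_trans (ler_normD _ _) _; rewrite !normrM.
by apply: lerD; rewrite ler_piMr ?cos_max ?sin_max.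
Qed.

(** By inversion and |cos (s x) - cos (s y)| <= 2 |sin (s (x - y) / 2)|, a
    multiple of om (x - y) bounds the increment; om is continuous and vanishes
    at 0. *)
Lemma density_uniformly_continuous (e : R) : 0 < e ->
  exists2 dl : R, 0 < dl & forall x y, `|x - y| <= dl -> `|h x - h y| <= e.
Proof.
move=> e0; have pi2 : 0 < 2 * pi :> R by rewrite mulr_gt0// pi_gt0.
pose om r := \int[mu]_s (H s * `|sin (r * (s / 2))|).
have cs : continuous (fun z : R => `|sin z|).
  move=> z; apply: (@continuous_comp _ _ _ (@sin R) (fun t => `|t|)).
    exact: continuous_sin.
  exact: continuous_abs.
have s1 (z : R) : `| `|sin z| | <= 1 by rewrite normr_id sin_max.
have mhalf : measurable_fun setT (fun s : R => s / 2) by exact: measurable_funM.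
have com : continuous (om : R -> R).
  exact: (continuous_wave_integral iH mhalf cs s1).
have om0 : om 0 = 0.
  rewrite /om; under eq_Rintegral do rewrite mul0r sin0 normr0 mulr0.
  by rewrite Rintegral_cst// mul0r.
have c0 : om r @[r --> (0 : R)] --> (0 : R) by rewrite -[X in _ --> X]om0; exact: com.
have e1 : 0 < e * pi by rewrite mulr_gt0// pi_gt0.
have /cvgrPdist_le/(_ _ e1)[dl /= dl0 Hdl] := c0.
exists (dl / 2); first by rewrite divr_gt0.
move=> x y xy; have {}Hdl : om (x - y) <= e * pi.
  apply: le_trans (ler_norm _) _; rewrite -normrN -sub0r; apply: Hdl.
  by rewrite /= sub0r normrN (le_lt_trans xy)// ltr_pdivrMr// ltr_pMr// ltr1n.
rewrite -(ler_pM2l pi2) -[X in X * `|_|]gtr0_norm// -normrM mulrBr !density_inversion.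
rewrite -RintegralB//; try exact: integrable_wave.
apply: (@le_trans _ _ (2 * om (x - y))); last by rewrite -mulrA [pi * e]mulrC ler_pM2l.
have iom := integrable_mul_wave iH mhalf cs s1 (x - y).
rewrite -RintegralZl//; apply: Rintegral_bound.
- exact: (integrableZl measurableT 2 iom).
- apply: measurable_funB; apply/measurable_EFinP; exact: measurable_int (integrable_wave _).
move=> s.
have -> : s * x = s * (x + y) / 2 + (x - y) * (s / 2) by field.
have -> : s * y = s * (x + y) / 2 - (x - y) * (s / 2) by field.
set p := s * _ / 2; set q := _ * (s / 2).
rewrite cosD cosB sinD sinB /H.
have -> : cL s * (cos p * cos q - sin p * sin q) +
    sL s * (sin p * cos q + cos p * sin q) -
    (cL s * (cos p * cos q + sin p * sin q) +
     sL s * (sin p * cos q - cos p * sin q)) =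
   2 * sin q * (sL s * cos p - cL s * sin p) by ring.
rewrite !normrM [`|2|]ger0_norm// mulrAC -mulrA ler_pM2l//; apply: ler_wpM2r => //.
apply: le_trans (ler_normB _ _) _; rewrite !normrM [leRHS]addrC.
by apply: lerD; rewrite ler_piMr ?cos_max ?sin_max.
Qed.

End limit_density.

(** * Compactly supported functions and scaled Fejer kernels *)

Section compact_support.
Context (R : realType) (phi : R -> R).
Hypothesis cphi : continuous phi.
Hypothesis sphi : compactly_supported phi.
Local Notation mu := (@lebesgue_measure R).

Lemma compactly_supported_bounds : exists rho M : R,
  [/\ 0 < rho, 0 <= M, forall x, rho < `|x| -> phi x = 0 & forall x, `|phi x| <= M].
Proof.
have [r [_ Hr]] := compact_bounded sphi.
pose rho := Num.max 0 r + 1.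
have rho0 : 0 < rho by rewrite /rho ltr_wpDl// le_max lexx.
have supp x : rho < `|x| -> phi x = 0.
  move=> rx; apply/eqP; apply: contraTT rx => px; rewrite -leNgt.
  apply: Hr; last exact: subset_closure.
  by rewrite /rho ltr_pwDr// le_max lexx orbT.
have cK : compact (phi @` `[- rho, rho]).
  apply: continuous_compact; first exact: continuous_subspaceT.
  exact: segment_compact.
have [m [_ Hm]] := compact_bounded cK.
exists rho, (Num.max 0 m + 1); split=> //.
  by rewrite addr_ge0// le_max lexx.
move=> x; have [xr|xr] := leP `|x| rho; last first.
  by rewrite supp// normr0 addr_ge0// le_max lexx.
apply: Hm; first by rewrite ltr_pwDr// le_max lexx orbT.
by exists x => //; rewrite /= in_itv/= -ler_norml.
Qed.

Lemma compactly_supported_integrable : mu.-integrable setT (EFin \o phi).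
Proof.
have [rho [M [_ M0 supp pM]]] := compactly_supported_bounds.
apply: (@integrable_le _ _ _ mu _ (fun x => M * cutoff rho x)).
- exact: continuous_measurable_fun.
- exact: (integrableZl measurableT M (integrable_cutoff rho)).
- move=> x; rewrite cutoffE; have [xr|xr] := leP `|x| rho; first by rewrite mulr1.
  by rewrite supp// normr0 mulr0.
Qed.

(** Compactness gives uniformity for x at distance at most 1 from the support;
    for other x both values vanish, as d <= 1. *)
Lemma compactly_supported_unif_continuous (eta : R) : 0 < eta ->
  exists2 d : R, 0 < d <= 1 & forall x y, `|x - y| < d -> `|phi x - phi y| <= eta.
Proof.
move=> eta0; have [rho [M [rho0 _ supp _]]] := compactly_supported_bounds.
have /compact_near_coveringP cov := @segment_compact R (- (rho + 1)) (rho + 1).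
have : \forall n \near \oo, `[- (rho + 1), rho + 1]%classic `<=`
    [set x | forall y, `|x - y| < n.+1%:R^-1 -> `|phi x - phi y| <= eta].
  apply: (cov nat \oo (fun n x => forall y, `|x - y| < n.+1%:R^-1 -> `|phi x - phi y| <= eta)) => x _.
  have e2 : 0 < eta / 2 by rewrite divr_gt0.
  have cx : phi y @[y --> x] --> phi x by exact: cphi.
  have /cvgrPdist_le/(_ _ e2)[r /= r0 Hr] := cx.
  have r20 : 0 < r / 2 by rewrite divr_gt0.
  exists (ball x (r / 2), [set n | n.+1%:R^-1 < r / 2]).
    split; first exact: nbhsx_ballx.
    exact: (near_infty_natSinv_lt (PosNum r20)).
  move=> [z n] /= [xz nr] y zy.
  have -> : phi z - phi y = (phi x - phi y) - (phi x - phi z) by ring.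
  apply: le_trans (ler_normB _ _) _; rewrite [eta]splitr; apply: lerD; apply: Hr => /=.
    have -> : x - y = (x - z) + (z - y) by ring.
    apply: le_lt_trans (ler_normD _ _) _; rewrite [r]splitr ltrD//.
    exact: lt_trans nr.
  by apply: lt_trans xz _; rewrite ltr_pdivrMr// ltr_pMr// ltr1n.
move=> [n _ /(_ n (leqnn n)) Hn].
exists n.+1%:R^-1; first by rewrite invr_gt0 ltr0n/= invf_le1// ler1n.
move=> x y xy; have [xr|xr] := leP `|x| (rho + 1).
  by apply: Hn => //; rewrite /= in_itv/= -ler_norml.
have n1 : n.+1%:R^-1 <= 1 :> R by rewrite invf_le1// ler1n.
have yr : rho < `|y|.
  have := ler_normD (x - y) y; rewrite subrK => xxy.
  by have := lt_le_trans xy n1; lra.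
by rewrite !supp// ?subrr ?normr0 ?ltW//; lra.
Qed.

End compact_support.

Section scaled_fejer.
Context (R : realType) (lam : R).
Hypothesis lam0 : 0 < lam.
Local Notation mu := (@lebesgue_measure R).

(** Its transform is the Fejer kernel at scale 1 / lam, of total mass 2 pi,
    which concentrates at 0 as lam grows. *)
Definition tri_scaled (t : R) := tri (t / lam).
Let K := cos_transform tri_scaled.

Let li : 0 < lam^-1. Proof. by rewrite invr_gt0. Qed.

Lemma integrable_tri_scaled : mu.-integrable setT (EFin \o tri_scaled).
Proof.
apply: eq_integrable (integrable_affine 0 li (integral_tri R).1) => // t _ /=.
by rewrite addr0 mulrC.
Qed.

Lemma tri_scaled_le1 t : `|tri_scaled t| <= 1.
Proof. by rewrite ger0_norm ?tri_ge0// tri_le1. Qed.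

Lemma tri_scaled_eq0 t : lam < `|t| -> tri_scaled t = 0.
Proof.
by move=> lt; rewrite /tri_scaled tri_eq0// normrM normfV [`|lam|]gtr0_norm// ler_pdivlMr// mul1r ltW.
Qed.

Lemma cvg_tri_scaled : tri_scaled t @[t --> (0 : R)] --> (1 : R).
Proof.
rewrite -(tri0 R) -[in X in _ --> tri X](mul0r lam^-1).
have c0 : t / lam @[t --> (0 : R)] --> 0 / lam by apply: cvgM; [exact: cvg_id|exact: cvg_cst].
exact: (cvg_comp _ _ c0 (@continuous_tri R _)).
Qed.

Lemma scaled_fejerE x : K x = lam * cos_transform (@tri R) (lam * x).
Proof.
have i : mu.-integrable setT (fun t => (tri_scaled t * cos (t * x))%:E).
  apply: (integrable_mulr (M := 1) integrable_tri_scaled); last by move=> ?; exact: cos_max.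
  apply: measurableT_comp; last exact: measurable_funM.
  exact: continuous_measurable_fun (@continuous_cos R).
rewrite /K /cos_transform (Rintegral_affine 0 lam0 i); congr (_ * _).
apply: eq_Rintegral => t _; rewrite /tri_scaled addr0 mulrAC divff ?gt_eqF// mul1r.
by congr (_ * cos _); ring.
Qed.

Lemma continuous_scaled_fejer : continuous K.
Proof.
move=> x; rewrite (_ : K = (fun x => lam * cos_transform (@tri R) (lam * x))); last first.
  by apply/funext => z; exact: scaled_fejerE.
apply: cvgM; first exact: cvg_cst.
have c0 : lam * y @[y --> x] --> lam * x by apply: cvgM; [exact: cvg_cst|exact: cvg_id].
exact: (cvg_comp _ _ c0 (@continuous_fejer R _)).
Qed.

Lemma scaled_fejer_ge0 x : 0 <= K x.
Proof. by rewrite scaled_fejerE mulr_ge0 ?(ltW lam0)// fejer_ge0. Qed.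

Lemma scaled_fejer_le x : K x <= lam.
Proof. by rewrite scaled_fejerE ler_piMr ?(ltW lam0)// fejer_le1. Qed.

Lemma scaled_fejer_tail x : K x * x ^+ 2 <= 4 / lam.
Proof.
rewrite scaled_fejerE ler_pdivlMr//.
have -> : lam * cos_transform (@tri R) (lam * x) * x ^+ 2 * lam =
  cos_transform (@tri R) (lam * x) * (lam * x) ^+ 2 by ring.
exact: fejer_le.
Qed.

Lemma integral_scaled_fejer x : mu.-integrable setT (fun y => (K (x - y))%:E) /\
  \int[mu]_y K (x - y) = 2 * pi.
Proof.
have KE y : K (x - y) = lam * cos_transform (@tri R) (lam * y + - (lam * x)).
  rewrite scaled_fejerE; congr (_ * _); rewrite /cos_transform.
  apply: eq_Rintegral => t _; rewrite -[t * (lam * (x - y))]opprK cosN.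
  by congr (_ * cos _); ring.
have i := integrable_affine (- (lam * x)) lam0 (@integrable_fejer R).
have I := Rintegral_affine (- (lam * x)) lam0 (@integrable_fejer R).
split.
  apply: eq_integrable (integrableZl measurableT lam i) => // y _.
  by rewrite KE EFinM.
rewrite -(@integral_fejer R) I -RintegralZl//.
by apply: eq_Rintegral => y _; rewrite KE.
Qed.

End scaled_fejer.

(** * Band-limited approximation *)

Section band_limited_approximation.
Context (R : realType) (phi : R -> R).
Hypothesis cphi : continuous phi.
Hypothesis sphi : compactly_supported phi.
Local Notation mu := (@lebesgue_measure R).
Local Notation K lam := (cos_transform (tri_scaled lam)).

Let iphi := compactly_supported_integrable cphi sphi.

Lemma integrable_phi_fejer lam x : 0 < lam ->
  mu.-integrable setT (fun y => (phi y * K lam (x - y))%:E).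
Proof.
move=> lam0; apply: (integrable_mulr (M := lam) iphi).
  apply: measurableT_comp; last exact: measurable_funB.
  exact: continuous_measurable_fun (continuous_scaled_fejer lam0).
by move=> y; rewrite ger0_norm ?scaled_fejer_ge0// scaled_fejer_le.
Qed.

(** As the kernel has mass 2 pi, the difference is the integral over y of
    (phi x - phi y) K (x - y).  For |x - y| < d uniform continuity is used,
    together with the boundedness of 1 + x^2 where phi x - phi y can be nonzero.
    For |x - y| >= d the kernel is O(1 / (lam (x - y)^2)), and
    (1 + x^2) / (x - y)^2 is bounded on the support of phi in x or in y; lam is
    chosen last.  The weight 1 + x^2 matters because the error is integrated
    against B_n times the law of S_n, a measure whose total mass is unbounded. *)
Lemma band_limited_approximation (eta : R) : 0 < eta -> exists2 lam : R, 0 < lam &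
  forall x, (1 + x ^+ 2) * `|2 * pi * phi x - \int[mu]_y (phi y * K lam (x - y))| <= eta.
Proof.
move=> eta0; have [rho [M [rho0 M0 supp pM]]] := compactly_supported_bounds cphi sphi.
have pi0 : 0 < pi :> R by exact: pi_gt0.
pose q : R := 1 + (rho + 1) ^+ 2.
have q0 : 0 < q by rewrite ltr_pwDl ?sqr_ge0.
pose eta0' := eta / (4 * pi) / q.
have eta0'0 : 0 < eta0' by rewrite !divr_gt0// mulr_gt0.
have [d /andP[d0 d1] ud] := compactly_supported_unif_continuous cphi sphi eta0'0.
pose C1 := (1 + rho ^+ 2) * M; pose Cd := 1 + d ^- 2.
pose C2 := (1 + 2 * rho ^+ 2) / d ^+ 2 + 2.
pose C := C1 * Cd * pi + C2 * \int[mu]_y `|phi y|.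
have d20 : 0 < d ^+ 2 by rewrite exprn_gt0.
have Cd0 : 0 <= Cd by apply: addr_ge0 => //; rewrite invr_ge0 ltW.
have C10 : 0 <= C1 by rewrite mulr_ge0 ?addr_ge0 ?sqr_ge0.
have C20 : 0 <= C2.
  apply: addr_ge0 => //; apply: divr_ge0; last exact: ltW.
  by apply: addr_ge0 => //; rewrite mulr_ge0 ?sqr_ge0.
have C0 : 0 <= C.
  apply: addr_ge0; first exact: mulr_ge0 (mulr_ge0 C10 Cd0) (ltW pi0).
  by apply: mulr_ge0 => //; apply: Rintegral_ge0.
pose lam := 8 * (C + 1) / eta.
have lam0 : 0 < lam by rewrite divr_gt0// mulr_gt0//; lra.
exists lam => // x; pose Kx y := K lam (x - y).
have [iK IK] := integral_scaled_fejer lam0 x.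
have [iq Iq] := integral_cauchy x (@ltr01 R).
have iab := integrable_norm iphi.
have ipK := integrable_phi_fejer x lam0.
have K0 y : 0 <= Kx y by exact: scaled_fejer_ge0.
(* 4 / lam times this majorant bounds the integrand where |x - y| >= d; the
   first summand comes from phi x and is a Cauchy kernel, the second from phi y *)
pose W y := C1 * Cd / 2 * (2 * 1 / (1 ^+ 2 + (y - x) ^+ 2)) + C2 * `|phi y|.
have i1 := integrableZl measurableT (C1 * Cd / 2) iq.
have i2 := integrableZl measurableT C2 iab.
have iW : mu.-integrable setT (EFin \o W) by exact: (integrableD measurableT i1 i2).
have IW : \int[mu]_y W y = C.
  rewrite RintegralD; [|by []|exact: i1|exact: i2].
  by rewrite RintegralZl// Iq RintegralZl// /C; field.
have W0 y : 0 <= W y.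
  have p1 : 0 <= (1 ^+ 2 + (y - x) ^+ 2)^-1 by rewrite invr_ge0 addr_ge0 ?sqr_ge0.
  apply: addr_ge0; apply: mulr_ge0 => //; last by rewrite mulr1 mulr_ge0.
  by apply: divr_ge0 => //; exact: mulr_ge0.
have x2 : 0 < 1 + x ^+ 2 by rewrite ltr_pwDl ?sqr_ge0.
have mphi : measurable_fun setT phi by exact: continuous_measurable_fun.
have -> : (1 + x ^+ 2) * `|2 * pi * phi x - \int[mu]_y (phi y * K lam (x - y))| =
    `|\int[mu]_y ((1 + x ^+ 2) * ((phi x - phi y) * Kx y))|.
  have i3 := integrableZl measurableT (phi x) iK.
  rewrite RintegralZl//; last first.
    apply: eq_integrable (integrableB measurableT i3 ipK) => // y _.
    by rewrite /= -EFinB; congr EFin; rewrite /Kx; ring.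
  rewrite normrM gtr0_norm//; congr (_ * `|_|).
  rewrite -IK mulrC -RintegralZl// -RintegralB//.
  by apply: eq_Rintegral => y _; rewrite mulrBl.
have bnd : eta / (4 * pi) * (2 * pi) + 4 / lam * C <= eta.
  have -> : eta / (4 * pi) * (2 * pi) = eta / 2.
    by move: pi0; move: (pi : R) => p p0; field; rewrite gt_eqF.
  have -> : 4 / lam * C = eta / 2 * (C / (C + 1)).
    by rewrite /lam; field; rewrite !gt_eqF//; lra.
  rewrite [leRHS]splitr lerD2l ler_piMr//; first by rewrite divr_ge0// ltW.
  by rewrite ler_pdivrMr; lra.
apply: le_trans bnd; rewrite -IK -IW -!RintegralZl// -RintegralD//; last 2 first.
- exact: (integrableZl measurableT (eta / (4 * pi)) iK).
- exact: (integrableZl measurableT (4 / lam) iW).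
apply: Rintegral_bound.
- exact: (integrableD measurableT (integrableZl measurableT (eta / (4 * pi)) iK)
    (integrableZl measurableT (4 / lam) iW)).
- apply: measurable_funM => //; apply: measurable_funM; first exact: measurable_funB.
  by apply/measurable_EFinP; exact: measurable_int iK.
move=> y; rewrite !normrM (gtr0_norm x2) (ger0_norm (K0 y)) mulrA.
have l40 : 0 <= 4 / lam by rewrite divr_ge0// ltW.
have [xy|xy] := ltP `|x - y| d.
  rewrite -[leLHS]addr0; apply: lerD; last by rewrite mulr_ge0.
  apply: ler_wpM2r; first exact: K0.
  have [xr|xr] := leP `|x| (rho + 1).
    have -> : eta / (4 * pi) = q * eta0'.
      by rewrite /eta0' [RHS]mulrC mulfVK// gt_eqF.
    apply: ler_pM => //; [exact: ltW| |exact: ud].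
    rewrite lerD2l -real_normK ?num_real// lerXn2r// ?nnegrE//; lra.
  have yr : rho < `|y|.
    by have := ler_normD (x - y) y; rewrite subrK => xxy; lra.
  rewrite !supp// ?subrr ?normr0 ?mulr0 ?divr_ge0 ?mulr_ge0// ?(ltW eta0) ?(ltW pi0)//; lra.
rewrite -[leLHS]add0r; apply: lerD; first by rewrite mulr_ge0 ?divr_ge0 ?mulr_ge0 ?(ltW eta0) ?(ltW pi0)// K0.
have d2z : d ^+ 2 <= (x - y) ^+ 2.
  by rewrite -[(x - y) ^+ 2]real_normK ?num_real// lerXn2r ?nnegrE// ltW.
have z0 : 0 < (x - y) ^+ 2 by exact: lt_le_trans d2z.
have Kz : Kx y <= 4 / lam * ((x - y) ^+ 2)^-1 by rewrite ler_pdivlMr//; exact: scaled_fejer_tail.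
apply: (@le_trans _ _ ((1 + x ^+ 2) * `|phi x - phi y| * (4 / lam * ((x - y) ^+ 2)^-1))).
  by apply: ler_wpM2l => //; rewrite mulr_ge0// ltW.
rewrite mulrCA; apply: ler_wpM2l => //.
have zi : ((x - y) ^+ 2)^-1 <= Cd * (1 ^+ 2 + (y - x) ^+ 2)^-1.
  rewrite expr1n -(sqrrN (y - x)) opprB ler_pdivlMr; last by rewrite ltr_pwDl// ltW.
  by rewrite mulrDr mulr1 mulVf ?gt_eqF// addrC /Cd lerD2l lef_pV2.
have A1 : (1 + x ^+ 2) * `|phi x| * ((x - y) ^+ 2)^-1 <= C1 * (Cd * (1 ^+ 2 + (y - x) ^+ 2)^-1).
  apply: ler_pM => //; rewrite ?mulr_ge0 ?invr_ge0 ?(ltW x2) ?(ltW z0)//.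
  have [xr|xr] := leP `|x| rho; last by rewrite supp// normr0 mulr0.
  apply: ler_pM => //; first exact: ltW.
  by rewrite lerD2l -real_normK ?num_real// lerXn2r// ?nnegrE// ltW.
have A2 : (1 + x ^+ 2) * `|phi y| * ((x - y) ^+ 2)^-1 <= C2 * `|phi y|.
  have [yr|yr] := leP `|y| rho; last by rewrite supp// normr0 !mulr0 mul0r.
  rewrite mulrAC; apply: ler_wpM2r => //; rewrite ler_pdivrMr// /C2 mulrDl.
  apply: (@le_trans _ _ ((1 + 2 * rho ^+ 2) + 2 * (x - y) ^+ 2)).
    have y2 : y ^+ 2 <= rho ^+ 2.
      by rewrite -real_normK ?num_real// lerXn2r// ?nnegrE// ltW.
    have := sqr_ge0 (x - 2 * y); nra.
  rewrite lerD2r mulrAC ler_pdivlMr//; apply: ler_wpM2l => //.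
  by rewrite addr_ge0// mulr_ge0// sqr_ge0.
apply: (@le_trans _ _ ((1 + x ^+ 2) * (`|phi x| + `|phi y|) * ((x - y) ^+ 2)^-1)).
  apply: ler_wpM2r; first by rewrite invr_ge0 ltW.
  by apply: ler_wpM2l; [exact: ltW|exact: ler_normB].
rewrite mulrDr mulrDl /W; apply: lerD => //.
apply: le_trans A1 _; rewrite le_eqVlt; apply/orP; left; apply/eqP; field.
by rewrite gt_eqF// ltr_pwDl ?exprn_gt0 ?sqr_ge0.
Qed.

End band_limited_approximation.

(** * Test functions on the line *)

Section nonlattice_limit.
Context (d : measure_display) (T : measurableType d) (R : realType)
  (P : probability T R).
Local Notation mu := (@lebesgue_measure R).
Variables (S : nat -> T -> R) (B : nat -> R) (h : R -> R) (M : R).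
Hypothesis mS : forall n, measurable_fun setT (S n).
Hypothesis By : B n @[n --> \oo] --> +oo.
Hypothesis M0 : 0 <= M.
Hypothesis hM : forall x, `|h x| <= M.
Hypothesis uh : forall e : R, 0 < e ->
  exists2 dl : R, 0 < dl & forall x y, `|x - y| <= dl -> `|h x - h y| <= e.
Local Notation K lam := (cos_transform (tri_scaled lam)).
Hypothesis fejer_limit : forall lam : R, 0 < lam -> forall e : R, 0 < e ->
  \forall n \near \oo, forall v : R,
    `|B n * \int[P]_o K lam (S n o + v) - 2 * pi * h (- (v / B n))| <= e.

(** A Fejer kernel has zeros, but the kernel and its translate by pi have none
    in common: 2 (1 - cos x) + 2 (1 - cos (x + pi)) = 4 in [fejer_lower]. *)
Lemma cauchy_le_fejer_pair (x : R) :
  1 <= (1 + pi ^+ 2) / 2 * (K 1 x + K 1 (x + pi)) * (1 + x ^+ 2).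
Proof.
have K1E z : K 1 z = cos_transform (@tri R) z by rewrite scaled_fejerE// !mul1r.
have l1 := fejer_lower x; have l2 := fejer_lower (x + pi).
have k1 := fejer_ge0 x; have k2 := fejer_ge0 (x + pi).
rewrite cosDpi in l2; rewrite !K1E.
move: l1 l2 k1 k2; set F := cos_transform _ x; set F' := cos_transform _ (x + pi).
have := cos_geN1 x; have := cos_le1 x; set c := cos x; move: (pi : R) => p c1 c2 l1 l2 k1 k2.
have p2 := sqr_ge0 p; have x2 := sqr_ge0 x.
have q : 1 + (x + p) ^+ 2 <= 2 * (1 + p ^+ 2) * (1 + x ^+ 2).
  have := sqr_ge0 (x - p); have := mulr_ge0 p2 x2; nra.
have l3 : 2 * (1 + c) <= F' * (2 * (1 + p ^+ 2) * (1 + x ^+ 2)).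
  apply: (@le_trans _ _ (F' * (1 + (x + p) ^+ 2))); first by rewrite -[c]opprK.
  exact: ler_wpM2l.
have l4 : 2 * (1 - c) * 1 <= F * (1 + x ^+ 2) * (2 * (1 + p ^+ 2)).
  apply: ler_pM => //; first by apply: mulr_ge0 => //; lra.
  lra.
lra.
Qed.

Let measurable_K (lam : R) : 0 < lam -> measurable_fun setT (K lam).
Proof. by move=> lam0; exact: continuous_measurable_fun (continuous_scaled_fejer lam0). Qed.

Let integrable_K n (lam v : R) : 0 < lam -> P.-integrable setT (fun o => (K lam (S n o + v))%:E).
Proof.
move=> lam0; apply: (@integrable_bounded _ _ _ P lam).
  apply: measurableT_comp; last exact: measurable_funD.
  exact: continuous_measurable_fun (continuous_scaled_fejer lam0).
by move=> o; rewrite ger0_norm ?scaled_fejer_ge0// scaled_fejer_le.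
Qed.

Lemma measurable_scaled_fejer_expectation n (lam u : R) : 0 < lam ->
  measurable_fun setT (fun y : R => \int[P]_o K lam (S n o + (u - y)) : R).
Proof.
move=> lam0; rewrite /Rintegral; apply: measurableT_comp => //.
apply: (@measurable_fun_fubini_tonelli_F _ _ (measurableTypeR R) T R P
  (fun z => (K lam (S n z.2 + (u - z.1)))%:E)).
  apply/measurable_EFinP; apply: measurableT_comp.
    exact: continuous_measurable_fun (continuous_scaled_fejer lam0).
  apply: measurable_funD; first exact: measurableT_comp (mS n) _.
  exact: measurable_funB.
by move=> z; rewrite lee_fin scaled_fejer_ge0.
Qed.

Variable phi : R -> R.
Hypothesis cphi : continuous phi.
Hypothesis sphi : compactly_supported phi.

Let iphi := compactly_supported_integrable cphi sphi.
Let I := \int[mu]_y `|phi y|.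

Let mphi : measurable_fun setT phi.
Proof. exact: continuous_measurable_fun. Qed.

Let measurable_convolution n (lam u : R) : 0 < lam ->
  measurable_fun [set: T * measurableTypeR R]
    (fun z : T * measurableTypeR R => phi z.2 * K lam (S n z.1 + u - z.2)).
Proof.
move=> lam0; apply: measurable_funM; first exact: measurableT_comp mphi _.
apply: measurableT_comp; first exact: measurable_K.
apply: measurable_funB => //; apply: measurable_funD => //.
exact: measurableT_comp (mS n) _.
Qed.

Let convolution_bound (lam x y : R) : 0 < lam -> `|phi y * K lam (x - y)| <= lam * `|phi y|.
Proof.
move=> lam0; rewrite normrM mulrC; apply: ler_wpM2r => //.
by rewrite ger0_norm ?scaled_fejer_ge0// scaled_fejer_le.
Qed.

(** The error of [band_limited_approximation] is at most e / C times a
    combination of two Fejer kernels, whose expectations multiplied by B_n stay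
    below 2 pi M + 1 by the special local limit. *)
Lemma band_limited_error (e : R) : 0 < e -> exists2 lam : R, 0 < lam &
  \forall n \near \oo, forall u : R,
    `|B n * \int[P]_o (2 * pi * phi (S n o + u) -
        \int[mu]_y (phi y * K lam (S n o + u - y)))| <= e.
Proof.
move=> e0; have pi0 : 0 < pi :> R by exact: pi_gt0.
pose q : R := (1 + pi ^+ 2) / 2; pose C := q * (2 * (2 * pi * M + 1)).
have q0 : 0 < q by rewrite divr_gt0// ltr_pwDl// sqr_ge0.
have C0 : 0 < C.
  apply: mulr_gt0 => //; apply: mulr_gt0 => //; apply: ltr_wpDl => //.
  by rewrite mulr_ge0// mulr_ge0// ltW.
have eC : 0 < e / C by rewrite divr_gt0.
have [lam lam0 Hlam] := band_limited_approximation cphi sphi eC.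
exists lam => //.
have B0 := near_B_gt By 0.
have FL := fejer_limit (@ltr01 R) (@ltr01 R).
near=> n; move=> u.
have Bn : 0 < B n by near: n.
have FL1 v : B n * \int[P]_o K 1 (S n o + v) <= 2 * pi * M + 1.
  have Fv : `|B n * \int[P]_o K 1 (S n o + v) - 2 * pi * h (- (v / B n))| <= 1 by move: v; near: n.
  have hv := hM (- (v / B n)).
  have : 2 * pi * h (- (v / B n)) <= 2 * pi * M.
    apply: ler_wpM2l; first by rewrite mulr_ge0// ltW.
    exact: le_trans (ler_norm _) hv.
  by move: Fv; rewrite ler_distl => /andP[_]; lra.
pose J x := \int[mu]_y (phi y * K lam (x - y)).
have pw x : `|2 * pi * phi x - J x| <= e / C * q * (K 1 x + K 1 (x + pi)).
  have x2 : 0 < 1 + x ^+ 2 by rewrite ltr_pwDl ?sqr_ge0.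
  rewrite -(ler_pM2l x2); apply: le_trans (Hlam x) _.
  have := cauchy_le_fejer_pair x; rewrite -/q => H1.
  rewrite -[leLHS]mulr1.
  apply: (@le_trans _ _ (e / C * (q * (K 1 x + K 1 (x + pi)) * (1 + x ^+ 2)))).
    by rewrite ler_pM2l.
  by rewrite le_eqVlt; apply/orP; left; apply/eqP; ring.
have i1 := integrable_K n u (@ltr01 R).
have i2 := integrable_K n (u + pi) (@ltr01 R).
have i12 := integrableD measurableT i1 i2.
rewrite normrM gtr0_norm//.
have mJ : measurable_fun setT (fun o => J (S n o + u)).
  apply: (@measurable_Rintegral_Fubini _ _ T (measurableTypeR R) R P mu
    (fun o y => phi y * K lam (S n o + u - y)) (fun=> lam) (fun y => `|phi y|)).
  - exact: measurable_convolution.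
  - exact: finite_measure_integrable_cst.
  - exact: integrable_norm.
  - by move=> o y; exact: convolution_bound.
have bnd : `|\int[P]_o (2 * pi * phi (S n o + u) - J (S n o + u))| <=
    \int[P]_o (e / C * q * (K 1 (S n o + u) + K 1 (S n o + (u + pi)))).
  apply: Rintegral_bound.
  - exact: (integrableZl measurableT (e / C * q) i12).
  - apply: measurable_funB => //; apply: measurable_funM => //.
    by apply: measurableT_comp => //; exact: measurable_funD.
  - by move=> o; rewrite addrA; exact: pw.
apply: (@le_trans _ _ (B n * (e / C * q * (\int[P]_o K 1 (S n o + u) + \int[P]_o K 1 (S n o + (u + pi)))))).
  rewrite ler_pM2l//; apply: le_trans bnd _.
  rewrite RintegralZl//.
  by rewrite RintegralD.
have eE : e / C * q * (2 * (2 * pi * M + 1)) = e by rewrite -mulrA -/C divfK// gt_eqF.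
rewrite -[leRHS]eE mulrCA ler_pM2l; last by rewrite mulr_gt0.
rewrite mulrDr [leRHS]mulr_natl mulr2n.
by apply: lerD; exact: FL1.
Unshelve. all: by end_near. Qed.

(** For the approximating function Fubini gives an average over y, with weight
    phi y, of B_n E K (S_n + u - y); this is close to
    2 pi h (- (u - y) / B_n), hence to 2 pi h (- u / B_n) since y is bounded and
    B_n tends to infinity. *)
Lemma nonlattice_limit (e : R) : 0 < e -> \forall n \near \oo, forall u : R,
  `|B n * \int[P]_o phi (S n o + u) - h (- (u / B n)) * \int[mu]_y phi y| <= e.
Proof.
move=> e0; have pi0 : 0 < pi :> R by exact: pi_gt0.
have I0 : 0 <= I by apply: Rintegral_ge0.
have I1 : 0 < I + 1 by rewrite ltr_wpDl.
have [rho [N [rho0 N0 supp pN]]] := compactly_supported_bounds cphi sphi.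
have [lam lam0 Ha] := band_limited_error e0.
have e1 : 0 < e / (I + 1) by rewrite divr_gt0.
have e2 : 0 < e / (4 * (I + 1)) by rewrite divr_gt0// mulr_gt0.
have Hb := fejer_limit lam0 e1.
have [dl dl0 Hdl] := uh e2.
have B0 := near_B_gt By 0.
have Brho := near_B_gt By (rho / dl).
near=> n; move=> u.
have Bn : 0 < B n by near: n.
have rB : rho / B n <= dl.
  by rewrite ler_pdivrMr// mulrC -ler_pdivrMr// ltW//; near: n.
have Ha1 : `|B n * \int[P]_o (2 * pi * phi (S n o + u) -
        \int[mu]_y (phi y * K lam (S n o + u - y)))| <= e by move: u; near: n.
have Hb1 v : `|B n * \int[P]_o K lam (S n o + v) - 2 * pi * h (- (v / B n))| <= e / (I + 1).
  by move: v; near: n.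
have F : \int[P]_o \int[mu]_y (phi y * K lam (S n o + u - y)) =
    \int[mu]_y (phi y * \int[P]_o K lam (S n o + (u - y))).
  rewrite (@Rintegral_Fubini _ _ T (measurableTypeR R) R P mu
    (fun o y => phi y * K lam (S n o + u - y)) (fun=> lam) (fun y => `|phi y|)).
  - apply: eq_Rintegral => y _; rewrite -RintegralZl//; last exact: integrable_K.
    by apply: eq_Rintegral => o _; rewrite addrA.
  - exact: measurable_convolution.
  - exact: finite_measure_integrable_cst.
  - exact: integrable_norm.
  - by move=> o y; exact: convolution_bound.
have mSu : measurable_fun setT (fun o => phi (S n o + u)).
  by apply: measurableT_comp => //; exact: measurable_funD.
have iSu : P.-integrable setT (fun o => (phi (S n o + u))%:E).
  by apply: (@integrable_bounded _ _ _ P N) => // o; exact: pN.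
have iJ : P.-integrable setT
    (fun o => (\int[mu]_y (phi y * K lam (S n o + u - y)))%:E).
  apply: (@integrable_bounded _ _ _ P (lam * I)).
    apply: (@measurable_Rintegral_Fubini _ _ T (measurableTypeR R) R P mu
      (fun o y => phi y * K lam (S n o + u - y)) (fun=> lam) (fun y => `|phi y|)).
    - exact: measurable_convolution.
    - exact: finite_measure_integrable_cst.
    - exact: integrable_norm.
    - by move=> o y; exact: convolution_bound.
  move=> o; rewrite /I -RintegralZl//; last exact: integrable_norm.
  apply: Rintegral_bound; last by move=> y; exact: convolution_bound.
    exact: (integrableZl measurableT lam (integrable_norm iphi)).
  exact: measurableT_comp (measurable_convolution n u lam0) (measurable_pair1 o).
move: Ha1; rewrite RintegralB//; last exact: (integrableZl measurableT (2 * pi) iSu).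
rewrite F RintegralZl// => Ha2.
set H := h (- (u / B n)).
have Hc : `|B n * \int[mu]_y (phi y * \int[P]_o K lam (S n o + (u - y))) -
    2 * pi * H * \int[mu]_y phi y| <=
    (e / (I + 1) + 2 * pi * (e / (4 * (I + 1)))) * I.
  have mE := measurable_scaled_fejer_expectation n u lam0.
  have iE : mu.-integrable setT
      (fun y => (phi y * \int[P]_o K lam (S n o + (u - y)))%:E).
    apply: (integrable_mulr (M := lam) iphi mE) => y.
    apply: Rintegral_prob_bound; first by apply: measurableT_comp; [exact: measurable_K|exact: measurable_funD].
    by move=> o; rewrite ger0_norm ?scaled_fejer_ge0// scaled_fejer_le.
  have i1 := integrableZl measurableT (B n) iE.
  have i2 := integrableZl measurableT (2 * pi * H) iphi.
  rewrite -RintegralZl// -[X in _ - X]RintegralZl// -RintegralB//.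
  rewrite -[X in _ <= X]RintegralZl//; last exact: integrable_norm.
  apply: Rintegral_bound.
  - exact: (integrableZl measurableT _ (integrable_norm iphi)).
  - by apply/measurable_EFinP; exact: measurable_int (integrableB measurableT i1 i2).
  move=> y; set E := Rintegral _ _ _.
  have -> : B n * (phi y * E) - 2 * pi * H * phi y =
    phi y * ((B n * E - 2 * pi * h (- ((u - y) / B n))) +
             2 * pi * (h (- ((u - y) / B n)) - H)) by ring.
  rewrite normrM mulrC.
  have [yr|yr] := leP `|y| rho; last by rewrite supp// normr0 !mulr0.
  apply: ler_wpM2r => //; apply: le_trans (ler_normD _ _) _.
  apply: lerD; first exact: Hb1.
  rewrite normrM ger0_norm; last by rewrite mulr_ge0// ltW.
  apply: ler_wpM2l; first by rewrite mulr_ge0// ltW.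
  apply: Hdl; apply: le_trans rB.
  have -> : - ((u - y) / B n) - - (u / B n) = y / B n by ring.
  by rewrite normrM normfV [`|B n|]gtr0_norm// ler_pM2r// invr_gt0.
set A := \int[P]_o phi (S n o + u); set J := \int[mu]_y phi y.
have p2 : 0 < 2 * pi :> R by rewrite mulr_gt0.
rewrite -(ler_pM2l p2) -[X in X * `|_|]gtr0_norm// -normrM.
move: Ha2 Hc; rewrite -/A -/J; set X := \int[mu]_y (_ * _) => Ha3 Hc.
have -> : 2 * pi * (B n * A - H * J) =
  B n * (2 * pi * A - X) + (B n * X - 2 * pi * H * J) by ring.
apply: le_trans (ler_normD _ _) _; apply: le_trans (lerD Ha3 Hc) _.
have k : I / (I + 1) <= 1 by rewrite ler_pdivrMr// mul1r lerDl.
have -> : (e / (I + 1) + 2 * pi * (e / (4 * (I + 1)))) * I =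
    e * (I / (I + 1)) + pi / 2 * (e * (I / (I + 1))).
  move: I1; move: (pi : R) (I) => p i i1.
  by field; rewrite gt_eqF.
have ek : e * (I / (I + 1)) <= e by rewrite ler_piMr// ltW.
have pk : pi / 2 * (e * (I / (I + 1))) <= pi / 2 * e.
  by apply: ler_wpM2l => //; rewrite divr_ge0// ltW.
have p3 : 2 * e <= pi * e by rewrite ler_pM2r// pi_ge2.
lra.
Unshelve. all: by end_near. Qed.

End nonlattice_limit.

(** * Test functions on a lattice *)

Section finite_atoms.
Context (d : measure_display) (T : measurableType d) (R : realType)
  (m : {measure set T -> \bar R}).
Variables (phi : R -> R) (F : T -> R) (pts : seq R).
Hypothesis mphi : measurable_fun setT phi.
Hypothesis mF : measurable_fun setT F.
Hypothesis upts : uniq pts.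
Hypothesis fin : forall x, x \in pts -> m (F @^-1` [set x]) \is a fin_num.
Hypothesis conc : {ae m, forall o, phi (F o) != 0 -> F o \in pts}.

(** Stated for a function F on a measure space so as to cover both the law of
    S_n + u and the measure carried by the lattice. *)
Lemma Rintegral_atoms : \int[m]_o phi (F o) =
  \sum_(x <- pts) phi x * fine (m (F @^-1` [set x])).
Proof.
have mA (x : R) : measurable (F @^-1` [set x]).
  by rewrite -[X in measurable X]setTI; exact: mF.
pose s (r : seq R) (o : T) : R := \sum_(x <- r) phi x * \1_(F @^-1` [set x]) o.
have ms r : measurable_fun setT (s r).
  by apply: measurable_sum => x; exact: measurable_funM.
transitivity (\int[m]_o s pts o).
  rewrite /Rintegral; congr fine; apply: ae_eq_integral => //.
  - exact/measurable_EFinP/measurableT_comp.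
  - exact/measurable_EFinP.
  apply: filterS conc => o Fo _ /=; congr EFin; rewrite /s.
  have E x : phi x * \1_(F @^-1` [set x]) o = if x == F o then phi (F o) else 0.
    rewrite indicE; case: eqVneq => [->|xF]; first by rewrite mem_set ?mulr1.
    by rewrite memNset ?mulr0// => /= Fx; rewrite Fx eqxx in xF.
  under eq_bigr do rewrite E.
  rewrite -big_mkcond/=; have [phi0|phi0] := eqVneq (phi (F o)) 0.
    by rewrite phi0 big1.
  by rewrite -big_filter filter_pred1_uniq ?big_seq1// Fo.
have fin' : all (fun x => m (F @^-1` [set x]) \is a fin_num) pts by exact/allP.
have ix (y : R) : m (F @^-1` [set y]) \is a fin_num ->
    m.-integrable setT (fun o => (\1_(F @^-1` [set y]) o)%:E).
  move=> fy; apply/integrableP; split; first exact/measurable_EFinP.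
  under eq_integral do rewrite gee0_abs//.
  by rewrite integral_indic// setIT ltey_eq fy.
suff [] : m.-integrable setT (EFin \o s pts) /\ \int[m]_o s pts o =
  \sum_(x <- pts) phi x * fine (m (F @^-1` [set x])) by [].
rewrite /s; elim: pts fin' => [_|x r IH /= /andP[fx /IH[ir Ir]]].
  split; last by under eq_Rintegral do rewrite big_nil; rewrite big_nil Rintegral_cst// mul0r.
  apply: eq_integrable (integrable0 m setT) => // o _.
  by rewrite /= big_nil.
have i1 := ix x fx; have i2 := integrableZl measurableT (phi x) i1.
split.
  apply: eq_integrable (integrableD measurableT i2 ir) => // o _.
  by rewrite /= big_cons.
under eq_Rintegral do rewrite big_cons; rewrite big_cons -Ir RintegralD//.
congr (_ + _); rewrite RintegralZl//; congr (_ * _).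
by rewrite /Rintegral integral_indic// setIT.
Qed.

End finite_atoms.

Section lattice_points.
Context (R : realType).
Local Notation mu := (@lebesgue_measure R).

Lemma lattice_opp_add (h x y : R) : lattice h x -> lattice h y -> lattice h (x - y).
Proof. by move=> [i _ <-] [j _ <-]; exists (i - j)%R => //; rewrite rmorphB mulrBl. Qed.

Lemma cos_transform_cutoff (c x : R) : 0 < c -> x != 0 ->
  cos_transform (cutoff c) x = 2 * sin (c * x) / x.
Proof.
move=> c0 x0; have cc : - c < c by rewrite gtrN.
have dF (t : R) : is_derive t 1 (fun t => sin (t * x) / x : R) (cos (t * x)).
  by apply: is_derive_eq; rewrite /GRing.scale/=; field.
have cf : continuous (fun t : R => cos (t * x)).
  move=> t; apply: continuous_comp; last exact: continuous_cos.
  by apply: cvgM; [exact: cvg_id|exact: cvg_cst].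
have := FTC_is_derive cc cf dF; rewrite integral_mkcond => E.
rewrite /cos_transform /Rintegral.
rewrite (_ : (\int[mu]_x0 _)%E = (sin (c * x) / x - sin (- c * x) / x)%:E).
  by rewrite /= mulNr sinN; field.
rewrite -E; apply: eq_integral => t _; rewrite patchE /cutoff indicE.
by case: ifPn => tI; rewrite ?mul1r ?mul0r.
Qed.

Lemma cos_transform_cutoff0 (c : R) : 0 < c -> cos_transform (cutoff c) 0 = 2 * c.
Proof.
move=> c0; rewrite /cos_transform; under eq_Rintegral do rewrite mulr0 cos0 mulr1.
rewrite /Rintegral /cutoff integral_indic// setIT.
transitivity (fine (mu `[- c, c]%classic)) => //.
by rewrite lebesgue_measure_itv/= lte_fin gtrN//= mulr2n mulrDl mul1r opprK.
Qed.

(** At x <> 0 the transform is 2 sin (pi x / h) / x, and x / h is an integer. *)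
Lemma cos_transform_cutoff_lattice (h x : R) : 0 < h -> lattice h x ->
  cos_transform (cutoff (pi / h)) x = (2 * pi / h) * (x == 0)%:R.
Proof.
move=> h0 [j _ <-]; have c0 : 0 < pi / h by rewrite divr_gt0// pi_gt0.
have [->|j0] := eqVneq (j%:~R * h) 0; first by rewrite cos_transform_cutoff0// mulr1 mulrA.
rewrite cos_transform_cutoff// mulr0.
have -> : pi / h * (j%:~R * h) = pi * j%:~R by rewrite mulrCA divfK ?gt_eqF// mulrC.
suff -> : sin (pi * j%:~R : R) = 0 by rewrite mulr0 mul0r.
have sn (n : nat) : sin (pi * n%:R : R) = 0.
  elim: n => [|n IH]; first by rewrite mulr0 sin0.
  by rewrite -natr1 mulrDr mulr1 sinDpi IH oppr0.
case: j {j0} => n; first exact: sn.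
by rewrite NegzE mulrNz mulrN sinN sn oppr0.
Qed.

Lemma lattice_points (h rho : R) : 0 < h -> exists pts : seq R,
  [/\ uniq pts, forall x, x \in pts -> lattice h x &
      forall x, lattice h x -> `|x| <= rho -> x \in pts].
Proof.
move=> h0; have [N rN] : exists N : nat, rho < N%:R * h.
  exists (Num.truncn (`|rho| / h)).+1.
  rewrite -ltr_pdivrMr//; apply: le_lt_trans (truncnS_gt _).
  by rewrite ler_pM2r ?invr_gt0// ler_norm.
exists (undup [seq (k%:Z - N%:Z)%:~R * h | k <- iota 0 (2 * N).+1]).
split; first exact: undup_uniq.
  by move=> x; rewrite mem_undup => /mapP[k _ ->]; exists (k%:Z - N%:Z)%R.
move=> _ [j _ <-] jr; rewrite mem_undup; apply/mapP.
have jN : `|j| < N%:Z.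
  have : `|j%:~R * h| < N%:R * h by exact: le_lt_trans rN.
  by rewrite normrM [`|h|]gtr0_norm// ltr_pM2r// -intr_norm -[N%:R]/(N%:Z%:~R) ltr_int.
exists (absz (j + N%:Z)); last by congr (_%:~R * h); lia.
by rewrite mem_iota; lia.
Qed.

Lemma lattice_measure_atom (h : {posnum R}) (x : R) : lattice h%:num x ->
  lattice_measure h [set x] = h%:num%:E.
Proof.
move=> hx; rewrite /lattice_measure /= /mscale/= /mrestr.
have -> : [set x] `&` lattice h%:num = [set x] by apply/setIidPl => _ ->.
rewrite /counting; case: asboolP => [_|[]]; last exact: finite_set1.
by rewrite fset_set1 finmap.cardfs1 mule1.
Qed.

Lemma lattice_measure_ae (h : {posnum R}) :
  {ae lattice_measure h, forall x, lattice h%:num x}.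
Proof.
exists (~` lattice h%:num); split=> //.
  by apply: measurableC; exact: measurable_lattice.
by rewrite /lattice_measure/= /mscale/= /mrestr setICl measure0 mule0.
Qed.

End lattice_points.
Section lattice_limit.
Context (d : measure_display) (T : measurableType d) (R : realType)
  (P : probability T R).
Variables (S : nat -> T -> R) (B : nat -> R) (hL : R -> R) (h : {posnum R}).
Hypothesis mS : forall n, measurable_fun setT (S n).
Hypothesis By : B n @[n --> \oo] --> +oo.
Hypothesis uh : forall e : R, 0 < e ->
  exists2 dl : R, 0 < dl & forall x y, `|x - y| <= dl -> `|hL x - hL y| <= e.
Hypothesis latticeS : forall n, {ae P, forall o, lattice h%:num (S n o)}.
Local Notation w := (cutoff (pi / h%:num)).
Hypothesis cutoff_limit : forall e : R, 0 < e -> \forall n \near \oo, forall v : R,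
  `|B n * \int[P]_o cos_transform w (S n o + v) - 2 * pi * hL (- (v / B n))| <= e.

Let h0 : 0 < h%:num. Proof. by []. Qed.

Let measurable_cos_transform : measurable_fun setT (cos_transform w).
Proof.
apply: continuous_measurable_fun.
have -> : cos_transform w = fun x : R => \int[lebesgue_measure]_t (w t * cos (x * t)).
  by apply/funext => x; apply: eq_Rintegral => t _; rewrite [x * t]mulrC.
apply: continuous_wave_integral => //; [exact: integrable_cutoff|exact: continuous_cos|exact: cos_max].
Qed.

(** Inversion formula for a law on the lattice. *)
Lemma lattice_point_mass n (u x : R) : lattice h%:num u -> lattice h%:num x ->
  2 * pi / h%:num * fine (P ((fun o => S n o + u) @^-1` [set x])) =
  \int[P]_o cos_transform w (S n o + (u - x)).
Proof.
move=> hu hx; set A := _ @^-1` _.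
have mA : measurable A.
  rewrite /A -[X in measurable X]setTI.
  by have mSu : measurable_fun setT (fun o => S n o + u) by [exact: measurable_funD]; exact: mSu.
transitivity (\int[P]_o (2 * pi / h%:num * \1_A o)).
  rewrite RintegralZl//; last exact: integrable_indic.
  by rewrite /Rintegral integral_indic// setIT.
rewrite /Rintegral; congr fine; apply: ae_eq_integral => //.
- by apply/measurable_EFinP; exact: measurable_funM.
- by apply/measurable_EFinP; apply: measurableT_comp => //; exact: measurable_funD.
apply: filterS (latticeS n) => o So _; congr EFin.
rewrite cos_transform_cutoff_lattice//; last first.
  by rewrite -[u - x]opprK opprB; apply: lattice_opp_add => //; exact: lattice_opp_add.
congr (_ * _); rewrite indicE addrA subr_eq0; congr ((nat_of_bool _)%:R).
by apply/idP/idP => [/set_mem/= ->|/eqP E]; [|exact/mem_set].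
Qed.

Variable phi : R -> R.
Hypothesis cphi : continuous phi.
Hypothesis sphi : compactly_supported phi.

(** Both integrals are finite sums over the same lattice points, so it suffices
    to compare B_n P (S_n + u = x) with h hL (- u / B_n) for each of them. *)
Lemma lattice_limit (e : R) : 0 < e -> \forall n \near \oo, forall u : R, lattice h%:num u ->
  `|B n * \int[P]_o phi (S n o + u) -
    hL (- (u / B n)) * \int[lattice_measure h]_v phi v| <= e.
Proof.
move=> e0; have pi0 : 0 < pi :> R by exact: pi_gt0.
have [rho [N [rho0 N0 supp pN]]] := compactly_supported_bounds cphi sphi.
have [pts [upts lpts ptsl]] := lattice_points rho h0.
have mphi : measurable_fun setT phi by exact: continuous_measurable_fun.
have inpts x : lattice h%:num x -> phi x != 0 -> x \in pts.
  move=> lx px; apply: ptsl => //; rewrite leNgt; apply: contra px => rx.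
  by rewrite supp.
have IL : \int[lattice_measure h]_v phi v = \sum_(x <- pts) phi x * h%:num.
  rewrite (@Rintegral_atoms _ _ R (lattice_measure h) phi id pts)//.
  - rewrite !big_seq; apply: eq_bigr => x /lpts lx.
    by rewrite preimage_id lattice_measure_atom.
  - by move=> x /lpts lx; rewrite preimage_id lattice_measure_atom.
  - by apply: filterS (lattice_measure_ae h) => x lx; exact: inpts.
pose A := \sum_(x <- pts) `|phi x|.
have A0 : 0 <= A by apply: sumr_ge0.
have A1 : 0 < A + 1 by rewrite ltr_wpDl.
pose e' := e / (2 * h%:num * (A + 1)).
have e'0 : 0 < e' by rewrite divr_gt0// !mulr_gt0.
have e1 : 0 < 2 * pi * e' by apply: mulr_gt0 => //; exact: mulr_gt0.
have Hb := cutoff_limit e1; have [dl dl0 Hdl] := uh e'0.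
have B0 := near_B_gt By 0; have Brho := near_B_gt By (rho / dl).
near=> n; move=> u lu.
have Bn : 0 < B n by near: n.
have rB : rho / B n <= dl.
  by rewrite ler_pdivrMr// mulrC -ler_pdivrMr// ltW//; near: n.
have Hb1 v : `|B n * \int[P]_o cos_transform w (S n o + v) -
    2 * pi * hL (- (v / B n))| <= 2 * pi * e' by move: v; near: n.
set H := hL (- (u / B n)).
pose m x := fine (P ((fun o => S n o + u) @^-1` [set x])).
have IS : \int[P]_o phi (S n o + u) = \sum_(x <- pts) phi x * m x.
  apply: (@Rintegral_atoms _ _ R P phi (fun o => S n o + u) pts) => //.
  - exact: measurable_funD.
  - move=> x _; apply: fin_num_measure.
    by rewrite -[X in measurable X]setTI; apply: measurable_funD.
  - apply: filterS (latticeS n) => o So; apply: inpts.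
    rewrite -[u]opprK; apply: lattice_opp_add => //; rewrite -sub0r.
    by apply: lattice_opp_add => //; exists 0 => //; rewrite mul0r.
have pw x : x \in pts -> `|phi x * (B n * m x - H * h%:num)| <= `|phi x| * (2 * h%:num * e').
  move=> xp; rewrite normrM.
  have [xr|xr] := leP `|x| rho; last by rewrite supp// normr0 !mul0r.
  apply: ler_wpM2l => //.
  have -> : B n * m x - H * h%:num = h%:num / (2 * pi) *
     (B n * \int[P]_o cos_transform w (S n o + (u - x)) - 2 * pi * hL (- ((u - x) / B n))) +
     h%:num * (hL (- ((u - x) / B n)) - H).
    rewrite -lattice_point_mass//; last exact: lpts.
    rewrite -/(m x); move: pi0 h0; move: (pi : R) (h%:num) => p k p0 k0.
    by field; rewrite !gt_eqF.
  apply: le_trans (ler_normD _ _) _; rewrite [leRHS](_ : _ =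
    h%:num / (2 * pi) * (2 * pi * e') + h%:num * e'); last first.
    by move: pi0; move: (pi : R) => p p0; field; rewrite gt_eqF.
  rewrite !normrM [`|h%:num|]gtr0_norm// [`|(2 * pi)^-1|]gtr0_norm; last by rewrite invr_gt0 mulr_gt0.
  apply: lerD; apply: ler_wpM2l => //.
    by rewrite divr_ge0// mulr_ge0// ltW.
  apply: Hdl; apply: le_trans rB.
  have -> : - ((u - x) / B n) - - (u / B n) = x / B n by ring.
  by rewrite normrM normfV [`|B n|]gtr0_norm// ler_pM2r// invr_gt0.
rewrite IS IL !mulr_sumr -sumrB.
apply: le_trans (ler_norm_sum _ _ _) _.
apply: (@le_trans _ _ (\sum_(x <- pts) `|phi x| * (2 * h%:num * e'))).
  rewrite big_seq [leRHS]big_seq; apply: ler_sum => x /pw.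
  by congr (`|_| <= _); ring.
rewrite -mulr_suml -/A /e'.
have -> : A * (2 * h%:num * (e / (2 * h%:num * (A + 1)))) = e * (A / (A + 1)).
  by move: h0; move: (h%:num) => k k0; field; rewrite !gt_eqF.
by rewrite ler_piMr ?(ltW e0)// ler_pdivrMr// mul1r lerDl.
Unshelve. all: by end_near. Qed.

End lattice_limit.

(** * The local limit theorems *)

Section charfun_facts.
Context (R : realType).

(** Waves are bounded continuous test functions. *)
Lemma cvg_Ecos_Esin (d d' : measure_display) (T : measurableType d) (T' : measurableType d')
    (P : probability T R) (P' : probability T' R) (S : nat -> T -> R) (B : nat -> R)
    (L : T' -> R) :
  cvg_in_distribution P (fun n w => S n w / B n) P' L -> forall s : R,
  Ecos P (S n) (s / B n) @[n --> \oo] --> Ecos P' L s /\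
  Esin P (S n) (s / B n) @[n --> \oo] --> Esin P' L s.
Proof.
move=> SL s.
have E (c : R -> R) : continuous c -> (forall x, `|c x| <= 1) ->
    \int[P]_o c (s / B n * S n o) @[n --> \oo] --> \int[P']_o c (s * L o).
  move=> cc c1; have := SL (fun x => c (s * x)).
  rewrite (_ : (fun n => \int[P]_o c (s / B n * S n o)) =
    fun n => \int[P]_o c (s * (S n o / B n))); last first.
    by apply/funext => n; apply: eq_Rintegral => o _; congr c; ring.
  apply.
    move=> x; apply: continuous_comp; last exact: cc.
    by apply: cvgM; [exact: cvg_cst|exact: cvg_id].
  exists 1; split=> // M M1 x _.
  by apply: le_trans (c1 _) _; exact: ltW.
by split; apply: E; [exact: continuous_cos|exact: cos_max|exact: continuous_sin|exact: sin_max].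
Qed.

Lemma normc_charfun_le1 (d : measure_display) (T : measurableType d)
    (P : probability T R) (S : T -> R) (t : R) : measurable_fun setT S ->
  Normc.normc (charfun P S t) <= 1.
Proof.
move=> mS; apply: normc_cRintegral; last by move=> o; rewrite normc_cexpi.
by apply: cmeasurable_cexpi; exact: measurable_funM.
Qed.

End charfun_facts.

Theorem theorem1
    (R : realType)
    (dO dX dL : measure_display)
    (Omega : measurableType dO) (X : measurableType dX)
    (OmegaL : measurableType dL)
    (P : probability Omega R) (PL : probability OmegaL R)
    (xi : nat -> {RV P >-> X}) (Q : nat -> R.-pker X ~> X)
    (a : R) (g : nat -> {mfun X >-> R})
    (B : nat -> R) (L : {RV PL >-> R}) (hL : R -> R)
    (Y : nat -> Omega -> R) (S : nat -> Omega -> R) (f : nat -> R -> R[i]) :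
  (forall (j : nat) (w : Omega), Y j w = g j (xi j w)) ->
  (forall n : nat, S n = partial_sum Y n) ->
  (forall k : nat, f k = charfun P (Y k)) ->
  markov_chain xi Q ->
  0 < a ->
  lower_bound_condition xi Q a ->
  (forall n : nat, (1 <= n)%N -> 0 < B n) ->
  B n @[n --> \oo] --> +oo ->
  cintegrable lebesgue_measure [set: R] (charfun PL L) ->
  continuous hL ->
  is_density L hL ->
  cvg_in_distribution P (fun n w => S n w / B n) PL L ->
  condition_A a f B ->
  ((~ exists h : R, 0 < h /\
        forall j : nat, {ae P, forall w, lattice h (Y j w)}) ->
   condition_B_on a f B [set u : R | u != 0] ->
   forall phi : R -> R, continuous phi -> compactly_supported phi ->
     ereal_sup [set (`| B n * (\int[P]_w phi (S n w + u)) -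
                        hL (- (u / B n)) *
                        \int[lebesgue_measure]_t phi t |)%:E | u in [set: R]]
       @[n --> \oo] --> 0%E)
  /\
  (forall h : {posnum R},
     (forall j : nat, {ae P, forall w, lattice h%:num (Y j w)}) ->
     condition_B_on a f B [set u : R | 0 < `|u| <= pi / h%:num] ->
     forall phi : R -> R, continuous phi -> compactly_supported phi ->
       ereal_sup [set (`| B n * (\int[P]_w phi (S n w + u)) -
                          hL (- (u / B n)) *
                          \int[lattice_measure h]_v phi v |)%:E
                 | u in lattice h%:num]
         @[n --> \oo] --> 0%E).
Proof.
move=> Yg SE fE mc a0 lb Bpos By icL chL dhL SL cA.
have mY k : measurable_fun setT (Y k).
  rewrite (_ : Y k = g k \o xi k); last by apply/funext => w; exact: Yg.
  by apply: measurableT_comp; exact: measurable_funP.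
have mS n : measurable_fun setT (S n) by rewrite SE; exact: measurable_sum.
have a1 := lower_bound_constant_le1 lb.
pose psi n t := Normc.normc (charfun P (S n) t).
have psi1 n t : psi n t <= 1 by exact: normc_charfun_le1.
have psiE n t : psi n t <= expR (- (a ^+ 4 / 2 ^+ 4 *
    \sum_(1 <= k < n.+1) (1 - Normc.normc (f k t) ^+ 2))).
  rewrite /psi SE; apply: le_trans (normc_charfun_partial_sum Yg mc a0 lb t n) _.
  rewrite ler_expR lerN2; under eq_bigr do rewrite fE.
  apply: ler_wpM2r.
    apply: sumr_ge0 => k _; rewrite subr_ge0 expr_le1 ?normc_ge0//.
    exact: normc_charfun_le1.
  have a2 : 0 <= a ^+ 2 <= 1 by rewrite sqr_ge0 expr_le1// ltW.
  have -> : a ^+ 4 = a ^+ 2 * a ^+ 2 by ring.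
  move: a2 => /andP[]; nra.
have cpsi n t : `|Ecos P (S n) t| <= psi n t by exact: (Re_le_normc (charfun P (S n) t)).
have spsi n t : `|Esin P (S n) t| <= psi n t by exact: (Im_le_normc (charfun P (S n) t)).
have [delta [D [delta0 iD domD]]] := condition_A_dominates psiE psi1 cA.
have dom_c : \forall n \near \oo, forall s : R, `|s| <= delta * B n ->
    `|Ecos P (S n) (s / B n)| <= D s.
  by apply: filterS domD => n H s /H; exact: le_trans.
have dom_s : \forall n \near \oo, forall s : R, `|s| <= delta * B n ->
    `|Esin P (S n) (s / B n)| <= D s.
  by apply: filterS domD => n H s /H; exact: le_trans.
have cvg_c s := proj1 (cvg_Ecos_Esin SL s).
have cvg_s s := proj2 (cvg_Ecos_Esin SL s).
have near_tail (U : set R) (kappa : R) (q : nat -> R -> R) : condition_B_on a f B U ->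
    (forall t : R, delta <= `|t| <= kappa -> U t) ->
    (forall n t, `|q n t| <= psi n t) ->
    forall e : R, 0 < e -> \forall n \near \oo, forall t : R,
      delta <= `|t| <= kappa -> B n * `|q n t| <= e.
  move=> cB kU qpsi e e0; have B0 := near_B_gt By 0.
  have H := condition_B_tail By psiE cB kU delta0 e0.
  near=> n; move=> t tk; apply: (@le_trans _ _ (B n * psi n t)).
    by apply: ler_wpM2l => //; apply: ltW; near: n.
  by move: t tk; near: n.
pose klim := kernel_local_limit mS By (integrable_Ecos_L icL) (integrable_Esin_L icL)
  (density_inversion icL chL dhL) cvg_c cvg_s delta0 iD dom_c dom_s.
have uh := density_uniformly_continuous icL chL dhL.
have [M [M0 hM]] := density_bounded icL chL dhL.
split=> [_ cB|h latY cB] phi cphi sphi; apply: cvg_ereal_sup0.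
- by exists 0.
- move=> e e0.
  have FL (lam : R) : 0 < lam -> forall e : R, 0 < e -> \forall n \near \oo, forall v : R,
    `|B n * \int[P]_o cos_transform (tri_scaled lam) (S n o + v) -
      2 * pi * hL (- (v / B n))| <= e.
    move=> lam0 e1 e10.
    have U (t : R) : delta <= `|t| <= lam -> t != 0.
      by move=> /andP[dt _]; rewrite -normr_gt0; exact: lt_le_trans dt.
    apply: (klim _ _ (integrable_tri_scaled lam0) (tri_scaled_le1 lam)
      (tri_scaled_eq0 lam0) (cvg_tri_scaled lam)) => //.
      exact: near_tail cB U cpsi.
    exact: near_tail cB U spsi.
  have := nonlattice_limit mS By M0 hM uh FL cphi sphi e0.
  by apply: filterS => n H u _; exact: H.
- by exists 0; exists 0 => //; rewrite mul0r.
- move=> e e0.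
  have latS n : {ae P, forall o, lattice h%:num (S n o)}.
    rewrite SE; elim: n => [|n IH].
      apply: aeW => o; rewrite /partial_sum big_geq//.
      by exists 0 => //; rewrite mul0r.
    apply: filterS2 IH (latY n.+1) => o [i _ iE] [j _ jE].
    rewrite /partial_sum big_nat_recr//= -[X in X + _]/(partial_sum Y n o) -iE -jE.
    by exists (i + j)%R => //; rewrite rmorphD mulrDl.
  have k0 : 0 < pi / h%:num by rewrite divr_gt0// pi_gt0.
  have U (t : R) : delta <= `|t| <= pi / h%:num -> 0 < `|t| <= pi / h%:num.
    by move=> /andP[dt ->]; rewrite andbT; exact: lt_le_trans dt.
  have w0 : cutoff (pi / h%:num) t @[t --> (0 : R)] --> (1 : R).
    apply/cvgrPdist_le => e1 e10; exists (pi / h%:num) => //= t.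
    by move=> /=; rewrite sub0r normrN => /ltW tk; rewrite cutoffE tk subrr normr0 ltW.
  have CL (e1 : R) : 0 < e1 -> \forall n \near \oo, forall v : R,
    `|B n * \int[P]_o cos_transform (cutoff (pi / h%:num)) (S n o + v) -
      2 * pi * hL (- (v / B n))| <= e1.
    apply: (klim _ (pi / h%:num) (integrable_cutoff _) (cutoff_le1 _) _ w0).
    + by move=> t; rewrite cutoffE ltNge => /negbTE->.
    + exact: near_tail cB U cpsi.
    + exact: near_tail cB U spsi.
  have := lattice_limit mS By uh latS CL cphi sphi e0.
  by apply: filterS => n H u; exact: H.
Unshelve. all: by end_near. Qed.
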